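(* Let $M(\mathit{odd})=\{(r^2+r)g(r^2): g\in\mathbb{Z}/2[t]\}\subset\mathbb{Z}/2[r]$ and let $K=\{f\in M(\mathit{odd}): U(f)=f\}$. Then $K=\{f\in\mathbb{Z}/2[r]: U_2f=0 \text{ and } U_3f=f\}$, i.e. $K$ consists of the mod $2$ modular forms of level $\Gamma_0(3)$ annihilated by $U_2$ and $U_3+I$. In particular, $T_p(K)\subseteq K$ for every prime $p>3$.
   Context: $\mathbb{Z}/2[[x]]$ is the formal power series ring over the field with two elements. Let $r=\sum_{n>0}(x^{n^2}+x^{2n^2}+x^{3n^2}+x^{6n^2})$, and $\mathbb{Z}/2[r]\subset\mathbb{Z}/2[[x]]$ the subring generated by $r$ (the space of mod $2$ modular forms of level $\Gamma_0(3)$; $r$ is transcendental over $\mathbb{Z}/2$). Let $F=r(r+1)^3$, $G=r^3(r+1)$. $\mathbb{Z}/2[r]$ is a free $\mathbb{Z}/2[G]$-module with basis $1,r,r^2,r^3$; let $U:\mathbb{Z}/2[r]\to\mathbb{Z}/2[r]$ be $U\big(\sum_{i=0}^3 g_i(G)r^i\big)=\sum_{i=0}^3 g_i(F)U(r^i)$ with $U(1)=1$, $U(r)=r$, $U(r^2)=r^2$, $U(r^3)=r^3+r^2+r$. Operators on $\mathbb{Z}/2[[x]]$: $U_2(\sum a_nx^n)=\sum a_{2n}x^n$, $U_3(\sum a_nx^n)=\sum a_{3n}x^n$, and for primes $p>3$, $T_p(\sum a_nx^n)=\sum a_{pn}x^n+\sum a_nx^{pn}$; these commute and map $\mathbb{Z}/2[r]$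 into itself. *)

(* Defs.v *)
From HB Require Import structures.
From mathcomp Require Import all_boot all_order all_algebra.
From mathcomp Require Import boolp classical_sets.

Set Implicit Arguments.
Unset Strict Implicit.
Unset Printing Implicit Defensive.

Import GRing.Theory.
Local Open Scope ring_scope.

(* Formal power series A[[x]], as coefficient sequences with the Cauchy
   product; a record, because nat -> A already carries a pointwise ring
   structure. *)
Record fps (A : Type) : Type := Fps { coefs : nat -> A }.
Arguments Fps {A} _.
Arguments coefs {A} _ _.

HB.instance Definition _ (A : Type) := gen_eqMixin (fps A).
HB.instance Definition _ (A : Type) := gen_choiceMixin (fps A).

Lemma fpsP (A : Type) (f g : fps A) : (forall n, coefs f n = coefs g n) -> f = g.
Proof. by case: f g => [f] [g] /= fg; congr Fps; apply/funext. Qed.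

Section FpsRing.
Variable A : comNzRingType.
Implicit Types f g h : fps A.

Definition fps_zero : fps A := Fps (fun=> 0).
Definition fps_opp f : fps A := Fps (fun n => - coefs f n).
Definition fps_add f g : fps A := Fps (fun n => coefs f n + coefs g n).
Definition fps_one : fps A := Fps (fun n => (n == 0%N)%:R).
Definition fps_mul f g : fps A :=
  Fps (fun n => \sum_(i < n.+1) coefs f i * coefs g (n - i)).
Definition fps_scale (a : A) f : fps A := Fps (fun n => a * coefs f n).

Lemma fps_addA : associative fps_add.
Proof. by move=> f g h; apply: fpsP => n /=; rewrite addrA. Qed.
Lemma fps_addC : commutative fps_add.
Proof. by move=> f g; apply: fpsP => n /=; rewrite addrC. Qed.
Lemma fps_add0 : left_id fps_zero fps_add.
Proof. by move=> f; apply: fpsP => n /=; rewrite add0r. Qed.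
Lemma fps_addN : left_inverse fps_zero fps_opp fps_add.
Proof. by move=> f; apply: fpsP => n /=; rewrite addNr. Qed.

HB.instance Definition _ :=
  GRing.isZmodule.Build (fps A) fps_addA fps_addC fps_add0 fps_addN.

Definition fps_trunc n f : {poly A} := \poly_(i < n.+1) coefs f i.

Lemma coef_trunc n f i : (i <= n)%N -> (fps_trunc n f)`_i = coefs f i.
Proof. by move=> le_in; rewrite coef_poly ltnS le_in. Qed.

Lemma fps_mul_trunc n f g k : (k <= n)%N ->
  coefs (fps_mul f g) k = (fps_trunc n f * fps_trunc n g)`_k.
Proof.
move=> le_kn; rewrite coefM; apply: eq_bigr => i _.
by rewrite !coef_trunc // ?(leq_trans (leq_subr _ _) le_kn) //
   (leq_trans _ le_kn) // -ltnS.
Qed.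

Lemma fps_mulC : commutative fps_mul.
Proof. by move=> f g; apply: fpsP => n; rewrite !(@fps_mul_trunc n) // mulrC. Qed.

Lemma fps_mulA : associative fps_mul.
Proof.
move=> f g h; apply: fpsP => n.
transitivity ((fps_trunc n f * fps_trunc n g * fps_trunc n h)`_n).
  rewrite -mulrA coefM; apply: eq_bigr => i _.
  by rewrite coef_trunc -1?ltnS // -fps_mul_trunc // leq_subr.
rewrite coefM; apply: eq_bigr => i _.
by rewrite coef_trunc ?leq_subr // -fps_mul_trunc // -ltnS.
Qed.

Lemma fps_mul1 : left_id fps_one fps_mul.
Proof.
move=> f; apply: fpsP => n /=; rewrite big_ord_recl /= mul1r subn0.
by rewrite big1 ?addr0 // => i _; rewrite mul0r.
Qed.

Lemma fps_mulDl : left_distributive fps_mul fps_add.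
Proof.
move=> f g h; apply: fpsP => n /=; rewrite -big_split /=.
by apply: eq_bigr => i _; rewrite mulrDl.
Qed.

Lemma fps_1neq0 : fps_one != 0.
Proof.
by apply/eqP => /(congr1 (fun f => coefs f 0)) /= /eqP; rewrite oner_eq0.
Qed.

HB.instance Definition _ := GRing.Zmodule_isComNzRing.Build (fps A)
  fps_mulA fps_mulC fps_mul1 fps_mulDl fps_1neq0.

Lemma fps_scaleA a b f :
  fps_scale a (fps_scale b f) = fps_scale (a * b) f.
Proof. by apply: fpsP => n /=; rewrite mulrA. Qed.
Lemma fps_scale1 : left_id 1 fps_scale.
Proof. by move=> f; apply: fpsP => n /=; rewrite mul1r. Qed.
Lemma fps_scaleDr : right_distributive fps_scale +%R.
Proof. by move=> a f g; apply: fpsP => n /=; rewrite mulrDr. Qed.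
Lemma fps_scaleDl f : {morph fps_scale^~ f : a b / a + b}.
Proof. by move=> a b; apply: fpsP => n /=; rewrite mulrDl. Qed.

HB.instance Definition _ := GRing.Zmodule_isLmodule.Build A (fps A)
  fps_scaleA fps_scale1 fps_scaleDr fps_scaleDl.

Lemma fps_scaleAl (a : A) (f g : fps A) : a *: (f * g) = (a *: f) * g.
Proof.
apply: fpsP => n /=; rewrite big_distrr /=.
by apply: eq_bigr => i _; rewrite mulrA.
Qed.

HB.instance Definition _ := GRing.Lmodule_isLalgebra.Build A (fps A) fps_scaleAl.
HB.instance Definition _ := GRing.Lalgebra_isComAlgebra.Build A (fps A).

Lemma coefs0 n : coefs (0 : fps A) n = 0. Proof. by []. Qed.
Lemma coefs1 n : coefs (1 : fps A) n = (n == 0%N)%:R. Proof. by []. Qed.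
Lemma coefsD f g n : coefs (f + g) n = coefs f n + coefs g n.
Proof. by []. Qed.
Lemma coefsZ (a : A) f n : coefs (a *: f) n = a * coefs f n. Proof. by []. Qed.
Lemma coefsM f g n :
  coefs (f * g) n = \sum_(i < n.+1) coefs f i * coefs g (n - i).
Proof. by []. Qed.
Lemma coefs_sum (I : Type) (s : seq I) (P : pred I) (F : I -> fps A) n :
  coefs (\sum_(i <- s | P i) F i) n = \sum_(i <- s | P i) coefs (F i) n.
Proof. by apply: (big_morph (fun f => coefs f n)). Qed.

End FpsRing.

Local Notation F2 := 'F_2.

(* r = sum_{n > 0} (x^(n^2) + x^(2n^2) + x^(3n^2) + x^(6n^2)).  The n > m do not
   contribute to the coefficient of x^m. *)
Definition r : fps F2 :=
  Fps (fun m => \sum_(c <- [:: 1; 2; 3; 6]%N) \sum_(1 <= n < m.+1)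
                  (m == c * n ^ 2)%N%:R).

Definition F : fps F2 := r * (r + 1) ^+ 3.
Definition G : fps F2 := r ^+ 3 * (r + 1).

(* [horner_alg f g] is g(f). *)
Definition Zr : set (fps F2) := range (horner_alg r).

Definition U_basis : seq (fps F2) := [:: 1; r; r ^+ 2; r ^+ 3 + r ^+ 2 + r].

(* U is defined on Z/2[r] only, and set to 0 elsewhere; [Zr_basis],
   [Zr_basis_free] and [UE] below show that it is well defined. *)
Definition U (f : fps F2) : fps F2 :=
  xget 0 [set h | exists g : 'I_4 -> {poly F2},
    f = \sum_(i < 4) horner_alg G (g i) * r ^+ i /\
    h = \sum_(i < 4) horner_alg F (g i) * U_basis`_i].

(* U_p: sum a_n x^n |-> sum a_(pn) x^n. *)
Definition Usub (p : nat) (f : fps F2) : fps F2 := Fps (fun n => coefs f (p * n)).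

(* x |-> x^p: sum a_n x^n |-> sum a_n x^(pn). *)
Definition Vsub (p : nat) (f : fps F2) : fps F2 :=
  Fps (fun n => if (p %| n)%N then coefs f (n %/ p) else 0).

Definition T (p : nat) (f : fps F2) : fps F2 := Usub p f + Vsub p f.

Definition Modd : set (fps F2) :=
  [set (r ^+ 2 + r) * horner_alg (r ^+ 2) g | g in [set: {poly F2}]].

Definition K : set (fps F2) := [set f | Modd f /\ U f = f].

Lemma coefs_r0 : coefs r 0 = 0.
Proof. by rewrite [LHS]big1 // => c _; rewrite big_geq. Qed.

Lemma coefs_r1 : coefs r 1 = 1.
Proof.
rewrite /r; cbn [coefs].
under eq_bigr => c _ do rewrite (big_ltn (ltnSn 1)) big_geq // addr0 muln1.
by rewrite !big_cons big_nil /= !addr0.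
Qed.

Lemma coefs_rX k m : (m <= k)%N -> coefs (r ^+ k) m = (m == k)%:R.
Proof.
elim: k m => [|k IHk] m; first by rewrite leqn0 => /eqP->.
move=> le_mk; rewrite exprS coefsM big_ord_recl coefs_r0 mul0r add0r.
case: m le_mk => [|m] le_mk; first by rewrite big_ord0.
rewrite big_ord_recl [coefs r _]coefs_r1 mul1r /= subn1 /= IHk // eqSS.
rewrite big1 ?addr0 // => i _.
have im : (m.+1 - bump 0 (bump 0 i) < m)%N.
  by rewrite /bump /= !add1n subSS ltn_subrL (leq_ltn_trans _ (ltn_ord i)).
have le_mk' : (m <= k)%N by [].
rewrite IHk ?(leq_trans (ltnW im)) //.
by rewrite (ltn_eqF (leq_trans im le_mk')) mulr0.
Qed.

Lemma coefs_horner_r (P : {poly F2}) n :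
  coefs (horner_alg r P) n = \sum_(i < size P) P`_i * coefs (r ^+ i) n.
Proof.
rewrite /horner_alg /horner_morph (@horner_coef_wide _ (size P)) ?size_map_poly //.
rewrite coefs_sum; apply: eq_bigr => i _.
by rewrite coef_map -scalerAl mul1r coefsZ.
Qed.

Lemma r_transcendental (P : {poly F2}) : horner_alg r P = 0 -> P = 0.
Proof.
move=> P0; apply/polyP => k; rewrite coef0.
elim/ltn_ind: k => k IHk; have [lek|ltk] := leqP (size P) k.
  by rewrite nth_default.
have := congr1 (fun f => coefs f k) P0; rewrite coefs_horner_r coefs0.
rewrite (bigD1 (Ordinal ltk)) //= coefs_rX // eqxx mulr1 big1 ?addr0 // => i.
rewrite -val_eqE /= neq_ltn => /orP[ltik|ltki]; first by rewrite IHk ?mul0r.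
by rewrite coefs_rX ?(ltnW ltki) // (ltn_eqF ltki) mulr0.
Qed.

(* G as a polynomial in r. *)
Definition Gpoly : {poly F2} := 'X^3 * ('X + 1).

Lemma horner_Gpoly : horner_alg r Gpoly = G.
Proof. by rewrite /Gpoly rmorphM rmorphXn rmorphD rmorph1 /= horner_algX. Qed.

Lemma horner_algG (g : {poly F2}) : horner_alg G g = horner_alg r (g \Po Gpoly).
Proof.
elim/poly_ind: g => [|g c IHg]; first by rewrite comp_poly0 !rmorph0.
rewrite comp_polyD comp_polyM comp_polyX comp_polyC.
rewrite [LHS]rmorphD [RHS]rmorphD [X in X + _]rmorphM [X in _ = X + _]rmorphM /=.
by rewrite IHg horner_Gpoly horner_algX !horner_algC.
Qed.

Lemma horner_algX_sum (g : 'I_4 -> {poly F2}) :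
  \sum_(i < 4) horner_alg G (g i) * r ^+ i =
  horner_alg r (\sum_(i < 4) (g i \Po Gpoly) * 'X^i).
Proof.
rewrite rmorph_sum; apply: eq_bigr => i _ /=.
by rewrite rmorphM rmorphXn /= horner_algX horner_algG.
Qed.

Lemma Gpoly_monic : Gpoly \is monic.
Proof. by rewrite monicMl ?monicXn // -[1]opprK -polyCN monicXsubC. Qed.

Lemma size_Gpoly : size Gpoly = 5%N.
Proof.
by rewrite size_monicM ?monicXn ?monic_neq0 // -[1]opprK -polyCN ?monicXsubC //
   size_polyXn size_XsubC.
Qed.

(* Splitting off the constant terms of the g_i is Euclidean division by G. *)
Lemma digits_split (g h : 'I_4 -> {poly F2}) (c : 'I_4 -> F2) :
    (forall i, g i = h i * 'X + (c i)%:P) ->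
  \sum_(i < 4) (g i \Po Gpoly) * 'X^i =
  (\sum_(i < 4) (h i \Po Gpoly) * 'X^i) * Gpoly + \sum_(i < 4) c i *: 'X^i.
Proof.
move=> gE; rewrite mulr_suml -big_split; apply: eq_bigr => i _ /=.
rewrite gE comp_polyD comp_polyM comp_polyX comp_polyC mulrDl mul_polyC.
by rewrite mulrAC.
Qed.

Lemma size_digit (c : 'I_4 -> F2) :
  (size (\sum_(i < 4) c i *: 'X^i : {poly F2})%R < size Gpoly)%N.
Proof.
rewrite size_Gpoly ltnS; apply: leq_trans (size_sum _ _ _) _.
apply/bigmax_leqP => i _; apply: leq_trans (size_scale_leq _ _) _.
by rewrite size_polyXn.
Qed.

Lemma Zr_basis f : Zr f ->
  exists g : 'I_4 -> {poly F2}, f = \sum_(i < 4) horner_alg G (g i) * r ^+ i.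
Proof.
case=> P _ <-.
suff [g ->] : exists g : 'I_4 -> {poly F2}, P = \sum_(i < 4) (g i \Po Gpoly) * 'X^i.
  by exists g; rewrite horner_algX_sum.
have [n] := ubnP (size P); elim: n P => // n IHn P ltPn.
have [->|P_neq0] := eqVneq P 0.
  by exists (fun=> 0); rewrite big1 // => i _; rewrite comp_poly0 mul0r.
have [|h hE] := IHn (P %/ Gpoly).
  rewrite -ltnS; apply: leq_trans ltPn; rewrite ltnS size_divp ?monic_neq0 //.
    by rewrite size_Gpoly ltn_subrL size_poly_gt0 P_neq0.
  exact: Gpoly_monic.
exists (fun i => h i * 'X + ((P %% Gpoly)`_i)%:P).
rewrite (digits_split (fun=> erefl)) -hE {1}(divp_eq P Gpoly); congr (_ + _).
have lt4 : (size (P %% Gpoly)%R <= 4)%N.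
  by rewrite -ltnS -size_Gpoly ltn_modpN0 // monic_neq0 // Gpoly_monic.
apply/polyP => k; rewrite coef_sum.
under eq_bigr do rewrite coefZ coefXn.
have [lek|ltk] := leqP 4 k.
  rewrite nth_default ?(leq_trans lt4) // big1 // => i _.
  by rewrite gtn_eqF ?mulr0 // (leq_trans (ltn_ord i)).
rewrite (bigD1 (Ordinal ltk)) //= eqxx mulr1 big1 ?addr0 // => i.
by rewrite -val_eqE /= eq_sym => /negPf->; rewrite mulr0.
Qed.

Lemma Zr_basis_free (g : 'I_4 -> {poly F2}) :
  \sum_(i < 4) horner_alg G (g i) * r ^+ i = 0 -> forall i, g i = 0.
Proof.
rewrite horner_algX_sum => /r_transcendental g0.
have [n] := ubnP (\max_(i < 4) size (g i)).
elim: n g g0 => // n IHn g g0 ltgn.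
pose h i := drop_poly 1 (g i).
have gE i : g i = h i * 'X + ((g i)`_0)%:P.
  rewrite -[LHS](poly_take_drop 1) addrC expr1; congr (_ + _).
  by apply/polyP => -[|k]; rewrite coef_take_poly coefC.
move: (g0); rewrite (digits_split gE) => gG0.
have /= c0 := modp_addl_mul_small (\sum_(i < 4) (h i \Po Gpoly) * 'X^i)
  (size_digit (fun i => (g i)`_0)).
rewrite gG0 mod0p in c0.
move/esym/eqP: gG0; rewrite -c0 addr0 eq_sym mulf_eq0 (negPf (monic_neq0 Gpoly_monic)).
rewrite orbF => /eqP h0.
have coef0 i : (g i)`_0 = 0.
  have := congr1 (fun p : {poly F2} => p`_i) c0.
  rewrite coef0 coef_sum (bigD1 i) //= coefZ coefXn eqxx mulr1 big1 ?addr0 //.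
  move=> j; rewrite -val_eqE /= eq_sym => /negPf ji.
  by rewrite coefZ coefXn ji mulr0.
have [g_0 i|[i gi0]] : (forall i, g i = 0) \/ (exists i, g i != 0).
- by case: (pselect (exists i, g i != 0)) => [|gN]; [right|left => i;
    apply/eqP/negP => /negP gi; apply: gN; exists i].
- exact: g_0.
suff h_0 : forall i, h i = 0.
  by move=> j; rewrite gE h_0 coef0 mul0r add0r.
apply: IHn => //; rewrite -ltnS; apply: leq_trans ltgn; rewrite ltnS.
have gt0 : (0 < \max_(i < 4) size (g i))%N.
  by apply: (bigmax_sup i) => //; rewrite size_poly_gt0.
rewrite -(prednK gt0) ltnS; apply/bigmax_leqP => j _.
rewrite size_drop_poly -subn1 leq_sub2r //; exact: (bigmax_sup j).
Qed.

Lemma horner_algG_sumB (g g' : 'I_4 -> {poly F2}) :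
  \sum_(i < 4) horner_alg G (g' i - g i) * r ^+ i =
  \sum_(i < 4) horner_alg G (g' i) * r ^+ i -
  \sum_(i < 4) horner_alg G (g i) * r ^+ i.
Proof.
rewrite -sumrB; apply: eq_bigr => i _.
by rewrite (raddfB (horner_alg G)) mulrBl.
Qed.

Lemma UE (g : 'I_4 -> {poly F2}) :
  U (\sum_(i < 4) horner_alg G (g i) * r ^+ i) =
  \sum_(i < 4) horner_alg F (g i) * U_basis`_i.
Proof.
apply: xget_unique => [|_ [g' [gg' ->]]]; first by exists g.
have gg0 := etrans (horner_algG_sumB g g')
  (elimT eqP (etrans (subr_eq0 _ _) (introT eqP (esym gg')))).
have {gg0} /= g0 := @Zr_basis_free (fun i => g' i - g i) gg0.
by apply: eq_bigr => i _; rewrite -[g' i](subrK (g i)) g0 add0r.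
Qed.

(* Main.v *)
(* Let x = w^(4 p^2), over a field of characteristic 2 which contains a primitive
   cube root of unity eta and a primitive p-th root of unity z.  The two theta
   series of the Tate curve satisfy quadratic addition formulas, and their
   normalized quotient [kap] is the abscissa on a curve with a_1 = 1 and
   Delta = gam^4.  It is also a sum of v / (1 + v^2) over a geometric progression
   of points v, and this gives kap = 1 + r(x) at the 3-torsion point eta, and
   then F = r (r + 1)^3 = sum_{n odd} x^(n^2).

   For a subgroup C of order p, the same series shows that the sum of the
   kap(eta + Q), Q in C, is 1 + r_C, where r_C is r(x^p) or some r(z^i x^(1/p)),
   so that T_p f(x) is the sum over C of the f(r_C).  By the addition law r_C is
   one rational function over Z/2(r) of kap(Q), where Q generates C; and the
   kap(Q) are the roots of a division polynomial, which is monic over Z/2[r].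
   Hence the symmetric sum T_p f is in Z/2(r) and integral over Z/2[r], so it is
   in Z/2[r].

   Finally r^2 + r = F(x) + F(x^3) yields G = F(x^3), so that U is U_3 on
   Z/2[r]; and M(odd) is the kernel of U_2, which like U_3 commutes with T_p. *)
Require Import Defs.
From HB Require Import structures.
From mathcomp Require Import all_boot all_order all_algebra all_field.
From mathcomp Require Import boolp classical_sets cardinality fsbigop.
From mathcomp Require Import fraction generic_quotient zify ring.

Set Implicit Arguments.
Unset Strict Implicit.
Unset Printing Implicit Defensive.

Import Order.TTheory GRing.Theory Num.Theory.
Local Open Scope classical_set_scope.
Local Open Scope ring_scope.

(** * Sums of power series *)

(** The stability of Z/2[r] under T_p is the bulk of the work. A point v = e w^(4 p b) is handled as
    the pair (b, e). Taking w as the variable turns the exponents at all p-division points into the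
    integers (p m + 2 b)^2, so that all theta series lie in one ring k[[w]] and the abscissas in its
    field of fractions. The curve, y^2 + x y = x^3 + Delta, is never constructed: only abscissas
    occur, and their laws x(2P) = x^2 + Delta / x^2 and x(P + Q) + x(P - Q) = x(P) x(Q) / (x(P) +
    x(Q))^2 are identities between theta quotients. Characteristic 2 makes these elementary.
    Squaring a series doubles its exponents term by term, so that an addition formula is a change of
    variables in a lattice; a sum whose equal terms are paired by an involution vanishes; and p,
    being odd, is 1 in k. The obstacle is to show that a symmetric sum over the subgroups is in
    Z/2(r). In place of a Galois group, linear algebra is used: a matrix over Z/2(r) has the torsion
    abscissas as eigenvalues, and a polynomial in it has the values at these as eigenvalues. *)

Section FiniteSupport.
Variables (V : nmodType).

Lemma fsum_eq_seq (I : choiceType) (P : set I) (X : seq I) (f : I -> V) :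
    uniq X -> (forall i, i \in X -> P i) -> (forall i, P i -> f i != 0 -> i \in X) ->
  \sum_(i \in P) f i = \sum_(i <- X) f i.
Proof.
move=> uX XP fX; rewrite (fsbigE X) //= => [|i Pi iX].
  rewrite big_seq_cond [RHS]big_seq; apply: eq_bigl => i.
  by have [/XP Pi|//] := boolP (i \in X); rewrite mem_set.
by apply/eqP; apply: contraNT iX => /(fX _ Pi).
Qed.

(** Both sides reduce to the finite rectangle spanned by the two projections of the support. *)
Lemma fsum_pair (I J : choiceType) (P : set I) (Q : set J) (f : I -> J -> V) :
    finite_set [set ij : I * J | [/\ P ij.1, Q ij.2 & f ij.1 ij.2 != 0]] ->
  \sum_(i \in P) \sum_(j \in Q) f i j = \sum_(ij \in P `*` Q) f ij.1 ij.2.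
Proof.
set S := [set ij : I * J | _] => finS.
have finP : finite_set (fst @` S) by exact: finite_image.
have finQ : finite_set (snd @` S) by exact: finite_image.
have inner i : P i -> \sum_(j \in Q) f i j = \sum_(j \in snd @` S) f i j.
  move=> Pi; apply/esym/fsbig_widen => [_ [[i' j] [] /= _ ? _ <-//]|j /= [Qj nS]].
  by apply/eqP; apply: contraPT nS => fij; apply; exists (i, j).
transitivity (\sum_(i \in fst @` S) \sum_(j \in snd @` S) f i j).
  transitivity (\sum_(i \in P) \sum_(j \in snd @` S) f i j).
    by apply: eq_fsbigr => i; rewrite inE => Pi; exact: inner.
  apply/esym/fsbig_widen => [_ [[i j] [] /= ? _ _ <-//]|i /= [Pi nS]].
  rewrite -inner // fsbig1 // => j Qj.
  by apply/eqP; apply: contraPT nS => fij; apply; exists (i, j).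
rewrite pair_fsbig //; apply: fsbig_widen.
  move=> -[i j] [] /= [[i1 j1] [/= P1 _ _] <-] [[i2 j2] [/= _ Q2 _] <-].
  by split.
move=> [i j] /= [[/= Pi Qj] nS]; apply/eqP; apply: contraPT nS => fij.
by apply; split; exists (i, j).
Qed.

End FiniteSupport.

Section Series.
Variable k : fieldType.
Implicit Types f g : fps k.

Definition mono (a : k) (e : nat) : fps k := Fps (fun N => if N == e then a else 0).

Lemma coefs_mono a e N : coefs (mono a e) N = if N == e then a else 0.
Proof. by []. Qed.

Lemma coefs_monoM a e f N :
  coefs (mono a e * f) N = if (e <= N)%N then a * coefs f (N - e) else 0.
Proof.
rewrite coefsM; case: leqP => [le_eN|lt_Ne].
  rewrite (bigD1 (Ordinal (le_eN : (e < N.+1)%N))) //= eqxx big1 ?addr0 // => i.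
  by rewrite -val_eqE /= => /negPf ->; rewrite mul0r.
rewrite big1 // => i _ /=; case: eqP => [ie|]; last by rewrite mul0r.
by move: (ltn_ord i); rewrite ie ltnS leqNgt lt_Ne.
Qed.

Lemma mono_mul a b e d : mono a e * mono b d = mono (a * b) (e + d).
Proof.
apply: fpsP => N; rewrite coefs_monoM !coefs_mono.
case: leqP => [le_eN|lt_Ne]; last by rewrite ltn_eqF // ltn_addr.
by rewrite -(eqn_add2l e) subnKC //; case: eqP; rewrite ?mulr0.
Qed.

Lemma mono1 : mono 1 0 = 1.
Proof. by apply: fpsP => N; rewrite coefs_mono coefs1; case: eqP. Qed.

Lemma monoX a e n : mono a e ^+ n = mono (a ^+ n) (e * n).
Proof.
elim: n => [|n IHn]; first by rewrite !expr0 muln0 mono1.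
by rewrite !exprS IHn mono_mul mulnS.
Qed.

Definition fsum (I : choiceType) (P : set I) (F : I -> fps k) : fps k :=
  Fps (fun N => \sum_(i \in P) coefs (F i) N).

(** A sum [\sum_(i \in P)] with infinite support is 0 by convention, so [fsum] is the intended sum
    only under this condition. All degrees up to [N] are taken together, because a coefficient of a
    product involves all lower ones. *)
Definition lfin (I : choiceType) (P : set I) (F : I -> fps k) : Prop :=
  forall N, finite_set [set i | P i /\ exists2 M, (M <= N)%N & coefs (F i) M != 0].

Lemma lfin_seq (I : choiceType) (P : set I) (F : I -> fps k) N : lfin P F ->
  exists X : seq I, [/\ uniq X, (forall i, i \in X -> P i) &
    forall i M, P i -> (M <= N)%N -> coefs (F i) M != 0 -> i \in X].
Proof.
move=> /(_ N)/finite_seqP[X /seteqP[SX XS]]; exists (undup X).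
split=> [|i|i M Pi leMN nz]; first exact: undup_uniq.
  by rewrite mem_undup => /XS[].
by rewrite mem_undup; apply: SX; split=> //; exists M.
Qed.

Lemma lfin_sub (I : choiceType) (P Q : set I) F : P `<=` Q -> lfin Q F -> lfin P F.
Proof.
move=> PQ lfQ N; apply: sub_finite_set (lfQ N) => i /= [Pi ?].
by split=> //; exact: PQ.
Qed.

Lemma lfin_mono (I : choiceType) (P : set I) (a : I -> k) (e : I -> nat) :
  (forall N, finite_set [set i | P i /\ (e i <= N)%N]) -> lfin P (fun i => mono (a i) (e i)).
Proof.
move=> fin N; apply: sub_finite_set (fin N) => i /= [Pi [M leMN]].
by case: (M =P e i) => [<-|_]; rewrite ?eqxx.
Qed.

Lemma coefs_fsum_seq (I : choiceType) (P : set I) (F : I -> fps k) (X : seq I) N :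
    uniq X -> (forall i, i \in X -> P i) ->
    (forall i, P i -> coefs (F i) N != 0 -> i \in X) ->
  coefs (fsum P F) N = coefs (\sum_(i <- X) F i) N.
Proof. by move=> uX XP FX; rewrite coefs_sum; exact: fsum_eq_seq. Qed.

Lemma coefsM_neq0 f g N : coefs (f * g) N != 0 ->
  exists ij : nat * nat, [/\ (ij.1 <= N)%N, (ij.2 <= N)%N, coefs f ij.1 != 0 & coefs g ij.2 != 0].
Proof.
move=> nz; apply: contraPP nz => /forallNP nz; apply/negP; rewrite negbK coefsM.
rewrite big1 // => i _; have := nz (val i, (N - i)%N) => /= {}nz.
apply/eqP; rewrite mulf_eq0; apply/norP => -[nf ng]; apply: nz.
by rewrite -ltnS ltn_ord leq_subr.
Qed.

Lemma eq_coefsM f g h N : (forall M, (M <= N)%N -> coefs g M = coefs h M) ->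
  coefs (f * g) N = coefs (f * h) N.
Proof. by move=> gh; rewrite !coefsM; apply: eq_bigr => i _; rewrite gh // leq_subr. Qed.

Lemma fsumMr (I : choiceType) (P : set I) (F : I -> fps k) f : lfin P F ->
  f * fsum P F = fsum P (fun i => f * F i).
Proof.
move=> lfF; apply: fpsP => N; have [X [uX XP FX]] := lfin_seq N lfF.
rewrite (@coefs_fsum_seq _ _ _ X) //; last first.
  by move=> i Pi /coefsM_neq0[[u v] [/= _ leN _ nz]]; apply: FX nz.
rewrite -mulr_sumr; apply: eq_coefsM => M leMN; apply: coefs_fsum_seq => // i Pi.
exact: FX.
Qed.

Lemma fsumD (I : choiceType) (P : set I) (F G : I -> fps k) : lfin P F -> lfin P G ->
  fsum P F + fsum P G = fsum P (fun i => F i + G i).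
Proof.
move=> lfF lfG; apply: fpsP => N; have [X [uX XP FX]] := lfin_seq N lfF.
have [Y [uY YP GY]] := lfin_seq N lfG.
have uZ := undup_uniq (X ++ Y); have ZP i : i \in undup (X ++ Y) -> P i.
  by rewrite mem_undup mem_cat => /orP[/XP|/YP].
rewrite coefsD !(@coefs_fsum_seq _ _ _ (undup (X ++ Y))) //.
- by rewrite big_split.
- move=> i Pi; rewrite coefsD mem_undup mem_cat => nz; apply: contraNT nz.
  case/norP => nX nY.
  have [F0|/(FX _ _ Pi (leqnn N)) iX] := eqVneq (coefs (F i) N) 0; last by rewrite iX in nX.
  have [G0|/(GY _ _ Pi (leqnn N)) iY] := eqVneq (coefs (G i) N) 0; last by rewrite iY in nY.
  by rewrite F0 G0 addr0.
- by move=> i Pi /(GY _ _ Pi (leqnn N)) iY; rewrite mem_undup mem_cat iY orbT.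
- by move=> i Pi /(FX _ _ Pi (leqnn N)) iX; rewrite mem_undup mem_cat iX.
Qed.

Lemma fsum_fsum (I J : choiceType) (P : set I) (Q : set J) (F : I -> J -> fps k) :
    lfin (P `*` Q) (fun ij => F ij.1 ij.2) ->
  fsum P (fun i => fsum Q (F i)) = fsum (P `*` Q) (fun ij => F ij.1 ij.2).
Proof.
move=> lfF; apply: fpsP => N /=; apply: fsum_pair.
by apply: sub_finite_set (lfF N) => -[i j] [/= Pi Qj nz]; split=> //; exists N.
Qed.

Lemma lfin_mul (I J : choiceType) (P : set I) (Q : set J) F G : lfin P F -> lfin Q G ->
  lfin (P `*` Q) (fun ij => F ij.1 * G ij.2).
Proof.
move=> lfF lfG N; apply: sub_finite_set (finite_setX (lfF N) (lfG N)) => -[i j].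
move=> /= [[/= Pi Qj] [M leMN /coefsM_neq0[[u v] [/= uM vM nu nv]]]].
by split=> /=; split=> //; [exists u|exists v] => //; apply: leq_trans leMN.
Qed.

Lemma fsum_mul (I J : choiceType) (P : set I) (Q : set J) F G : lfin P F -> lfin Q G ->
  fsum P F * fsum Q G = fsum (P `*` Q) (fun ij => F ij.1 * G ij.2).
Proof.
move=> lfF lfG; rewrite -(@fsum_fsum _ _ _ _ (fun i j => F i * G j)); last exact: lfin_mul.
rewrite mulrC fsumMr //; congr fsum; apply: funext => i.
by rewrite mulrC fsumMr.
Qed.

Lemma eq_fsum (I : choiceType) (P : set I) (F G : I -> fps k) :
  (forall i, P i -> F i = G i) -> fsum P F = fsum P G.
Proof.
by move=> FG; apply: fpsP => N; apply: eq_fsbigr => i; rewrite inE => /FG->.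
Qed.

Lemma eq_lfin (I : choiceType) (P : set I) (F G : I -> fps k) :
  (forall i, P i -> F i = G i) -> lfin P F -> lfin P G.
Proof.
move=> FG lfF N; apply: sub_finite_set (lfF N) => i [Pi nz].
by split=> //; rewrite FG.
Qed.

Lemma eq_fsuml (I : choiceType) (P Q : set I) (F : I -> fps k) :
  (forall i, P i <-> Q i) -> fsum P F = fsum Q F.
Proof. by move=> PQ; have -> : P = Q by apply/seteqP; split=> i /PQ. Qed.

(* The change of variables asks for the maps in both directions, which is what
   the concrete reindexings provide. *)
Lemma reindex_fsum (I J : choiceType) (h : I -> J) (h' : J -> I) (P : set I)
    (Q : set J) (F : J -> fps k) :
    (forall i, P i -> Q (h i) /\ h' (h i) = i) ->
    (forall j, Q j -> P (h' j) /\ h (h' j) = j) ->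
  fsum Q F = fsum P (fun i => F (h i)).
Proof.
move=> hP hQ; apply: fpsP => N /=; apply: reindex_fsbig; split.
- by move=> i /hP[].
- move=> i i'; rewrite !inE => /hP[_ {2}<-] /hP[_ {2}<-] -> //.
- by move=> j Qj; have [? ?] := hQ j Qj; exists (h' j).
Qed.

Lemma fsumID (I : choiceType) (A P : set I) F : lfin P F ->
  fsum P F = fsum (P `&` A) F + fsum (P `&` ~` A) F.
Proof.
move=> lfF; apply: fpsP => N; rewrite coefsD /=; apply: full_fsbigID.
apply: sub_finite_set (lfF N) => i [Pi /= /eqP nz].
by split=> //; exists N.
Qed.

Lemma lfin_comp (I J : choiceType) (h : I -> J) (h' : J -> I) (P : set I)
    (Q : set J) (F : J -> fps k) :
    (forall i, P i -> Q (h i) /\ h' (h i) = i) -> lfin Q F ->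
  lfin P (fun i => F (h i)).
Proof.
move=> hP lfF N; apply: sub_finite_set (finite_image h' (lfF N)) => i [Pi nz].
by have [? ?] := hP i Pi; exists (h i).
Qed.

Lemma fsum_set1 (I : choiceType) (i : I) F : fsum [set i] F = F i.
Proof. by apply: fpsP => N /=; rewrite fsbig_set1. Qed.

Hypothesis char2 : 2%N \in [pchar k].

Lemma fps_addff f : f + f = 0.
Proof. by apply: fpsP => N; rewrite coefsD addrr_pchar2. Qed.

(** Equal terms cancel in pairs in characteristic 2; [A] selects one index from each pair, which
    also excludes fixed points of [h]. *)
Lemma fsum_pairing (I : choiceType) (A P : set I) (h : I -> I) F : lfin P F ->
    (forall i, P i -> [/\ P (h i), h (h i) = i, F (h i) = F i & A (h i) <-> ~ A i]) ->
  fsum P F = 0.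
Proof.
move=> lfF hP; rewrite (fsumID A) //.
rewrite (@reindex_fsum _ _ h h (P `&` ~` A)).
- rewrite (@eq_fsum _ _ _ F) ?fps_addff // => i [Pi _].
  by have [] := hP i Pi.
- move=> i [Pi nA]; have [? ? ? [? ?]] := hP i Pi.
  by split=> //; split=> //; tauto.
- move=> i [Pi nA]; have [? hh ? [H1 H2]] := hP i Pi.
  by split=> //; split=> //= /H1; apply.
Qed.

Lemma fps_sqrr f N : coefs (f ^+ 2) (N * 2) = coefs f N ^+ 2.
Proof.
rewrite expr2 coefsM.
have lt : (N < (N * 2).+1)%N by lia.
rewrite (bigD1 (Ordinal lt)) //= (_ : (N * 2 - N)%N = N); last by lia.
rewrite -expr2 (bigID (fun i : 'I__ => (i < N)%N)) /=.
rewrite [X in _ + (X + _)](reindex_inj rev_ord_inj) /=.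
rewrite [X in _ + (X + _)](_ : _ =
  \sum_(i < (N * 2).+1 | (i != Ordinal lt) && ~~ (i < N)%N) coefs f i * coefs f (N * 2 - i)).
  by rewrite addrr_pchar2 ?addr0.
apply: eq_big => i; rewrite -!val_eqE /=; first by move: (ltn_ord i); lia.
move=> _; rewrite mulrC; congr (coefs f _ * coefs f _); move: (ltn_ord i); lia.
Qed.

Lemma fps_sqrr_odd f N : odd N -> coefs (f ^+ 2) N = 0.
Proof.
move=> oN; rewrite expr2 coefsM (bigID (fun i : 'I__ => (i < N./2.+1)%N)) /=.
rewrite [X in X + _](reindex_inj rev_ord_inj) /=.
rewrite [X in X + _](_ : _ = \sum_(i < N.+1 | ~~ (i < N./2.+1)%N) coefs f i * coefs f (N - i)).
  by rewrite addrr_pchar2.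
apply: eq_big => i /=; first by move: (ltn_ord i); lia.
move=> _; rewrite mulrC; congr (coefs f _ * coefs f _); move: (ltn_ord i); lia.
Qed.

(** Frobenius is additive on infinite sums as well: the square of a series has no odd coefficients,
    and its even ones are the squares of the original coefficients. *)
Lemma fsum_sqr (I : choiceType) (P : set I) (F : I -> fps k) : lfin P F ->
  fsum P F ^+ 2 = fsum P (fun i => F i ^+ 2).
Proof.
move=> lfF; apply: fpsP => N; have [oN|eN] := boolP (odd N).
  by rewrite fps_sqrr_odd //; symmetry; apply: fsbig1 => i _; apply: fps_sqrr_odd.
have -> : N = (N./2 * 2)%N by rewrite muln2 even_halfK.
have [X [uX XP FX]] := lfin_seq N./2 lfF.
rewrite fps_sqrr !(@coefs_fsum_seq _ _ _ X) //.
- rewrite !coefs_sum -[LHS](pFrobenius_autE char2) rmorph_sum /=.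
  by apply: eq_bigr => i _; apply/esym/fps_sqrr.
- by move=> i Pi; rewrite fps_sqrr expf_eq0 /=; exact: FX.
- by move=> i Pi; exact: FX.
Qed.

End Series.

(* Only a power series with nonzero constant term is invertible, but the
   classical definition spares us the computation of the inverse. *)
Section FpsDomain.
Variable k : fieldType.
Implicit Types f g : fps k.

Definition fps_unit : pred (fps k) := fun f => `[< exists g, g * f = 1 >].
Definition fps_inv f : fps k :=
  if pselect (exists g, g * f = 1) is left ex then projT1 (cid ex) else f.

Lemma fps_mulVr : {in fps_unit, left_inverse 1 fps_inv *%R}.
Proof.
move=> f /asboolP ex; rewrite /fps_inv; case: pselect => // ex'; by case: (cid ex').
Qed.

Lemma fps_unitP f g : g * f = 1 -> fps_unit f.
Proof. by move=> gf; apply/asboolP; exists g. Qed.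

Lemma fps_invr_out : {in [predC fps_unit], fps_inv =1 id}.
Proof.
move=> f /asboolP nex; rewrite /fps_inv; case: pselect => // ex; by case: nex.
Qed.

HB.instance Definition _ := GRing.ComNzRing_hasMulInverse.Build (fps k)
  fps_mulVr fps_unitP fps_invr_out.

Lemma fps_neq0P f : f != 0 ->
  exists n, coefs f n != 0 /\ forall m, (m < n)%N -> coefs f m = 0.
Proof.
move=> nz; have ex : exists n, coefs f n != 0.
  apply: contraPP nz => /forallNP f0; apply/negP; rewrite negbK; apply/eqP/fpsP => n.
  by apply/eqP; rewrite -[_ == _]negbK; apply/negP/f0.
exists (ex_minn ex); case: ex_minnP => n nzn min; split=> // m lt_mn.
by apply/eqP; apply: contraTT lt_mn => /min; rewrite -leqNgt.
Qed.

Lemma fps_integral : GRing.integral_domain_axiom (fps k).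
Proof.
move=> f g fg0; apply/norP => -[/fps_neq0P[m [nzm minm]] /fps_neq0P[n [nzn minn]]].
have := congr1 (fun h => coefs h (m + n)) fg0; rewrite coefsM coefs0.
have lt : (m < (m + n).+1)%N by rewrite ltnS leq_addr.
rewrite (bigD1 (Ordinal lt)) //= addKn big1 ?addr0 => [/eqP|i].
  by rewrite mulf_eq0 (negPf nzm) (negPf nzn).
rewrite -val_eqE /= neq_ltn => /orP[/minm->|lt_mi]; first by rewrite mul0r.
by rewrite minn ?mulr0 //; move: (ltn_ord i); lia.
Qed.

HB.instance Definition _ := GRing.ComUnitRing_isIntegral.Build (fps k) fps_integral.

End FpsDomain.

(** * Theta series *)

Lemma finite_int_box (B : nat) : finite_set [set m : int | (`|m| <= B)%N].
Proof.
pose s := map Posz (iota 0 B.+1) ++ map (fun n => - n%:Z) (iota 0 B.+1).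
apply/finite_seqP; exists s; apply/seteqP; split=> m /=; rewrite /s mem_cat.
  move=> le; apply/orP; case: (lerP 0 m) => m0; [left|right]; apply/mapP;
  by exists `|m|%N; rewrite ?mem_iota; lia.
by case/orP => /mapP[n]; rewrite mem_iota => n_le ->; lia.
Qed.

Lemma absz_sqr (z : int) : (`|z| ^ 2)%N = z ^+ 2 :> int.
Proof. by rewrite -mulnn PoszM -!expr2; lia. Qed.

Lemma absz_sqr2 (z : int) : (`|z| ^ 2 * 2)%N = z ^+ 2 * 2 :> int.
Proof. by rewrite PoszM absz_sqr. Qed.

Section Theta.
Variables (k : fieldType) (p : nat).
Hypothesis odd_p : odd p.

Definition par (j : bool) : set int := [set m | odd `|m| = j].

(* With x = w^(4 p^2) and v = e w^(4 p b), the m-th term is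
   w^(4 b^2) v^m x^(m^2 / 4). *)
Definition theta (j : bool) (b : int) (e : k) : fps k :=
  fsum (par j) (fun m => mono (e ^ m) (`|p%:Z * m + 2 * b| ^ 2)).

(** This is half of [theta true 0 1], which is itself 0 because m and - m cancel. It is also the
    leading coefficient of [theta true] in v + 1/v at v = 1, as (v^m + v^(-m)) / (v + 1/v) takes the
    value m = 1 there. *)
Definition gam : fps k :=
  fsum [set m : int | odd `|m| /\ 0 < m] (fun m => mono 1 (`|p%:Z * m| ^ 2)).

Lemma fin_theta (P : set int) b N :
  finite_set [set m : int | P m /\ (`|(p%:Z * m + 2 * b)%R| ^ 2 <= N)%N].
Proof.
apply: sub_finite_set (finite_int_box (N + 2 * `|b|)) => m [_ /=] le.
have : (`|(p%:Z * m + 2 * b)%R| <= N)%N.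
  by apply: leq_trans le; case: `|_|%N => // n; rewrite -mulnn leq_pmulr.
have : (`|m| <= p * `|m|)%N by rewrite leq_pmull //; lia.
have -> : (p * `|m| = `|(p%:Z * m)%R|)%N by rewrite abszM.
move: (p%:Z * m) => z; lia.
Qed.

Lemma lfin_theta (P : set int) b (a : int -> k) :
  lfin P (fun m => mono (a m) (`|p%:Z * m + 2 * b| ^ 2)).
Proof. by apply: lfin_mono => N; exact: fin_theta. Qed.

Lemma lfin_theta2 (P : set int) b (a : int -> k) :
  lfin P (fun m => mono (a m) (`|p%:Z * m + 2 * b| ^ 2 * 2)).
Proof.
apply: lfin_mono => N; apply: sub_finite_set (fin_theta P b N) => m [Pm le].
by split=> //; apply: leq_trans le; rewrite leq_pmulr.
Qed.

Lemma lfin_pair (I J : choiceType) (P : set I) (Q : set J) (a : I -> k) (b : J -> k)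
    (d : I -> nat) (e : J -> nat) :
    lfin P (fun m => mono (a m) (d m)) -> lfin Q (fun m => mono (b m) (e m)) ->
  lfin (P `*` Q) (fun mn => mono (a mn.1 * b mn.2) (d mn.1 + e mn.2)).
Proof.
move=> lfP lfQ; have := lfin_mul lfP lfQ.
by congr lfin; apply: funext => -[m n] /=; rewrite mono_mul.
Qed.

Lemma fsum_mono_mul (I J : choiceType) (P : set I) (Q : set J) (a : I -> k) (b : J -> k)
    (d : I -> nat) (e : J -> nat) :
    lfin P (fun m => mono (a m) (d m)) -> lfin Q (fun m => mono (b m) (e m)) ->
  fsum P (fun m => mono (a m) (d m)) * fsum Q (fun m => mono (b m) (e m)) =
  fsum (P `*` Q) (fun mn => mono (a mn.1 * b mn.2) (d mn.1 + e mn.2)).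
Proof.
move=> lfP lfQ; rewrite fsum_mul //.
by apply: eq_fsum => -[m n] _ /=; rewrite mono_mul.
Qed.

Lemma thetaN j b e : theta j (- b) e^-1 = theta j b e.
Proof.
rewrite {1}/theta (@reindex_fsum _ _ _ (fun m => - m) (fun m => - m) (par j)).
- apply: eq_fsum => m _; congr mono; first by rewrite exprz_inv opprK.
  by apply/eqP; rewrite -eqz_nat !absz_sqr; apply/eqP; ring.
- by move=> m; rewrite /par /= => <-; split; lia.
- by move=> m; rewrite /par /= => <-; split; lia.
Qed.

(** Translation by the period x of the Tate curve is the reindexing m -> m + 2, which preserves
    parity; the normalizing factor w^(4 b^2) absorbs every power of w. *)
Lemma theta_shift j (b : int) (e : k) : e != 0 ->
  theta j (b + p%:Z) e = mono (e ^ (- 2%:Z)) 0 * theta j b e.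
Proof.
move=> e0; rewrite /theta fsumMr; last exact: lfin_theta.
rewrite (@reindex_fsum _ _ _ (fun m => m - 2) (fun m => m + 2) (par j)).
- apply: eq_fsum => m _; rewrite mono_mul -expfzDr //; congr mono; first by congr (_ ^ _); lia.
  by apply/eqP; rewrite -eqz_nat !absz_sqr; apply/eqP; ring.
- by move=> m; rewrite /par /= => <-; split; lia.
- by move=> m; rewrite /par /= => <-; split; lia.
Qed.

Hypothesis char2 : 2%N \in [pchar k].

Lemma sqr_theta j b e : theta j b e ^+ 2 =
  fsum (par j) (fun m => mono ((e ^ m) ^+ 2) (`|p%:Z * m + 2 * b| ^ 2 * 2)).
Proof.
rewrite /theta (fsum_sqr char2); last exact: lfin_theta.
by apply: eq_fsum => m _; rewrite monoX.
Qed.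

(** Pairs (m, n) of equal parity are the (a + c, a - c), and the sum of the two exponents becomes 2
    (p a + 2 b)^2 + 2 (p c + 2 b')^2. Doubled exponents belong to the squares of the series, and the
    parity of a separates the two products. *)
Lemma thetaM j (b b' : int) (e e' : k) : e != 0 -> e' != 0 ->
  theta j (b + b') (e * e') * theta j (b - b') (e / e') =
  theta false b e ^+ 2 * theta j b' e' ^+ 2 +
  theta true b e ^+ 2 * theta (~~ j) b' e' ^+ 2.
Proof.
move=> e0 e0'; rewrite fsum_mono_mul; try exact: lfin_theta.
pose h (ac : int * int) := (ac.1 + ac.2, ac.1 - ac.2).
pose h' (mn : int * int) := (((mn.1 + mn.2) %/ 2)%Z, ((mn.1 - mn.2) %/ 2)%Z).
pose P := [set ac : int * int | odd `|(ac.1 + ac.2)%R|%N = j].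
pose F (ac : int * int) := mono ((e ^ ac.1) ^+ 2 * (e' ^ ac.2) ^+ 2)
  (`|(p%:Z * ac.1 + 2 * b)%R| ^ 2 * 2 + `|(p%:Z * ac.2 + 2 * b')%R| ^ 2 * 2)%N.
rewrite (@reindex_fsum _ _ _ h h' P) /=; first last.
- case=> m n [/= Hm Hn]; rewrite /P /par /h /h' /=.
  have -> : ((m + n) %/ 2)%Z + ((m - n) %/ 2)%Z = m by move: Hm Hn; rewrite /par /=; lia.
  by have -> : ((m + n) %/ 2)%Z - ((m - n) %/ 2)%Z = n by move: Hm Hn; rewrite /par /=; lia.
- by case=> a c; rewrite /P /par /h /h' /= => ?; split; [split|congr pair]; lia.
rewrite (@eq_fsum _ _ _ _ F) => [|[a c] _]; last first.
  rewrite /F /h /=; congr mono.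
    rewrite !expfzMl exprz_inv mulrACA -!expfzDr // ?invr_eq0 // !exprnP !exprz_exp.
    by congr (_ ^ _ * _ ^ _); lia.
  apply/eqP; rewrite -eqz_nat !PoszD !absz_sqr2 !absz_sqr; apply/eqP; ring.
have lfP : lfin [set: int * int] F.
  have := lfin_pair (@lfin_theta2 setT b (fun m => (e ^ m) ^+ 2))
    (@lfin_theta2 setT b' (fun m => (e' ^ m) ^+ 2)).
  by apply: lfin_sub => -[].
rewrite (fsumID [set ac | odd `|ac.1|%N = false]); last exact: lfin_sub lfP.
rewrite !sqr_theta !fsum_mono_mul; try exact: lfin_theta2.
by congr (_ + _); apply: eq_fsuml => -[a c]; rewrite /P /par /=; split; lia.
Qed.

Lemma theta_double_even (b : int) (e : k) :
  theta false (b * 2) (e ^+ 2) = theta false b e ^+ 4 + theta true b e ^+ 4.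
Proof.
have fourth j : theta j b e ^+ 4 =
    fsum (par j) (fun m => mono ((e ^ m) ^+ 4) (`|p%:Z * m + 2 * b| ^ 2 * 4)).
  rewrite (exprM _ 2 2) sqr_theta (fsum_sqr char2); last exact: lfin_theta2.
  by apply: eq_fsum => m _; rewrite monoX -!exprM -mulnA.
pose F m : fps k := mono ((e ^ m) ^+ 4) (`|p%:Z * m + 2 * b| ^ 2 * 4).
rewrite !fourth (_ : theta _ _ _ = fsum setT F).
  rewrite (fsumID [set m | odd `|m|%N = false]).
    by congr (_ + _); apply: eq_fsuml => m; rewrite /par /=; split; lia.
  apply: lfin_mono => N; apply: sub_finite_set (fin_theta setT b N) => m [_ le].
  by split=> //; apply: leq_trans le; rewrite leq_pmulr.
rewrite /theta (@reindex_fsum _ _ _ (fun m => m * 2) (fun m => (m %/ 2)%Z) setT).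
- apply: eq_fsum => m _; congr mono.
    by rewrite !exprnP !exprz_exp; congr (_ ^ _); lia.
  by apply/eqP; rewrite -eqz_nat absz_sqr PoszM absz_sqr; apply/eqP; ring.
- by move=> m _; rewrite /par /=; split; lia.
- by move=> m; rewrite /par /= => ?; split; lia.
Qed.

(** For a even and c odd, 2 (p a + 2 b)^2 + 2 (p c + 2 b)^2 = (p (a - c))^2 + (p (a + c) + 4 b)^2.
    Only the square of a - c enters, which is why the positive odd integers of [gam] suffice. *)
Lemma theta_double_odd (b : int) (e : k) : e != 0 ->
  theta false b e ^+ 2 * theta true b e ^+ 2 = gam * theta true (b * 2) (e ^+ 2).
Proof.
move=> e0; rewrite !sqr_theta fsum_mono_mul; try exact: lfin_theta2.
have lfg : lfin [set m : int | odd `|m| /\ 0 < m] (fun m => mono (1 : k) (`|p%:Z * m| ^ 2)).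
  apply: lfin_mono => N.
  by apply: sub_finite_set (fin_theta [set m | odd `|m| /\ 0 < m] 0 N) => m /=; rewrite mulr0 addr0.
rewrite /gam /theta fsum_mono_mul //; last exact: lfin_theta.
(* d = +-(a - c) and m = a + c, where a is even and c is odd: the sign of d is
   determined by m mod 4. *)
pose sg (d m : int) : int := if ((d + m) %% 4 == 0)%Z then d else - d.
pose h (dm : int * int) := (((dm.2 + sg dm.1 dm.2) %/ 2)%Z, ((dm.2 - sg dm.1 dm.2) %/ 2)%Z).
pose h' (ac : int * int) := (`|ac.1 - ac.2|%:Z, ac.1 + ac.2).
rewrite (@reindex_fsum _ _ _ h h' ([set m : int | odd `|m| /\ 0 < m] `*` par true)).
- apply: eq_fsum => -[d m] [/= [od d0] om]; rewrite /par /= in om.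
  have [a [c [dE mE -> ->]]] : exists a c, [/\ sg d m = a - c, m = a + c,
      ((m + sg d m) %/ 2)%Z = a & ((m - sg d m) %/ 2)%Z = c].
    exists ((m + sg d m) %/ 2)%Z, ((m - sg d m) %/ 2)%Z.
    by rewrite /sg; case: ifP => ?; split=> //; lia.
  rewrite mul1r mE; congr mono.
    by rewrite !exprnP !exprz_exp -expfzDr //; congr (_ ^ _); lia.
  apply/eqP; rewrite -eqz_nat !PoszD !absz_sqr2 !absz_sqr.
  have -> : (p%:Z * d) ^+ 2 = (p%:Z * (a - c)) ^+ 2.
    by rewrite -dE /sg; case: ifP => // _; rewrite mulrN sqrrN.
  by apply/eqP; ring.
- case=> d m [/= [od d0] om]; rewrite /par /= in om *; rewrite /h /h' /sg /=.
  by case: ifP => ?; split; [split|congr pair|split|congr pair]; lia.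
- case=> a c [/= oa oc]; rewrite /par /= in oa oc *; rewrite /h /h' /sg /=.
  by case: ifP => ?; split; [split; [split|]|congr pair|split; [split|]|congr pair]; lia.
Qed.

End Theta.

(** * Lambert series along a geometric progression of points *)

Section Lambert.
Variables (k : fieldType) (p : nat).
Hypothesis char2 : 2%N \in [pchar k].
Hypothesis odd_p : odd p.

Definition geo (u : k) (d : nat) : fps k :=
  fsum [set j : nat | odd j] (fun j => mono (u ^+ j : k) (d * j)).

(* v / (1 + v^2) for v = e * w^(d * s), which does not change under v -> 1/v *)
Definition lam (d : nat) (e : k) (s : int) : fps k :=
  if s == 0 then mono (e / (1 + e ^+ 2)) 0
  else if 0 < s then geo e (d * `|s|) else geo e^-1 (d * `|s|).

Lemma lfin_geo u d : (0 < d)%N -> lfin [set j : nat | odd j] (fun j => mono (u ^+ j : k) (d * j)).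
Proof.
move=> d0; apply: lfin_mono => N; apply: (sub_finite_set _ (finite_II N.+1)) => j /= [_ le].
by rewrite ltnS (leq_trans _ le) // leq_pmull.
Qed.

Lemma coefs_lam_neq0 d e s N : (0 < d)%N -> coefs (lam d e s) N != 0 -> (`|s| <= N)%N.
Proof.
move=> d0; rewrite /lam; have [->|s0] := eqVneq s 0; first by [].
have geo_ge u : coefs (geo u (d * `|s|)) N != 0 -> (`|s| <= N)%N.
  apply: contraNT; rewrite -ltnNge => lt; apply/eqP; apply: fsbig1 => j /= oj.
  case: (N =P _) => // NE; move: lt; rewrite NE ltnNge => /negP[].
  by rewrite mulnAC leq_pmull // muln_gt0 d0; case: j oj {NE}.
by case: ifP => _; exact: geo_ge.
Qed.

Definition lambert d b e := fsum [set: int] (fun n => lam d e (p%:Z * n + b)).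

Lemma lfin_lambert d b e : (0 < d)%N ->
  lfin [set: int] (fun n => lam d e (p%:Z * n + b)).
Proof.
move=> d0 N; apply: sub_finite_set (finite_int_box (N + `|b|)) => n.
move=> /= [_ [M le /(coefs_lam_neq0 d0) sM]].
have : (`|n| <= p * `|n|)%N by rewrite leq_pmull //; lia.
have -> : (p * `|n| = `|(p%:Z * n)%R|)%N by rewrite abszM.
by move: (p%:Z * n) sM => z; lia.
Qed.

Let Om : set (int * int) :=
  [set mj | [/\ odd `|mj.1|%N, ~~ odd `|mj.2|%N & (`|mj.2|%:Z < mj.1)]].

Let expo b (n m j : int) : nat :=
  `|p%:Z ^+ 2 * (m ^+ 2 - j ^+ 2) + (p%:Z * (2 * n + j) + 2 * b) ^+ 2|.

(** A term of [theta true] times the n-th Lambert term: m + 2 n is the index in the theta series and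
    |j - m| the index in the geometric series. In these variables the term is even in m. On [Om] the
    integer inside [expo] is nonnegative, so that the absolute value changes nothing there. *)
Let F b e n (mj : int * int) := mono (e ^ (2 * n + mj.2) : k) (expo b n mj.1 mj.2).

Lemma expo_Om b n m j : Om (m, j) -> expo b n m j =
  (p ^ 2 * `|(m ^+ 2 - j ^+ 2)%R| + `|(p%:Z * (2 * n + j) + 2 * b)%R| ^ 2)%N.
Proof.
case=> /= om oj ltjm; rewrite /expo.
have mj0 : 0 <= m ^+ 2 - j ^+ 2 by nia.
have -> : p%:Z ^+ 2 * (m ^+ 2 - j ^+ 2) + (p%:Z * (2 * n + j) + 2 * b) ^+ 2 =
    (p ^ 2 * `|(m ^+ 2 - j ^+ 2)%R| + `|(p%:Z * (2 * n + j) + 2 * b)%R| ^ 2)%N.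
  by rewrite PoszD absz_sqr PoszM gez0_abs // -mulnn PoszM expr2.
by [].
Qed.

Lemma fin_Om N : finite_set [set mj | Om mj /\ (p ^ 2 * `|(mj.1 ^+ 2 - mj.2 ^+ 2)%R| <= N)%N].
Proof.
apply: sub_finite_set (finite_setX (finite_int_box N) (finite_int_box N)) => -[m j] /=.
case=> -[/= om oj ltjm] le.
have : (`|(m ^+ 2 - j ^+ 2)%R| <= N)%N.
  by apply: leq_trans le; rewrite leq_pmull // expn_gt0; case: (p) odd_p.
by move=> ?; split => /=; nia.
Qed.

Let Sg (sg : int) : set (int * int) :=
  [set mj | [/\ odd `|mj.1|%N, ~~ odd `|mj.2|%N & 0 < sg * (mj.2 - mj.1)]].

Lemma F_opp b e n m j : F b e n (- m, j) = F b e n (m, j).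
Proof. by rewrite /F /expo /= sqrrN. Qed.

(** Since the terms are even in m, those with |m| < |j| cancel in pairs. Where |j| < |m|, the sign
    of j - m is that of - m, so both half planes leave the same sum over [Om]. *)
Lemma fsum_Sg sg b e n : sg = 1 \/ sg = -1 -> lfin (Sg sg) (F b e n) ->
  fsum (Sg sg) (F b e n) = fsum Om (F b e n).
Proof.
move=> sgE lfF; rewrite (fsumID [set mj | `|mj.2| < `|mj.1|]) //.
rewrite [X in _ + X](fsum_pairing char2 (A := [set mj | 0 < mj.1])
  (h := fun mj => (- mj.1, mj.2))) ?addr0.
- pose h (mj : int * int) := (- sg * mj.1, mj.2).
  rewrite (@reindex_fsum _ _ _ h h Om).
  + apply: eq_fsum => -[m j] _; rewrite /h /=.
    by case: sgE => ->; rewrite ?opprK ?mul1r // mulN1r F_opp.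
  + by case=> m j [/= om oj lt]; rewrite /h /=; case: sgE => ->; split;
      [split; [split|]|congr pair|split; [split|]|congr pair] => //=; lia.
  + by case=> m j [[/= om oj lt] lt2]; rewrite /h /=; case: sgE lt => -> lt; split;
      [split|congr pair|split|congr pair] => //=; lia.
- exact: lfin_sub lfF.
- case=> m j [[/= om oj lt] lt2]; rewrite opprK F_opp; split=> //=; last by lia.
  by split; [split=> //=|]; case: sgE lt => ->; lia.
Qed.

Lemma theta_lam_sign (sg : int) b e n : e != 0 -> sg = 1 \/ sg = -1 ->
    0 < sg * (p%:Z * n + b) ->
  theta p true b e * lam (4 * p) e (p%:Z * n + b) = fsum Om (F b e n).
Proof.
move=> e0 sgE; set s := p%:Z * n + b => s0.
have d0 : (0 < 4 * p * `|s|)%N.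
  by rewrite !muln_gt0 (odd_gt0 odd_p) /= absz_gt0; apply: contraTneq s0 => ->; rewrite mulr0.
have -> : lam (4 * p) e s = geo (e ^ sg) (4 * p * `|s|).
  rewrite /lam; case: sgE s0 => ->.
    by rewrite mul1r => s0; rewrite gt_eqF // s0.
  by rewrite mulN1r oppr_gt0 => s0; rewrite lt_eqF // ltNge ltW //= exprN1.
have lft := lfin_theta odd_p (par true) b (fun m => e ^ m).
have lfg := lfin_geo (e ^ sg) d0.
rewrite fsum_mono_mul //.
pose h (mj : int * int) := (mj.1 + 2 * n, `|mj.2 - mj.1|%N).
pose h' (mj : int * nat) := (mj.1 - 2 * n, mj.1 - 2 * n + sg * mj.2%:Z).
have hP mj : Sg sg mj -> (par true `*` [set j | odd j]) (h mj) /\ h' (h mj) = mj.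
  case: mj => m j [/= om oj lt]; rewrite /h /h' /par /=.
  by case: sgE lt => ->; split; [split|congr pair|split|congr pair]; lia.
have hE mj : Sg sg mj ->
    mono (e ^ (h mj).1 * (e ^ sg) ^+ (h mj).2)
      (`|(p%:Z * (h mj).1 + 2 * b)%R| ^ 2 + 4 * p * `|s| * (h mj).2) = F b e n mj.
  case: mj => m j [/= om oj lt]; rewrite /F /h /=; congr mono.
    rewrite exprnP exprz_exp -expfzDr //; congr (_ ^ _).
    by case: sgE lt => ->; lia.
  rewrite /expo.
  have -> : p%:Z ^+ 2 * (m ^+ 2 - j ^+ 2) + (p%:Z * (2 * n + j) + 2 * b) ^+ 2 =
    (`|(p%:Z * (m + 2 * n) + 2 * b)%R| ^ 2 + 4 * p * `|s| * `|(j - m)%R|)%N.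
    rewrite PoszD absz_sqr -mulnA PoszM -abszM gez0_abs; last first.
      by case: sgE lt s0 => ->; nia.
    by rewrite PoszM /s; ring.
  by [].
rewrite (reindex_fsum _ hP); last first.
  move=> [m j] [/= om oj]; rewrite /h /h' /par /= in om oj *.
  by case: sgE => ->; split; [split|congr pair|split|congr pair]; rewrite /=; lia.
rewrite (eq_fsum hE) fsum_Sg //.
exact: eq_lfin hE (lfin_comp hP (lfin_pair lft lfg)).
Qed.

(** Here v = e is constant and v / (1 + v^2) has no expansion in w. But the exponent p^2 m^2 of a
    term no longer depends on j, so multiplication by 1 + e^2, which shifts j by 2, makes the sum
    over j telescope; the two ends, over all m, are the two halves of the theta series. *)
Lemma theta_lam0 b e n : e != 0 -> e ^+ 2 != 1 -> p%:Z * n + b = 0 ->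
  theta p true b e * lam (4 * p) e 0 = fsum Om (F b e n).
Proof.
move=> e0 e1 s0; have e2 : 1 + e ^+ 2 != 0.
  by rewrite addr_eq0 oppr_pchar2 // eq_sym.
have -> : lam (4 * p) e 0 = mono (e / (1 + e ^+ 2)) 0 by rewrite /lam eqxx.
have FE mj : F b e n mj = mono (e ^ (2 * n + mj.2)) (`|p%:Z * mj.1| ^ 2).
  rewrite /F /expo (_ : p%:Z ^+ 2 * _ + _ = (p%:Z * mj.1) ^+ 2) ?abszX //.
  have -> : b = - (p%:Z * n) by apply/eqP; rewrite -addr_eq0 addrC s0.
  ring.
pose Om' : set (int * int) :=
  [set mj | [/\ odd `|mj.1|%N, ~~ odd `|mj.2|%N & (`|mj.2 - 2|%:Z < mj.1)]].
have lfbox (P : set (int * int)) : P `<=` (fun mj => `|mj.2|%N <= `|mj.1| + 1)%N -> lfin P (F b e n).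
  move=> sub; apply: (eq_lfin (fun mj _ => esym (FE mj))); apply: lfin_mono => N.
  have := finite_setX (finite_int_box N) (finite_int_box (N + 1)).
  apply: sub_finite_set => -[m j] [/sub /= jm le].
  have : (`|m| <= N)%N.
    have sq : (`|m| <= `|m| ^ 2)%N by rewrite -mulnn; case: `|m|%N => // ?; rewrite leq_pmulr.
    by apply: leq_trans le; rewrite abszM expnMn (leq_trans sq) // leq_pmull // expn_gt0 odd_gt0.
  by move=> ?; split => /=; lia.
have lfO : lfin Om (F b e n) by apply: lfbox => -[m j] [/= *]; lia.
have lfO' : lfin Om' (F b e n) by apply: lfbox => -[m j] [/= *]; lia.
have shiftE : mono (e ^+ 2) 0 * fsum Om (F b e n) = fsum Om' (F b e n).
  rewrite fsumMr // [RHS](@reindex_fsum _ _ _ (fun mj => (mj.1, mj.2 + 2)) (fun mj => (mj.1, mj.2 - 2)) Om).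
  - apply: eq_fsum => -[m j] _; rewrite !FE mono_mul add0n /= exprnP -expfzDr //.
    by congr mono; congr (_ ^ _); lia.
  - by case=> m j [/= om oj lt]; split; [split|congr pair] => //=; lia.
  - by case=> m j [/= om oj lt]; split; [split|congr pair] => //=; lia.
have eS m : e * e ^ m = e ^ (1 + m) by rewrite expfzDr // expr1z.
have key : mono (1 + e ^+ 2) 0 * fsum Om (F b e n) = mono e 0 * theta p true b e.
  have -> : mono (1 + e ^+ 2) 0 = 1 + mono (e ^+ 2) 0 :> fps k.
    by rewrite -mono1; apply: fpsP => N; rewrite coefsD !coefs_mono; case: eqP; rewrite ?addr0.
  rewrite mulrDl mul1r shiftE.
  rewrite (fsumID [set mj | `|mj.2 - 2|%:Z < mj.1] lfO) (fsumID [set mj | `|mj.2|%:Z < mj.1] lfO').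
  rewrite [X in _ + (X + _)](_ : _ = fsum (Om `&` [set mj | `|mj.2 - 2|%:Z < mj.1]) (F b e n)); last first.
    by apply: eq_fsuml => -[m j]; rewrite /Om /Om' /=; split=> -[[? ? ?] ?].
  rewrite addrACA fps_addff // add0r.
  rewrite /theta fsumMr; last exact: lfin_theta.
  pose H m : fps k := mono e 0 * mono (e ^ m) (`|p%:Z * m + 2 * b| ^ 2).
  have lfH : lfin (par true) H.
    apply: eq_lfin (lfin_theta odd_p (par true) b (fun m => e * e ^ m)) => m _.
    by rewrite /H mono_mul.
  rewrite (fsumID [set m | m < 2 * n] lfH); congr (_ + _); apply/esym.
  - rewrite (@reindex_fsum _ _ _ (fun mj => 2 * n - mj.1) (fun m => (2 * n - m, m - 2 * n + 1))
      (Om `&` ~` [set mj | `|mj.2 - 2|%:Z < mj.1])).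
    + apply: eq_fsum => -[m j] [[/= om oj lt] lt2].
      rewrite FE /H mono_mul add0n /= eS; congr mono.
        by congr (_ ^ _); lia.
      have -> : b = - (p%:Z * n) by apply/eqP; rewrite -addr_eq0 addrC s0.
      by apply/eqP; rewrite -eqz_nat !absz_sqr; apply/eqP; ring.
    + by case=> m j [[/= om oj lt] lt2]; rewrite /par /=; split; [split|congr pair] => //=; lia.
    + by move=> m [/= om lt]; rewrite /par /= in om *; split; [split; [split|]|] => //=; lia.
  - rewrite (@reindex_fsum _ _ _ (fun mj => 2 * n + mj.1) (fun m => (m - 2 * n, m - 2 * n + 1))
      (Om' `&` ~` [set mj | `|mj.2|%:Z < mj.1])).
    + apply: eq_fsum => -[m j] [[/= om oj lt] lt2].
      rewrite FE /H mono_mul add0n /= eS; congr mono.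
        by congr (_ ^ _); lia.
      have -> : b = - (p%:Z * n) by apply/eqP; rewrite -addr_eq0 addrC s0.
      by apply/eqP; rewrite -eqz_nat !absz_sqr; apply/eqP; ring.
    + by case=> m j [[/= om oj lt] lt2]; rewrite /par /=; split; [split|congr pair] => //=; lia.
    + by move=> m [/= om lt]; rewrite /par /= in om *; split; [split; [split|]|] => //=; lia.
have -> : mono (e / (1 + e ^+ 2)) 0 = mono e 0 * mono (1 + e ^+ 2)^-1 0 :> fps k.
  by rewrite mono_mul.
rewrite mulrCA mulrA -key mulrAC mono_mul divff // mono1 mul1r //.
Qed.

Lemma fsum_Om_gam : fsum Om (fun mj => mono (1 : k) (p ^ 2 * `|(mj.1 ^+ 2 - mj.2 ^+ 2)%R|)) = gam k p.
Proof.
set H := fun mj : int * int => _; have lfH : lfin Om H by apply: lfin_mono => N; exact: fin_Om.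
rewrite (fsumID [set mj | mj.2 = 0] lfH) [X in _ + X](fsum_pairing char2 (A := [set mj | 0 < mj.2])
  (h := fun mj => (mj.1, - mj.2))) ?addr0; first last.
- case=> m j [[/= om oj lt] j0]; rewrite opprK /H /= sqrrN; split=> //; last by lia.
  by split; [split=> //=|]; lia.
- exact: lfin_sub lfH.
rewrite /gam (@reindex_fsum _ _ _ (fun mj => mj.1) (fun m => (m, 0)) (Om `&` [set mj | mj.2 = 0])).
- apply: eq_fsum => -[m j] [_ /= ->]; rewrite /H /= expr0n subr0; congr mono.
  by rewrite abszM expnMn abszX.
- by case=> m j [[/= om oj lt] ->]; split=> //; split=> //; lia.
- by move=> m [om m0]; split=> //; split=> //; split=> //=; lia.
Qed.

(* In the sum over (n, m, j) of the F b e n (m, j), the terms (n, m, j) and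
   (n + j, m, - j) are equal, hence cancel; the terms with j = 0 give gam * theta false. *)
Lemma theta_lambert b e : e != 0 -> (forall n, p%:Z * n + b = 0 -> e ^+ 2 != 1) ->
  theta p true b e * lambert (4 * p) b e = theta p false b e * gam k p.
Proof.
move=> e0 e1; have d0 : (0 < 4 * p)%N by rewrite muln_gt0 (odd_gt0 odd_p).
rewrite /lambert (fsumMr _ (lfin_lambert b e d0)).
rewrite (@eq_fsum _ _ _ _ (fun n => fsum Om (F b e n))); last first.
  move=> n _; case: (ltgtP (p%:Z * n + b) 0) => [s0|s0|s0].
  - by apply: (@theta_lam_sign (- 1)) => //; [right|rewrite mulN1r oppr_gt0].
  - by apply: (@theta_lam_sign 1) => //; [left|rewrite mul1r].
  - by rewrite s0; apply: theta_lam0 => //; exact: (e1 n).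
pose h (q : int * (int * int)) := (2 * q.1 + q.2.2, q.2).
pose h' (q : int * (int * int)) := (((q.1 - q.2.2) %/ 2)%Z, q.2).
pose H (q : int * (int * int)) := mono (e ^ q.1 * 1)
  (`|(p%:Z * q.1 + 2 * b)%R| ^ 2 + p ^ 2 * `|(q.2.1 ^+ 2 - q.2.2 ^+ 2)%R|).
have lft := lfin_theta odd_p (par false) b (fun m => e ^ m).
have lfO : lfin Om (fun mj => mono (1 : k) (p ^ 2 * `|(mj.1 ^+ 2 - mj.2 ^+ 2)%R|)).
  by apply: lfin_mono => N; exact: fin_Om.
have hP q : ([set: int] `*` Om) q -> (par false `*` Om) (h q) /\ h' (h q) = q.
  case: q => n [m j] [/= _ [/= om oj lt]]; rewrite /h /h' /par /=.
  by split; [split; [|split]|congr pair] => //=; lia.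
have hE q : ([set: int] `*` Om) q -> H (h q) = F b e q.1 q.2.
  case: q => n [m j] [_ /= Omj]; rewrite /H /F /h /= mulr1; congr mono.
  by rewrite (expo_Om _ _ Omj) addnC.
rewrite (@fsum_fsum _ _ _ _ _ (F b e)); last first.
  exact: eq_lfin hE (lfin_comp hP (lfin_pair lft lfO)).
rewrite -(eq_fsum hE) -(reindex_fsum _ hP); last first.
  move=> [i [m j]] [/= oi [/= om oj lt]]; rewrite /h /h' /par /= in oi *.
  by split; [split=> //; split|congr pair] => //=; lia.
by rewrite -fsum_Om_gam fsum_mono_mul.
Qed.

End Lambert.

(** * Coefficients of r *)

Definition is_sq (c n : nat) : bool := `[< exists m, (0 < m)%N /\ n = (c * m ^ 2)%N >].

Lemma F2_addrr (a : 'F_2) : a + a = 0.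
Proof. by case: a => [[|[|[]]]] // ?; apply/val_inj. Qed.

Lemma coefs_r n : coefs r n = \sum_(c <- [:: 1; 2; 3; 6]%N) (is_sq c n)%:R.
Proof.
rewrite big_seq [LHS]big_seq; apply: eq_bigr => c c_in.
have c0 : (0 < c)%N by case: c c_in.
rewrite /is_sq; case: asboolP => [[m [m0 nE]]|nex]; last first.
  rewrite big_nat big1 // => m /andP[m0 _].
  by case: eqP => // nE; case: nex; exists m.
rewrite (bigD1_seq m) ?iota_uniq ?mem_index_iota ?m0 //=; last first.
  by rewrite nE ltnS -mulnn mulnA leq_pmull // muln_gt0 c0.
rewrite {1}nE eqxx big1_seq ?addr0 // => i /andP[im _].
rewrite nE eqn_pmul2l // eqn_exp2r //.
by rewrite eq_sym (negPf im).
Qed.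

Lemma is_sqM a c n : (0 < a)%N -> is_sq (a * c) (a * n) = is_sq c n.
Proof.
move=> a0; apply/asboolP/asboolP => -[m [m0 nE]]; exists m; split=> //; last by rewrite nE mulnA.
by apply/eqP; rewrite -(eqn_pmul2l a0) nE mulnA.
Qed.

Lemma is_sq_prime a c n : prime a -> coprime a c -> is_sq c (a * n) = is_sq (a * c) n.
Proof.
move=> pa ac; have a0 := prime_gt0 pa; apply/asboolP/asboolP => -[m [m0 nE]].
  have : (a %| c * m ^ 2)%N by rewrite -nE dvdn_mulr.
  rewrite Gauss_dvdr // Euclid_dvdX // andbT => /dvdnP[m' mE].
  exists m'; split; first by move: m0; rewrite mE muln_gt0 => /andP[].
  by apply/eqP; rewrite -(eqn_pmul2l a0) nE mE; apply/eqP; ring.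
exists (a * m)%N; split; first by rewrite muln_gt0 a0.
by rewrite nE; ring.
Qed.

Lemma is_sq_dvdn c n : is_sq c n -> (c %| n)%N.
Proof. by case/asboolP => m [_ ->]; rewrite dvdn_mulr. Qed.

Lemma Usub2_r : Usub 2 r = r.
Proof.
apply: fpsP => n; change (coefs r (2 * n) = coefs r n).
rewrite !coefs_r !big_cons !big_nil !addr0.
have -> : is_sq 1 (2 * n) = is_sq 2 n by exact: (is_sq_prime (a := 2) (c := 1)).
have -> : is_sq 2 (2 * n) = is_sq 1 n by exact: (is_sqM (a := 2) 1).
have -> : is_sq 3 (2 * n) = is_sq 6 n by exact: (is_sq_prime (a := 2) (c := 3)).
have -> : is_sq 6 (2 * n) = is_sq 3 n by exact: (is_sqM (a := 2) 3).
by ring.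
Qed.

Lemma Usub3_r : Usub 3 r = r.
Proof.
apply: fpsP => n; change (coefs r (3 * n) = coefs r n).
rewrite !coefs_r !big_cons !big_nil !addr0.
have -> : is_sq 1 (3 * n) = is_sq 3 n by exact: (is_sq_prime (a := 3) (c := 1)).
have -> : is_sq 2 (3 * n) = is_sq 6 n by exact: (is_sq_prime (a := 3) (c := 2)).
have -> : is_sq 3 (3 * n) = is_sq 1 n by exact: (is_sqM (a := 3) 1).
have -> : is_sq 6 (3 * n) = is_sq 2 n by exact: (is_sqM (a := 3) 2).
by ring.
Qed.

(** The involution j -> n / j on the divisors has a fixed point exactly when n is a square. *)
Lemma sum_divisors_sq n : (0 < n)%N ->
  \sum_(j <- divisors n) 1 = (is_sq 1 n)%:R :> 'F_2.
Proof.
move=> n0; rewrite (bigID (fun j => j * j < n)%N) /= [X in _ + X](bigID (fun j => j * j == n)%N) /=.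
have -> : \sum_(j <- divisors n | (j * j < n)%N)  1 =
    \sum_(j <- divisors n | ~~ (j * j < n)%N && (j * j != n)%N) 1 :> 'F_2.
  have pm : perm_eq (divisors n) (map (fun j => n %/ j)%N (divisors n)).
    apply: uniq_perm; first exact: divisors_uniq.
      rewrite map_inj_in_uniq ?divisors_uniq // => i j; rewrite -!dvdn_divisors //.
      move=> i_n j_n ij; apply/eqP; rewrite -(eqn_pmul2l (n0 : (0 < n)%N)).
      by rewrite -{1}(divnK j_n) -[X in _ == (X * _)%N](divnK i_n) ij mulnAC.
    move=> i; apply/idP/mapP => [|[j]]; rewrite -!dvdn_divisors //.
      move=> i_n; exists (n %/ i)%N; first by rewrite -dvdn_divisors // dvdn_div.
      by rewrite divnA // mulKn.
    by move=> j_n ->; rewrite dvdn_div.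
  rewrite (perm_big _ pm) /= big_map big_seq_cond [RHS]big_seq_cond.
  apply: eq_bigl => j; rewrite -dvdn_divisors //.
  case: (boolP (j %| n)%N) => //= /dvdnP[u nE].
  have j0 : (0 < j)%N by move: n0; rewrite nE muln_gt0 => /andP[].
  by rewrite nE mulnK //; nia.
rewrite addrCA F2_addrr addr0; rewrite /is_sq; case: asboolP => [[m [m0 nE]]|nex].
  rewrite big_mkcond (bigD1_seq m) ?divisors_uniq //=; last first.
    by rewrite -dvdn_divisors // nE mul1n -mulnn dvdn_mulr.
  have -> : (m * m == n)%N by rewrite nE mul1n mulnn.
  rewrite ltn_neqAle nE mul1n -mulnn eqxx /= big1 ?addr0 // => j jm.
  case: ifP => // /andP[_ /eqP jj].
  by case/eqP: jm; nia.
rewrite big_seq_cond big1 // => j /andP[_ /andP[_ /eqP jE]].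
case: nex; exists j; split; last by rewrite mul1n -jE mulnn.
by case: j jE n0 => // <-.
Qed.

(** Both sides are unchanged when n is multiplied by 2 or 3. For n prime to 6 every divisor counts,
    and only the summand x^(m^2) of r contributes. *)
Lemma coefs_r_divisors n : (0 < n)%N ->
  coefs r n = \sum_(j <- divisors n | coprime j 6) 1.
Proof.
elim/ltn_ind: n => n IHn n0.
have step q m : prime q -> (q %| 6)%N -> Usub q r = r -> n = (q * m)%N ->
    coefs r n = \sum_(j <- divisors n | coprime j 6) 1.
  move=> pq q6 Ur nE; have m0 : (0 < m)%N by move: n0; rewrite nE muln_gt0 => /andP[].
  have -> : coefs r n = coefs r m by rewrite -[in RHS]Ur nE.
  rewrite IHn //; last by rewrite nE ltn_Pmull ?prime_gt1.
  rewrite -[LHS]big_filter -[RHS]big_filter; apply: perm_big; apply: uniq_perm;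
    rewrite ?filter_uniq ?divisors_uniq //.
  move=> j; rewrite !mem_filter -!dvdn_divisors // nE.
  case: (boolP (coprime j 6)) => //= cj; rewrite Gauss_dvdr //.
  by apply: coprime_dvdr cj.
have [/dvdnP[m nE]|n2] := boolP (2 %| n)%N.
  by apply: (step 2 m) => //; rewrite ?nE 1?mulnC //; exact: Usub2_r.
have [/dvdnP[m nE]|n3] := boolP (3 %| n)%N.
  by apply: (step 3 m) => //; rewrite ?nE 1?mulnC //; exact: Usub3_r.
rewrite coefs_r !big_cons big_nil.
have -> : is_sq 2 n = false by apply: contraNF n2 => /is_sq_dvdn.
have -> : is_sq 3 n = false by apply: contraNF n3 => /is_sq_dvdn.
have -> : is_sq 6 n = false by apply: contraNF n2 => /is_sq_dvdn; apply: dvdn_trans.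
rewrite !addr0 -sum_divisors_sq // big_seq [RHS]big_seq_cond.
apply: eq_bigl => j; rewrite -dvdn_divisors //.
case: (boolP (j %| n)%N) => //= jn; apply/esym.
rewrite (_ : 6%N = (2 * 3)%N) // coprimeMr ![coprime j _]coprime_sym !prime_coprime //.
by apply/andP; split; [apply: contraNN n2|apply: contraNN n3] => /dvdn_trans; apply.
Qed.

Lemma sum_dvdn (V : nmodType) (d n : nat) (h : nat -> V) : (0 < d)%N ->
  \sum_(i < (d * n).+1 | (d %| i)%N) h i = \sum_(j < n.+1) h (d * j)%N.
Proof.
move=> d0; rewrite (reindex_onto (fun j : 'I_n.+1 => inord (d * j) : 'I_(d * n).+1)
  (fun i => inord (i %/ d))) /=; last first.
  move=> i /dvdnP[q qE]; apply: val_inj.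
  have qn : (q < n.+1)%N by rewrite ltnS -(leq_pmul2l d0) [(d * q)%N]mulnC -qE -ltnS ltn_ord.
  by rewrite /= {1}qE mulnK // (inordK qn) inordK mulnC -qE.
have dj (j : 'I_n.+1) : (d * j < (d * n).+1)%N by rewrite ltnS leq_pmul2l // -ltnS.
apply: eq_big => j; last by rewrite inordK.
rewrite inordK // dvdn_mulr //= mulKn //; apply/eqP/val_inj.
by rewrite /= inordK.
Qed.

(** * Substitutions x -> l w^d in power series over Z/2 *)

Section Substitution.
Variables (k : fieldType) (emb : {rmorphism 'F_2 -> k}).

Lemma F2_ext_pchar : 2%N \in [pchar k].
Proof. by apply: (rmorph_pchar emb); rewrite pchar_Fp. Qed.

(** When p divides n the sum is p, which is 1 in k as p is odd. *)
Lemma sum_prim_root (p : nat) (z : k) n : p.-primitive_root z -> odd p ->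
  \sum_(i < p) (z ^+ n) ^+ i = (p %| n)%:R.
Proof.
move=> pz op; case: (boolP (p %| n)%N) => pn.
  rewrite -(prim_expr_mod pz) (eqP pn) expr0 (eq_bigr (fun=> 1)) => [|i _]; last by rewrite expr1n.
  rewrite sumr_const card_ord -[p]odd_double_half op -mul2n mulrnDr mulrnA.
  by rewrite (pcharf0 F2_ext_pchar) mul0rn addr0.
have zn : z ^+ n - 1 != 0 by rewrite subr_eq0 -(prim_order_dvd pz).
by apply: (mulfI zn); rewrite mulr0 -subrX1 exprAC (prim_expr_order pz) expr1n subrr.
Qed.

(* f(x) |-> f(l * w^d), with coefficients extended to k *)
Definition fsub (l : k) (d : nat) (f : fps 'F_2) : fps k :=
  Fps (fun N => if (d %| N)%N then emb (coefs f (N %/ d)) * l ^+ (N %/ d) else 0).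

Lemma coefs_fsub l d f n : (0 < d)%N -> coefs (fsub l d f) (d * n) = emb (coefs f n) * l ^+ n.
Proof. by move=> d0; rewrite /= dvdn_mulr // mulKn. Qed.

Lemma fsubD l d : {morph fsub l d : f g / f + g}.
Proof.
move=> f g; apply: fpsP => N; rewrite coefsD /=; case: ifP => _; last by rewrite addr0.
by rewrite rmorphD mulrDl.
Qed.

Lemma fsub0 l d : fsub l d 0 = 0.
Proof. by apply: fpsP => N /=; rewrite rmorph0 mul0r if_same. Qed.

Lemma fsubM l d : (0 < d)%N -> {morph fsub l d : f g / f * g}.
Proof.
move=> d0 f g; apply: fpsP => N.
have [/dvdnP[n ->]|dN] := boolP (d %| N)%N; last first.
  rewrite coefsM /= (negPf dN) big1 // => i _.
  case: (boolP (d %| i)%N) => di; last by rewrite mul0r.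
  case: (boolP (d %| N - i)%N) => di'; last by rewrite mulr0.
  have iN : (i <= N)%N by rewrite -ltnS.
  by have := dvdn_add di' di; rewrite subnK // (negPf dN).
rewrite mulnC coefs_fsub // !coefsM rmorph_sum mulr_suml.
transitivity (\sum_(i < (d * n).+1 | (d %| i)%N) coefs (fsub l d f) i * coefs (fsub l d g) (d * n - i)).
  rewrite (sum_dvdn n (fun i => coefs (fsub l d f) i * coefs (fsub l d g) (d * n - i))) //.
  apply: eq_bigr => j _; rewrite -mulnBr !coefs_fsub //.
  have jn : (j <= n)%N by rewrite -ltnS.
  by rewrite rmorphM mulrACA -exprD subnKC.
rewrite [RHS](bigID (fun i : 'I__ => (d %| i)%N)) /= [X in _ + X]big1 ?addr0 // => i /negPf ->.
by rewrite mul0r.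
Qed.

Lemma fsub_inj l d : (0 < d)%N -> l != 0 -> injective (fsub l d).
Proof.
move=> d0 l0 f g fg; apply: fpsP => n.
have := congr1 (fun h => coefs h (d * n)) fg; rewrite !coefs_fsub // => /mulIf.
by move=> /(_ (expf_neq0 _ l0)) /fmorph_inj.
Qed.

Lemma fsub_poly l d f (P : {poly 'F_2}) : (0 < d)%N ->
  fsub l d (horner_alg f P) = (map_poly (in_alg (fps k) \o emb) P).[fsub l d f].
Proof.
move=> d0; elim/poly_ind: P => [|P c IHP]; first by rewrite !rmorph0 horner0 fsub0.
rewrite [horner_alg f _]rmorphD [X in fsub _ _ (X + _)]rmorphM /= horner_algX horner_algC.
rewrite fsubD fsubM // IHP rmorphD rmorphM /= map_polyX map_polyC /= !hornerE.
congr (_ + _); apply: fpsP => N; rewrite /= -[emb c]mulr1.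
case: (N =P 0%N) => [->|/eqP N0]; first by rewrite dvdn0 div0n !mulr1.
case: ifP => [/dvdnP[q NE]|_]; last by rewrite !mulr0.
rewrite NE mulnK // (_ : (q == 0)%N = false) ?mulr0 ?rmorph0 ?mul0r //.
by apply: contraNF N0 => /eqP q0; rewrite NE q0.
Qed.

Lemma fsub_Vsub d p f : (0 < d)%N -> (0 < p)%N -> fsub 1 d (Vsub p f) = fsub 1 (d * p) f.
Proof.
move=> d0 p0; apply: fpsP => N /=.
have [/dvdnP[n ->]|dN] := boolP (d %| N)%N; last first.
  have -> // : (d * p %| N)%N = false.
  by apply: contraNF dN; apply: dvdn_trans; rewrite dvdn_mulr.
rewrite mulnK // !expr1n !mulr1 [(n * d)%N]mulnC dvdn_pmul2l // divnMl //.
by case: ifP; rewrite ?rmorph0.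
Qed.

Lemma fsub_Usub d (p : nat) (z : k) f : (0 < d)%N -> p.-primitive_root z -> odd p ->
  fsub 1 (d * p) (Usub p f) = \sum_(i < p) fsub (z ^+ i) d f.
Proof.
move=> d0 pz op; have p0 := odd_gt0 op; apply: fpsP => N; rewrite coefs_sum.
have [/dvdnP[n ->]|dN] := boolP (d %| N)%N; last first.
  rewrite big1 /= => [|i _]; last by rewrite (negPf dN).
  have -> // : (d * p %| N)%N = false.
  by apply: contraNF dN; apply: dvdn_trans; rewrite dvdn_mulr.
rewrite [(n * d)%N]mulnC (eq_bigr (fun i : 'I_p => emb (coefs f n) * (z ^+ n) ^+ i)); last first.
  by move=> i _; rewrite coefs_fsub // exprAC.
rewrite -mulr_sumr /= dvdn_pmul2l // divnMl // expr1n mulr1.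
rewrite (sum_prim_root n pz op); case: ifP => [pn|_]; last by rewrite mulr0.
by rewrite mulnC divnK // mulr1.
Qed.

End Substitution.

(** * Lambert series at translates of the 3-torsion point *)

Section LambertSeries.
Variables (k : fieldType) (emb : {rmorphism 'F_2 -> k}) (eta : k).
Hypothesis eta_eq : eta ^+ 2 + eta + 1 = 0.

Let char2 := F2_ext_pchar emb.

Lemma eta3 : eta ^+ 3 = 1.
Proof.
apply/eqP; rewrite -subr_eq0; apply/eqP.
transitivity ((eta - 1) * (eta ^+ 2 + eta + 1)); first by ring.
by rewrite eta_eq mulr0.
Qed.

Lemma eta_neq0 : eta != 0.
Proof. by apply/eqP => e0; move: eta3; rewrite e0 expr0n => /eqP; rewrite eq_sym oner_eq0. Qed.

Lemma eta_neq1 : eta != 1.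
Proof.
apply/eqP => e1; move: eta_eq; rewrite e1 expr1n addrr_pchar2 // add0r => /eqP.
by rewrite oner_eq0.
Qed.

Lemma eta_inv : eta^-1 = eta ^+ 2.
Proof. by apply: (mulfI eta_neq0); rewrite divff ?eta_neq0 // -exprS eta3. Qed.

Lemma eta_sum j : eta ^+ j + eta^-1 ^+ j = (~~ (3 %| j)%N)%:R.
Proof.
have e23 : (eta ^+ 2) ^+ 3 = 1 by rewrite exprAC eta3 expr1n.
rewrite eta_inv -(expr_mod j eta3) -(expr_mod j e23) /dvdn; set s := (j %% 3)%N.
have : (s < 3)%N by rewrite ltn_mod.
case: s => [|[|[|]]] // _; first by rewrite !expr0 addrr_pchar2.
  rewrite !expr1 /=; apply/eqP; rewrite -subr_eq0 oppr_pchar2 //; apply/eqP.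
  by rewrite -eta_eq; ring.
rewrite -exprM (exprD _ 3 1) eta3 /=; apply/eqP; rewrite -subr_eq0 oppr_pchar2 //; apply/eqP.
by rewrite -eta_eq; ring.
Qed.

(** The term m = 0 is eta / (1 + eta^2) = 1. The terms m and - m together are the sum over odd j of
    (eta^j + eta^(-j)) (l w^d)^(m j), and eta^j + eta^(-j) is 0 or 1 according as 3 divides j or
    not. So the coefficient of (l w^d)^n counts the divisors of n prime to 6, as for r. *)
Lemma fsum_lam_r (l : k) d : (0 < d)%N -> l != 0 ->
  fsum [set: int] (fun m => lam d (eta * l ^ m) m) = 1 + fsub emb l d r.
Proof.
move=> d0 l0; set H := fun m : int => _.
have lfH : lfin [set: int] H.
  move=> N; apply: sub_finite_set (finite_int_box N) => m [_ [M le]] /(coefs_lam_neq0 d0) /= s_le.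
  exact: leq_trans s_le le.
rewrite (fsumID [set m | m = 0] lfH); congr (_ + _).
  rewrite (eq_fsuml (Q := [set 0])) => [|m]; last by rewrite /=; split=> [[]|].
  rewrite fsum_set1 /H /lam eqxx expr0z mulr1 -mono1; congr mono.
  have -> : 1 + eta ^+ 2 = eta.
    by apply/eqP; rewrite -subr_eq0 oppr_pchar2 // -eta_eq; apply/eqP; ring.
  by rewrite divff ?eta_neq0.
have lfH0 : lfin ([set: int] `&` ~` [set m | m = 0]) H by exact: lfin_sub lfH.
rewrite (fsumID [set m | 0 < m] lfH0).
rewrite (@reindex_fsum _ _ _ (fun n : nat => n.+1%:Z) (fun m => `|m|.-1)%N [set: nat]); first last.
- by move=> m [_ /=] m0; split=> //; lia.
- by move=> n _; split; [split; [split|]|] => //=; lia.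
rewrite [X in _ + X](@reindex_fsum _ _ _ (fun n : nat => - n.+1%:Z)
  (fun m => `|m|.-1)%N [set: nat]); first last.
- by move=> m [[_ /= m0] m1]; split=> //; lia.
- by move=> n _; split; [split; [split|]|] => //=; lia.
pose c j := eta ^+ j + eta^-1 ^+ j.
pose K0 n j : fps k := mono (c j * l ^+ (n.+1 * j)) (d * (n.+1 * j)).
rewrite fsumD; first last.
- have := lfin_comp (h := fun n : nat => - n.+1%:Z) (h' := fun m => `|m|.-1%N) (P := [set: nat]) _ lfH.
  by apply=> n _; split=> //; lia.
- have := lfin_comp (h := fun n : nat => n.+1%:Z) (h' := fun m => `|m|.-1%N) (P := [set: nat]) _ lfH.
  by apply=> n _; split=> //; lia.
rewrite (@eq_fsum _ _ _ _ (fun n => fsum [set j | odd j] (K0 n))); last first.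
  move=> n _; have lfg u := @lfin_geo k u (d * n.+1) _.
  have -> : H n.+1%:Z = geo (eta * l ^+ n.+1) (d * n.+1) by [].
  have -> : H (- n.+1%:Z) = geo (eta^-1 * l ^+ n.+1) (d * n.+1).
    have -> : H (- n.+1%:Z) = geo (eta * l ^ (- n.+1%:Z))^-1 (d * n.+1) by [].
    by rewrite -invr_expz invfM invrK.
  rewrite /geo fsumD; try by apply: lfg; rewrite muln_gt0 d0.
  apply: eq_fsum => j _; rewrite /K0 mulrDl; apply: fpsP => N.
  rewrite coefsD !coefs_mono mulnA; case: eqP => _; last by rewrite addr0.
  by rewrite !exprMn -!exprM.
have finK N : finite_set [set nj : nat * nat |
    ([set: nat] `*` [set j | odd j]) nj /\ (d * (nj.1.+1 * nj.2) <= N)%N].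
  apply: sub_finite_set (finite_setX (finite_II N.+1) (finite_II N.+1)) => -[n j] /= [[_ oj] le].
  have j0 := odd_gt0 oj; have : (n.+1 * j <= N)%N by apply: leq_trans le; rewrite leq_pmull.
  by move=> ?; split; nia.
rewrite (@fsum_fsum _ _ _ _ _ K0); last exact: lfin_mono finK.
apply: fpsP => N.
have [/dvdnP[n ->]|dN] := boolP (d %| N)%N; last first.
  rewrite [RHS]/= (negPf dN); apply: fsbig1 => -[n j] _ /=; case: eqP => // NE.
  by move: dN; rewrite NE dvdn_mulr.
rewrite [(n * d)%N]mulnC coefs_fsub //; have [->|n_gt0] := posnP n.
  rewrite muln0 coefs_r0 rmorph0 mul0r; apply: fsbig1 => -[m j] [_ /= oj]; case: eqP => // /esym/eqP.
  by rewrite muln_eq0 (gtn_eqF d0) muln_eq0 /= => /eqP j0; rewrite j0 in oj.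
rewrite coefs_r_divisors //.
pose X := [seq ((n %/ j).-1, j) | j <- divisors n & odd j].
have XE j : j \in [seq j <- divisors n | odd j] -> ((n %/ j).-1.+1 * j = n)%N.
  rewrite mem_filter -dvdn_divisors // => /andP[oj jn].
  by rewrite prednK ?divnK // divn_gt0 ?odd_gt0 // dvdn_leq.
rewrite [LHS]/= (fsum_eq_seq (X := X)).
- rewrite big_map big_filter rmorph_sum mulr_suml big_mkcond [RHS]big_mkcond /=.
  rewrite big_seq [RHS]big_seq; apply: eq_bigr => j jn.
  case: (boolP (odd j)) => oj; last first.
    rewrite (_ : coprime j 6 = false) //; apply: contraNF oj => /(coprime_dvdr (isT : 2 %| 6)%N).
    by rewrite coprimen2.
  have nE : ((n %/ j).-1.+1 * j = n)%N by apply: XE; rewrite mem_filter oj.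
  rewrite nE eqxx /c eta_sum (_ : coprime j 6 = ~~ (3 %| j)%N).
    by case: ifP => _; rewrite ?mul0r ?rmorph1.
  by rewrite (_ : 6%N = (2 * 3)%N) // coprimeMr coprimen2 oj coprime_sym prime_coprime.
- by rewrite map_inj_uniq ?filter_uniq ?divisors_uniq // => i j [_ ->].
- by move=> i /mapP[j]; rewrite mem_filter => /andP[oj _] ->.
- move=> [m j] [_ /= oj]; case: ((d * n)%N =P _) => [NE _|_]; last by rewrite eqxx.
  have nE : (m.+1 * j = n)%N.
    by apply/eqP; rewrite -(eqn_pmul2l d0) -NE.
  have j0 := odd_gt0 oj; apply/mapP; exists j; last by rewrite -nE mulnK.
  by rewrite mem_filter oj -dvdn_divisors // -nE dvdn_mull.
Qed.

Lemma fsum_ord (n : nat) (F : 'I_n -> fps k) : \sum_(i < n) F i = fsum [set: 'I_n] F.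
Proof.
apply: fpsP => N; rewrite coefs_sum /=; symmetry; rewrite -big_enum.
by apply: fsum_eq_seq => [|//|i _ _]; rewrite ?enum_uniq ?mem_enum.
Qed.

Lemma sum_fsum (n : nat) (I : choiceType) (P : set I) (F : 'I_n -> I -> fps k) :
    (forall i, lfin P (F i)) ->
  \sum_(i < n) fsum P (F i) = fsum P (fun m => \sum_(i < n) F i m).
Proof.
elim: n F => [|n IHn] F lfF.
  rewrite big_ord0; apply: fpsP => N; symmetry; apply: fsbig1 => i _.
  by rewrite big_ord0.
rewrite big_ord_recl IHn // fsumD //.
  by apply: eq_fsum => m _; rewrite big_ord_recl.
move=> N; apply: (@sub_finite_set _ _ (\bigcup_(i in [set: 'I_n])
   [set m | P m /\ exists2 M, (M <= N)%N & coefs (F (lift ord0 i) m) M != 0])); last first.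
  by apply: bigcup_finite => // i _; exact: lfF.
move=> m [Pm [M leMN]]; rewrite coefs_sum => nz.
have [i nzi] : exists i, coefs (F (lift ord0 i) m) M != 0.
  apply: contraPP nz => /forallNP nz; rewrite big1 ?eqxx // => i _.
  by apply/eqP; apply: contraT => /(nz i).
by exists i => //; split=> //; exists M.
Qed.

Variable p : nat.
Hypothesis odd_p : odd p.

Let p0 : (0 < p)%N := odd_gt0 odd_p.
Let d0 : (0 < 4 * p)%N.
Proof. by rewrite muln_gt0. Qed.

Let lfg d u : (0 < d)%N -> lfin [set j | odd j] (fun j => mono (u ^+ j : k) (d * j)) :=
  @lfin_geo k u d.

Lemma lam_scale d e (s : int) : lam d e (p%:Z * s) = lam (d * p) e s :> fps k.
Proof.
have pz0 : 0 < p%:Z by move: p0; lia.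
by rewrite /lam mulf_eq0 (gt_eqF pz0) /= pmulr_rgt0 // abszM mulnA.
Qed.

Lemma lambert0E (e : k) : lambert p (4 * p) 0 e = fsum [set: int] (lam (4 * p * p) e).
Proof. by apply: eq_fsum => n _; rewrite addr0 lam_scale. Qed.

Lemma lambert_base : lambert p (4 * p) 0 eta = 1 + fsub emb 1 (4 * p * p) r.
Proof.
rewrite lambert0E -fsum_lam_r ?muln_gt0 ?p0 ?oner_eq0 //.
by apply: eq_fsum => n _; rewrite exp1rz mulr1.
Qed.

(** The p progressions p n + b fill the integers, and l^p = 1 makes l^(p n + b) depend on b alone.
    The period x = w^(4 p^2) is thereby replaced by w^(4 p) = x^(1/p). *)
Lemma lambert_cyclic (l : k) : l ^+ p = 1 ->
  \sum_(b < p) lambert p (4 * p) b%:Z (eta * l ^+ b) = 1 + fsub emb l (4 * p) r.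
Proof.
move=> lp; have l0 : l != 0.
  by apply: contra_eq_neq lp => ->; rewrite expr0n gtn_eqF // eq_sym oner_eq0.
rewrite -(fsum_lam_r d0 l0) fsum_ord.
set H := fun m : int => _.
have lfH : lfin [set: int] H.
  move=> N; apply: sub_finite_set (finite_int_box N) => m [_ [M le]] /(coefs_lam_neq0 d0) /= s_le.
  exact: leq_trans s_le le.
pose h (bn : 'I_p * int) := p%:Z * bn.2 + (val bn.1)%:Z.
pose h' (m : int) : 'I_p * int := (Ordinal (ltn_pmod `|(m %% p%:Z)%Z| p0), (m %/ p%:Z)%Z).
have hP bn : ([set: 'I_p] `*` [set: int]) bn -> [set: int] (h bn) /\ h' (h bn) = bn.
  case: bn => b n _; split=> //; rewrite /h /h' /=; congr pair.
    by apply: val_inj; rewrite /= mulrC modzMDl modz_nat modn_mod modn_small.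
  by rewrite mulrC divzMDl ?eqz_nat ?gtn_eqF // divz_nat divn_small // addr0.
have hE bn : ([set: 'I_p] `*` [set: int]) bn ->
    H (h bn) = lam (4 * p) (eta * l ^+ bn.1) (p%:Z * bn.2 + bn.1%:Z).
  move=> _; rewrite /H /h; congr (lam _ (_ * _) _).
  by rewrite expfzDr // -exprz_exp -exprnP lp exp1rz mul1r.
rewrite (@fsum_fsum _ _ _ _ _ (fun (b : 'I_p) n => lam (4 * p) (eta * l ^+ b) (p%:Z * n + b%:Z))); last first.
  exact: eq_lfin hE (lfin_comp hP lfH).
rewrite -(eq_fsum hE) -(reindex_fsum _ hP) // => m _; split; first by split.
rewrite /h /h' /= mulrC modn_small; last first.
  by rewrite -ltz_nat gez0_abs ?ltz_pmod ?modz_ge0 // eqz_nat gtn_eqF.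
by rewrite gez0_abs ?modz_ge0 ?eqz_nat ?gtn_eqF // -divz_eq.
Qed.

Lemma sum_geo (u v : k) d : (0 < d)%N -> p.-primitive_root v ->
  \sum_(a < p) geo (u * v ^+ a) d = geo (u ^+ p) (d * p).
Proof.
move=> d_gt0 pv; rewrite /geo sum_fsum; last by move=> a; exact: lfg.
pose H j : fps k := mono (u ^+ j * (p %| j)%:R) (d * j).
rewrite (@eq_fsum _ _ _ _ H); last first.
  move=> j _; rewrite /H -(sum_prim_root emb j pv odd_p); apply: fpsP => N.
  rewrite coefs_sum coefs_mono mulr_sumr.
  case: (eqVneq N (d * j)%N) => [->|ne]; last by rewrite big1 // => a _; rewrite coefs_mono (negPf ne).
  by apply: eq_bigr => a _; rewrite coefs_mono eqxx exprMn exprAC.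
have lfH : lfin [set j | odd j] H.
  apply: lfin_mono => N; apply: (sub_finite_set _ (finite_II N.+1)) => j /= [_ le].
  by rewrite ltnS (leq_trans _ le) // leq_pmull.
rewrite (fsumID [set j | (p %| j)%N] lfH) [X in _ + X](_ : _ = 0) ?addr0; last first.
  apply: fpsP => N; apply: fsbig1 => j [_ /= /negP/negPf pj].
  by rewrite pj mulr0 if_same.
rewrite (@reindex_fsum _ _ _ (fun j => p * j)%N (fun j => j %/ p)%N [set j | odd j]).
- apply: eq_fsum => j _; rewrite /H dvdn_mulr // mulr1 mulnA; congr mono.
  by rewrite exprM.
- by move=> j /= oj; rewrite oddM odd_p oj mulKn //; split=> //; split=> //; rewrite dvdn_mulr.
- move=> j /= [oj pj]; rewrite mulnC divnK //; split=> //.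
  by move: oj; rewrite -{1}(divnK pj) oddM odd_p andbT.
Qed.

Variable z : k.
Hypothesis pz : p.-primitive_root z.

(** The distribution relation of v / (1 + v^2): its sum over the p-th roots of u^p is its value at
    u^p. Away from s = 0 it holds term by term in the geometric series. *)
Lemma sum_lam u d s : (0 < d)%N -> u ^+ p != 1 ->
  \sum_(a < p) lam d (u * z ^+ a) s = lam (d * p) (u ^+ p) s.
Proof.
move=> d_gt0 up; rewrite /lam; case: eqVneq => [s0|s0].
  rewrite -[RHS]/(mono _ _); apply: fpsP => N; rewrite coefs_sum coefs_mono.
  case: (eqVneq N 0%N) => [->|ne]; last by rewrite big1 // => a _; rewrite coefs_mono (negPf ne).
  under eq_bigr => a _ do rewrite coefs_mono eqxx.
  (* Partial fractions in characteristic 2. As squaring is additive, only the sum of the 1 / (1 - u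
     z^a) is left to compute, and it is p / (1 - u^p) with p = 1. *)
  have frac (v : k) : v != 1 -> v / (1 + v ^+ 2) = (1 - v)^-1 + (1 - v)^-1 ^+ 2.
    move=> v1; have nz : 1 - v != 0 by rewrite subr_eq0 eq_sym.
    have -> : 1 + v ^+ 2 = (1 - v) ^+ 2 + v *+ 2 by ring.
    rewrite (mulrn_pchar char2) addr0; apply: (mulIf (expf_neq0 2 nz)).
    rewrite divfK ?expf_neq0 // mulrDl -exprMn mulVf // expr1n expr2 mulKf //.
    have -> : 1 - v + 1 = (1 *+ 2 - v) by ring.
    by rewrite (mulrn_pchar char2) sub0r oppr_pchar2.
  have v1 a : u * z ^+ a != 1.
    apply: contraNneq up => /(congr1 (fun v => v ^+ p)).
    by rewrite expr1n exprMn exprAC (prim_expr_order pz) expr1n mulr1 => ->.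
  rewrite (eq_bigr _ (fun a _ => frac _ (v1 (val a)))) frac // big_split /=.
  have sqS : \sum_(a < p) (1 - u * z ^+ a)^-1 ^+ 2 = (\sum_(a < p) (1 - u * z ^+ a)^-1) ^+ 2.
    by rewrite -[RHS](pFrobenius_autE char2) rmorph_sum.
  rewrite sqS; suff -> : \sum_(a < p) (1 - u * z ^+ a)^-1 = (1 - u ^+ p)^-1 by [].
  have nz : 1 - u ^+ p != 0 by rewrite subr_eq0 eq_sym.
  apply: (mulfI nz); rewrite divff // mulr_sumr.
  transitivity (\sum_(a < p) \sum_(j < p) u ^+ j * (z ^+ j) ^+ a).
    apply: eq_bigr => a _; have nza : 1 - u * z ^+ a != 0 by rewrite subr_eq0 eq_sym v1.
    apply: (mulIf nza); rewrite mulfVK //.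
    have -> : 1 - u ^+ p = 1 - (u * z ^+ a) ^+ p.
      by rewrite exprMn exprAC (prim_expr_order pz) expr1n mulr1.
    rewrite -opprB subrX1 -mulNr opprB mulrC; congr (_ * _).
    by apply: eq_bigr => j _; rewrite exprMn exprAC.
  rewrite exchange_big /= (bigD1 (Ordinal p0)) //= [X in _ + X]big1 ?addr0.
    by rewrite -mulr_sumr (sum_prim_root emb 0 pz) // dvdn0 expr0 mulr1.
  move=> j; rewrite -val_eqE /= => j0.
  rewrite -mulr_sumr (sum_prim_root emb j pz) // gtnNdvd ?mulr0 // lt0n.
  exact: j0.
case: ifP => _; first by rewrite sum_geo ?muln_gt0 ?d_gt0 ?absz_gt0 // mulnAC.
under eq_bigr => a _ do rewrite invfM -exprVn.
have pzV : p.-primitive_root z^-1.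
  have -> : z^-1 = z ^+ p.-1.
    have z0 : z != 0.
      apply: contra_eq_neq (prim_expr_order pz) => ->.
      by rewrite expr0n gtn_eqF // eq_sym oner_eq0.
    by apply: (mulfI z0); rewrite divff // -exprS prednK // (prim_expr_order pz).
  by rewrite (prim_root_exp_coprime _ pz) coprimePn.
by rewrite sum_geo ?muln_gt0 ?d_gt0 ?absz_gt0 // mulnAC exprVn.
Qed.

End LambertSeries.

(** Summation over the p-th roots of unity replaces v by v^p, hence x by x^p and eta by eta^p, which
    is again a primitive cube root of unity because 3 does not divide p. *)
Lemma lambert_mu (k : fieldType) (emb : {rmorphism 'F_2 -> k}) (eta z : k) (p : nat) :
    eta ^+ 2 + eta + 1 = 0 -> odd p -> p.-primitive_root z -> ~~ (3 %| p)%N ->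
  \sum_(a < p) lambert p (4 * p) 0 (eta * z ^+ a) = 1 + fsub emb 1 (4 * p * p * p) r.
Proof.
move=> eta_eq odd_p pz p3; have char2 := F2_ext_pchar emb; have p0 := odd_gt0 odd_p.
have etap_eq : (eta ^+ p) ^+ 2 + eta ^+ p + 1 = 0.
  have := eta_sum emb eta_eq p; rewrite p3 (eta_inv eta_eq) exprAC addrC => ->.
  by rewrite addrr_pchar2.
rewrite -(fsum_lam_r emb etap_eq (d := 4 * p * p * p) (l := 1)) ?muln_gt0 ?p0 ?oner_eq0 //.
under eq_bigr => a _ do rewrite (lambert0E emb odd_p).
rewrite sum_fsum; last first.
  move=> a N; apply: sub_finite_set (finite_int_box N) => m [_ [M le]] /coefs_lam_neq0 /= s_le.
  by apply: leq_trans le; apply: s_le; rewrite !muln_gt0 p0.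
apply: eq_fsum => m _; rewrite exp1rz mulr1 (sum_lam emb) ?muln_gt0 ?p0 //.
exact: eta_neq1 etap_eq.
Qed.

(** * The abscissa of the Tate curve *)

Section FieldIdentities.
Variable F : fieldType.
Implicit Types g a b c d : F.

Lemma sqr_quotients g a b c d : b != 0 -> d != 0 ->
  (g * a / b) ^+ 2 + (g * c / d) ^+ 2 = g ^+ 2 * (a ^+ 2 * d ^+ 2 + b ^+ 2 * c ^+ 2) / (b ^+ 2 * d ^+ 2).
Proof. by move=> b0 d0; field; rewrite b0 d0. Qed.

Lemma addition_quotients g a b c d x y : g != 0 -> b != 0 -> d != 0 -> x != 0 -> y != 0 ->
  a ^+ 2 * b ^+ 2 * (c ^+ 2 * d ^+ 2) / (x ^+ 2 * y ^+ 2) =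
  (g * a / b * (g * c / d)) ^+ 2 / (g ^+ 2 * (x * y) / (b ^+ 2 * d ^+ 2)) ^+ 2.
Proof. by move=> g0 b0 d0 x0 y0; field; rewrite g0 b0 d0 x0 y0. Qed.

Lemma double_quotients g a b : g != 0 -> a != 0 -> b != 0 ->
  g * (a ^+ 4 + b ^+ 4) / (a ^+ 2 * b ^+ 2 / g) =
  (g * a / b) ^+ 2 + g ^+ 4 / (g * a / b) ^+ 2.
Proof. by move=> g0 a0 b0; field; rewrite g0 a0 b0. Qed.

Lemma sqrf_inj : 2%N \in [pchar F] -> injective (fun x : F => x ^+ 2).
Proof. by move=> char2 x y /eqP; rewrite eqf_sqr oppr_pchar2 // orbb => /eqP. Qed.

Lemma quotient_neq0 g a b : g != 0 -> a != 0 -> b != 0 -> g * a / b != 0.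
Proof. by move=> g0 a0 b0; rewrite !mulf_neq0 ?invr_eq0. Qed.

Lemma quotient_eq0 g b d x y : g != 0 -> b != 0 -> d != 0 ->
  g ^+ 2 * (x * y) / (b ^+ 2 * d ^+ 2) = 0 -> (x == 0) || (y == 0).
Proof.
move=> /negPf g0 /negPf b0 /negPf d0 /eqP.
by rewrite !mulf_eq0 invr_eq0 mulf_eq0 !expf_eq0 /= g0 b0 d0 !orbF.
Qed.

End FieldIdentities.

Section Kappa.
Variables (k : fieldType) (p : nat).
Hypothesis char2 : 2%N \in [pchar k].
Hypothesis odd_p : odd p.

Lemma coefs_theta_seq j b (e : k) (X : seq int) N : uniq X ->
    (forall m, (m \in X) = (odd `|m|%N == j) && (`|(p%:Z * m + 2 * b)%R| ^ 2 == N)%N) ->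
  coefs (theta p j b e) N = \sum_(m <- X) e ^ m.
Proof.
move=> uX XE; rewrite [LHS](fsum_eq_seq (X := X)) //.
- rewrite big_seq [RHS]big_seq; apply: eq_bigr => m; rewrite XE => /andP[_ /eqP NE].
  by rewrite coefs_mono NE eqxx.
- by move=> m; rewrite XE => /andP[/eqP].
- move=> m; rewrite /par /= => om; rewrite XE om eqxx /=.
  by case: (N =P _) => [->|]; rewrite ?eqxx.
Qed.

Lemma dvdz_4 (b m : int) : p%:Z * m = 4 * b -> (p%:Z %| b)%Z.
Proof.
move=> E; have : (p%:Z %| 4 * b)%Z by rewrite -E dvdz_mulr.
rewrite Gauss_dvdzr // coprimezE absz_nat (_ : `|4|%N = (2 ^ 2)%N) //.
by rewrite coprime_pexpr // coprimen2.
Qed.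

Lemma absz_sqr_eq (x y : int) : (`|x| ^ 2 == `|y| ^ 2)%N = (x == y) || (x == - y).
Proof.
rewrite eqn_exp2r //; lia.
Qed.

(** A single term has the exponent examined: m = 0 with exponent (2 b)^2 if p does not divide b, and
    m = - 2 n with exponent 0 if b = p n. *)
Lemma theta_false_neq0 (b : int) (e : k) : e != 0 -> theta p false b e != 0.
Proof.
move=> e0; have p0 := odd_gt0 odd_p; case: (boolP (p%:Z %| b)%Z) => [/dvdzP[n bE]|nb].
  apply/eqP => /(congr1 (fun f => coefs f 0)); rewrite coefs0.
  rewrite (@coefs_theta_seq _ _ _ [:: - (n * 2)]) //.
    by rewrite big_seq1 => /eqP; rewrite expfz_eq0 (negPf e0) andbF.
  move=> m; rewrite inE expn_eq0 andbT absz_eq0 bE.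
  rewrite (_ : p%:Z * m + _ = p%:Z * (m + n * 2)); last by ring.
  by rewrite mulf_eq0; lia.
apply/eqP => /(congr1 (fun f => coefs f (`|2 * b| ^ 2))); rewrite coefs0.
rewrite (@coefs_theta_seq _ _ _ [:: 0]) // ?big_seq1 => [/eqP|m]; first by rewrite expr0z oner_eq0.
rewrite inE absz_sqr_eq; apply/eqP/andP => [->|[om /orP[|]/eqP mE]].
- by rewrite mulr0 add0r eqxx.
- have : p%:Z * m = 0 by lia.
  by move/eqP; rewrite mulf_eq0; lia.
- by case/negP: nb; apply: (@dvdz_4 b (- m)); lia.
Qed.

(** The zeros are the points of the period lattice. If p does not divide b, the exponent (p + 2 b)^2
    occurs only for m = 1. If b = p n, the exponent p^2 occurs for m = 1 - 2 n and m = - 1 - 2 n,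
    with total coefficient e^(-2 n) (e + 1/e), and for e = 1 the symmetry m -> - m - 4 n cancels the
    whole series. *)
Lemma theta_true_eq0 (b : int) (e : k) : e != 0 ->
  (theta p true b e == 0) = (p%:Z %| b)%Z && (e == 1).
Proof.
move=> e0; have p0 := odd_gt0 odd_p; case: (boolP (p%:Z %| b)%Z) => [/dvdzP[n bE]|nb] /=; last first.
  apply/eqP => /(congr1 (fun f => coefs f (`|p%:Z + 2 * b| ^ 2))); rewrite coefs0.
  rewrite (@coefs_theta_seq _ _ _ [:: 1]) // ?big_seq1 => [/eqP|m].
    by rewrite expr1z (negPf e0).
  rewrite inE absz_sqr_eq; apply/eqP/andP => [->|[om /orP[|]/eqP mE]].
  - by split; rewrite ?mulr1 ?eqxx.
  - have : p%:Z * (m - 1) = 0 by lia.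
    by move/eqP; rewrite mulf_eq0; lia.
  - by case/negP: nb; apply: (@dvdz_4 b (- m - 1)); lia.
have [->|e1] := eqVneq e 1.
  apply/eqP; apply: (fsum_pairing char2 (A := [set m | 0 < m + 2 * n]) (h := fun m => - m - 4 * n)).
    exact: lfin_theta.
  move=> m; rewrite /par /= => om; split; try lia.
  by congr mono; [rewrite !exp1rz|congr (_ ^ 2)%N; rewrite bE -abszN; congr absz; ring].
apply/eqP => /(congr1 (fun f => coefs f (p ^ 2))); rewrite coefs0.
rewrite (@coefs_theta_seq _ _ _ [:: 1 - n * 2; -1 - n * 2]) //.
- rewrite big_cons big_seq1 !expfzDr // -mulrDl => /eqP.
  rewrite mulf_eq0 expfz_eq0 (negPf e0) andbF orbF expr1z exprN1 => /eqP ee.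
  have : e ^+ 2 = 1.
    have : (e + e^-1) * e = 0 by rewrite ee mul0r.
    by rewrite mulrDl mulVf // => /eqP; rewrite addr_eq0 oppr_pchar2 // => /eqP.
  move/eqP; rewrite sqrf_eq1 oppr_pchar2 // orbb; exact/negP.
- by rewrite /= inE; lia.
move=> m; rewrite !inE (_ : (p ^ 2 = `|p%:Z| ^ 2)%N) // absz_sqr_eq bE.
rewrite (_ : p%:Z * m + _ = p%:Z * (m + n * 2)); last by ring.
have pz0 : p%:Z != 0 by rewrite eqz_nat gtn_eqF.
have -> : (p%:Z * (m + n * 2) == p%:Z) = (m + n * 2 == 1).
  by rewrite -{2}[p%:Z]mulr1 (inj_eq (mulfI pz0)).
have -> : (p%:Z * (m + n * 2) == - p%:Z) = (m + n * 2 == -1).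
  by rewrite -[- p%:Z]mulrN1 (inj_eq (mulfI pz0)).
lia.
Qed.

Lemma theta_false_01 : theta p false 0 (1 : k) = 1.
Proof.
rewrite /theta; set H := fun m : int => _; have lfH : lfin (par false) H by exact: lfin_theta.
rewrite (fsumID [set m | m = 0] lfH) [X in _ + X](fsum_pairing char2 (A := [set m | 0 < m])
  (h := fun m => - m)) ?addr0.
- rewrite (eq_fsuml (Q := [set 0])) => [|m]; last by rewrite /par /=; split=> [[]|->].
  by rewrite fsum_set1 /H expr0z !mulr0 addr0 -mono1.
- exact: lfin_sub lfH.
- move=> m [/= om m0]; rewrite /par /= in om *; split; try lia.
  by rewrite /H !exp1rz !mulr0 !addr0 mulrN abszN.
Qed.

Local Notation L := {fraction fps k}.

Lemma frac_pchar2 : 2%N \in [pchar L].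
Proof.
rewrite inE /= -(rmorph_nat (@tofrac (fps k))) tofrac_eq0.
by apply/eqP; exact: (fps_addff char2).
Qed.

Let charL := frac_pchar2.

Definition thf (j : bool) (b : int) (e : k) : L := tofrac (theta p j b e).
Definition gamf : L := tofrac (gam k p).
(** The factor [gamf] normalizes the double pole at the origin to v / (1 + v^2): there [theta false]
    is 1, and [theta true] is [gam] times v + 1/v to leading order. *)
Definition kap (b : int) (e : k) : L := gamf * thf false b e / thf true b e.

Lemma thfM j (b b' : int) (e e' : k) : e != 0 -> e' != 0 ->
  thf j (b + b') (e * e') * thf j (b - b') (e / e') =
  thf false b e ^+ 2 * thf j b' e' ^+ 2 + thf true b e ^+ 2 * thf (~~ j) b' e' ^+ 2.
Proof. by move=> e0 e0'; rewrite /thf -!rmorphXn -!rmorphM -rmorphD /= -thetaM. Qed.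

Lemma thf_double_odd (b : int) (e : k) : e != 0 ->
  thf false b e ^+ 2 * thf true b e ^+ 2 = gamf * thf true (b * 2) (e ^+ 2).
Proof. by move=> e0; rewrite /thf -!rmorphXn -!rmorphM /= theta_double_odd. Qed.

Lemma thf_double_even (b : int) (e : k) :
  thf false (b * 2) (e ^+ 2) = thf false b e ^+ 4 + thf true b e ^+ 4.
Proof. by rewrite /thf -!rmorphXn -rmorphD /= theta_double_even. Qed.

Lemma gamf_neq0 : gamf != 0.
Proof.
rewrite tofrac_eq0; apply/eqP => /(congr1 (fun f => coefs f (`|p%:Z| ^ 2))); rewrite coefs0.
have p0 := odd_gt0 odd_p; have pz0 : 0 < p%:Z by lia.
rewrite [LHS](fsum_eq_seq (X := [:: 1])) //.
- by rewrite big_seq1 coefs_mono mulr1 eqxx => /eqP; rewrite oner_eq0.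
- by move=> m; rewrite inE => /eqP ->.
move=> m [om m0]; rewrite coefs_mono absz_sqr_eq.
have -> : (p%:Z == p%:Z * m) = (m == 1).
  by rewrite -{1}[p%:Z]mulr1 (inj_eq (mulfI (lt0r_neq0 pz0))) eq_sym.
have -> : (p%:Z == - (p%:Z * m)) = (m == -1).
  by rewrite -mulrN -{1}[p%:Z]mulr1 (inj_eq (mulfI (lt0r_neq0 pz0))); lia.
by case: ifP; rewrite ?eqxx // inE => + _; lia.
Qed.

Lemma thf_false_neq0 b e : e != 0 -> thf false b e != 0.
Proof. by move=> e0; rewrite tofrac_eq0 theta_false_neq0. Qed.

Lemma thf_true_eq0 b e : e != 0 -> (thf true b e == 0) = (p%:Z %| b)%Z && (e == 1).
Proof. by move=> e0; rewrite tofrac_eq0 theta_true_eq0. Qed.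

Lemma kapN b e : kap (- b) e^-1 = kap b e.
Proof. by rewrite /kap /thf !thetaN. Qed.

Lemma kap_shift b e : e != 0 -> kap (b + p%:Z) e = kap b e.
Proof.
move=> e0; rewrite /kap /thf !theta_shift // !rmorphM /=.
have m0 : tofrac (mono (e ^ (- 2%:Z)) 0) != 0 :> L.
  rewrite tofrac_eq0; apply/eqP => /(congr1 (fun f => coefs f 0)) /eqP.
  by rewrite coefs_mono expfz_eq0 (negPf e0) andbF.
by rewrite mulrCA -mulf_div divff // mul1r.
Qed.

Lemma sqrfD (x y : L) : (x + y) ^+ 2 = x ^+ 2 + y ^+ 2.
Proof. by rewrite sqrrD mulrn_pchar // addr0. Qed.

Lemma kap_sqrD b b' e e' : e != 0 -> e' != 0 -> thf true b e != 0 -> thf true b' e' != 0 ->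
  kap b e ^+ 2 + kap b' e' ^+ 2 =
  gamf ^+ 2 * (thf true (b + b') (e * e') * thf true (b - b') (e / e')) /
  (thf true b e ^+ 2 * thf true b' e' ^+ 2).
Proof. by move=> e0 e0' s0 s0'; rewrite (thfM _ _ _ e0 e0') (sqr_quotients _ _ _ s0 s0'). Qed.

(** It is enough to compare squares. By [kap_sqrD] at P + Q and P - Q, the square of the left side
    involves the theta series at 2P and 2Q; duplication turns these into the theta series at P and
    Q, and [kap_sqrD] at P and Q produces the denominator. *)
Lemma kap_addition b b' e e' : e != 0 -> e' != 0 -> thf true b e != 0 -> thf true b' e' != 0 ->
    thf true (b + b') (e * e') != 0 -> thf true (b - b') (e / e') != 0 ->
  kap (b + b') (e * e') + kap (b - b') (e / e') =
  kap b e * kap b' e' / (kap b e + kap b' e') ^+ 2.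
Proof.
move=> e0 e0' s0 s0' sp sm; apply: (sqrf_inj charL).
rewrite /= [LHS]sqrfD [LHS]kap_sqrD ?mulf_neq0 ?invr_eq0 //.
have -> : b + b' + (b - b') = b * 2 by ring.
have -> : b + b' - (b - b') = b' * 2 by ring.
have -> : e * e' * (e / e') = e ^+ 2 by rewrite mulrACA divff // mulr1 expr2.
have -> : e * e' / (e / e') = e' ^+ 2 by rewrite invfM invrK mulrACA divff // mul1r expr2.
have -> : gamf ^+ 2 * (thf true (b * 2) (e ^+ 2) * thf true (b' * 2) (e' ^+ 2)) =
    (thf false b e ^+ 2 * thf true b e ^+ 2) * (thf false b' e' ^+ 2 * thf true b' e' ^+ 2).
  by rewrite !thf_double_odd // expr2 mulrACA.
rewrite (addition_quotients _ _ gamf_neq0 s0 s0' sp sm) -(kap_sqrD e0 e0' s0 s0') -sqrfD.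
by rewrite -exprVn -exprMn.
Qed.

Lemma kap_double b e : e != 0 -> thf true b e != 0 ->
  kap (b * 2) (e ^+ 2) = kap b e ^+ 2 + gamf ^+ 4 / kap b e ^+ 2.
Proof.
move=> e0 s0; have f0 := thf_false_neq0 b e0; have g0 := gamf_neq0.
have E := thf_double_odd b e0.
rewrite {1}/kap thf_double_even.
have -> : thf true (b * 2) (e ^+ 2) = thf false b e ^+ 2 * thf true b e ^+ 2 / gamf.
  by rewrite E mulrAC divff // mul1r.
by rewrite (double_quotients g0 f0 s0).
Qed.

Lemma kap_neq0 b e : e != 0 -> thf true b e != 0 -> kap b e != 0.
Proof.
by move=> e0 s0; exact: quotient_neq0 gamf_neq0 (thf_false_neq0 b e0) s0.
Qed.

(** An abscissa determines its point up to sign: the sum of the two squares is, up to nonzero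
    factors, the product of [theta true] at P + Q and at P - Q. *)
Lemma kap_eq b b' e e' : e != 0 -> e' != 0 -> thf true b e != 0 -> thf true b' e' != 0 ->
    kap b e = kap b' e' ->
  (thf true (b + b') (e * e') == 0) || (thf true (b - b') (e / e') == 0).
Proof.
move=> e0 e0' s0 s0' E; have := kap_sqrD e0 e0' s0 s0'.
rewrite -E (addrr_pchar2 charL) => /esym; exact: quotient_eq0 gamf_neq0 s0 s0'.
Qed.

Lemma kap_lambert b e : e != 0 -> (forall n, p%:Z * n + b = 0 -> e ^+ 2 != 1) ->
  thf true b e != 0 -> kap b e = tofrac (lambert p (4 * p) b e).
Proof.
move=> e0 e1 s0; apply: (mulfI s0); rewrite /kap mulrC divfK // /thf /gamf -!rmorphM /=.
by rewrite theta_lambert // mulrC.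
Qed.

End Kappa.

(** * Division polynomials *)

(* The values at the multiples of a point of the numerator and the denominator
   of the multiplication maps of a curve with Delta = D and a_1 = 1 in
   characteristic 2; a n / b n is the abscissa of the n-th multiple. *)
Record multiples (L : fieldType) (D x : L) (a b : nat -> L) : Prop := Multiples {
  mult0a : a 0%N = 1; mult0b : b 0%N = 0; mult1a : a 1%N = x; mult1b : b 1%N = 1;
  mult_even_a : forall n, a n.*2 = a n ^+ 4 + D * b n ^+ 4;
  mult_even_b : forall n, b n.*2 = a n ^+ 2 * b n ^+ 2;
  mult_odd_a : forall n, x * a n.*2.+1 = (a n.+1 * a n) ^+ 2 + D * (b n.+1 * b n) ^+ 2;
  mult_odd_b : forall n, b n.*2.+1 = (a n.+1 * b n + b n.+1 * a n) ^+ 2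
}.

Section PolyFacts.
Variable A : idomainType.
Implicit Types p q : {poly A}.

Lemma coefM_top p q m n : (size p <= m.+1)%N -> (size q <= n.+1)%N ->
  (p * q)`_(m + n) = p`_m * q`_n.
Proof.
move=> sp sq; rewrite coefM; have lt : (m < (m + n).+1)%N by rewrite ltnS leq_addr.
rewrite (bigD1 (Ordinal lt)) //= addKn big1 ?addr0 // => i.
rewrite -val_eqE /= neq_ltn => /orP[im|mi].
  by rewrite [q`__]nth_default ?mulr0 // (leq_trans sq) //; lia.
by rewrite [p`__]nth_default ?mul0r // (leq_trans sp).
Qed.

Lemma size_monic_mul p q m n : p \is monic -> q \is monic -> size p = m.+1 -> size q = n.+1 ->
  size (p * q) = (m + n).+1.
Proof. by move=> mp mq sp sq; rewrite size_monicM ?monic_neq0 // sp sq addnS. Qed.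

Lemma size_monicX p m n : p \is monic -> size p = m.+1 -> size (p ^+ n) = (m * n).+1.
Proof.
move=> mp sp; elim: n => [|n IHn]; first by rewrite expr0 size_poly1 muln0.
by rewrite exprS (size_monic_mul mp _ sp IHn) ?monic_exp // mulnS.
Qed.

Lemma monic_addl p q : p \is monic -> (size q < size p)%N ->
  p + q \is monic /\ size (p + q) = size p.
Proof.
by move=> mp lt; rewrite monicE lead_coefDl // (monicP mp) eqxx size_polyDl.
Qed.

Lemma size_mul_le p q m n : (size p <= m.+1)%N -> (size q <= n.+1)%N ->
  (size (p * q)%R <= (m + n).+1)%N.
Proof. by move=> sp sq; apply: leq_trans (size_polyMleq _ _) _; lia. Qed.

Lemma size_exp_le p m n : (size p <= m.+1)%N -> (size (p ^+ n)%R <= (m * n).+1)%N.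
Proof.
move=> sp; elim: n => [|n IHn]; first by rewrite expr0 size_poly1.
by rewrite exprS mulnS size_mul_le.
Qed.

Lemma size_mulC_le (c : A) p : (size (c%:P * p)%R <= size p)%N.
Proof. by rewrite mul_polyC size_scale_leq. Qed.

End PolyFacts.

Section Division.
Variables (A : idomainType) (D : A).
Hypothesis char2 : 2%N \in [pchar A].

(** The point of abscissa 0 has order 2, so its odd multiples have abscissa 0 and its even multiples
    are the origin. The last condition records this; it yields the factor X to be divided out in the
    recursion for odd indices. The coefficient [n%:R] controls the degree of the odd
    denominators. *)
Definition division_spec n (f g : {poly A}) : Prop :=
  [/\ f \is monic, size f = (n ^ 2).+1, (size g <= n ^ 2)%N,
      g`_(n ^ 2).-1 = n%:R & if odd n then f`_0 = 0 else g`_0 = 0].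

(** The abscissa x is taken nonzero because the recursion at an odd index determines only the
    product of x and the numerator. *)
Definition division_eval n (f g : {poly A}) : Prop :=
  forall (L : fieldType) (phi : {rmorphism A -> L}) x a b,
    multiples (phi D) x a b -> x != 0 ->
  a n = (map_poly phi f).[x] /\ b n = (map_poly phi g).[x].

(** In degree 2 m (m + 1) the two products have the coefficients m and m + 1, whose sum is 1 in
    characteristic 2. *)
Lemma division_odd_spec m f g f' g' : (0 < m)%N ->
    division_spec m f g -> division_spec m.+1 f' g' ->
  let h := f' * g + g' * f in
  h \is monic /\ size h = (2 * m * m.+1).+1.
Proof.
move=> m0 [mf sf sg cg _] [mf' sf' sg' cg' _] h.
have e1 : (2 * m * m.+1 = m.+1 ^ 2 + (m ^ 2).-1)%N by rewrite -!mulnn; nia.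
have e2 : (2 * m * m.+1 = (m.+1 ^ 2).-1 + m ^ 2)%N by rewrite -!mulnn; nia.
have mm : ((m ^ 2).-1.+1 = m ^ 2)%N by rewrite prednK // expn_gt0 m0.
have top : h`_(2 * m * m.+1) = 1.
  rewrite coefD {1}e1 coefM_top ?sf' ?mm // e2 coefM_top ?sf ?prednK ?expn_gt0 //.
  have -> : f'`_(m.+1 ^ 2) = 1 by rewrite -(monicP mf') lead_coefE sf'.
  have -> : f`_(m ^ 2) = 1 by rewrite -(monicP mf) lead_coefE sf.
  by rewrite cg cg' mul1r mulr1 mulrS addrCA addrr_pchar2 // addr0.
have sh : (size h <= (2 * m * m.+1).+1)%N.
  rewrite (leq_trans (size_polyD _ _)) // geq_max {1}e1 e2.
  by rewrite !size_mul_le ?sf ?sf' ?mm ?prednK ?expn_gt0.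
have sh' : size h = (2 * m * m.+1).+1.
  apply/eqP; rewrite eqn_leq sh /=; apply: contraT; rewrite -ltnNge ltnS => le.
  by move: top; rewrite nth_default // => /eqP; rewrite eq_sym oner_eq0.
by rewrite monicE lead_coefE sh' top.
Qed.

Lemma division_polys n : exists f g, division_spec n f g /\ division_eval n f g.
Proof.
elim/ltn_ind: n => -[_|[_|n IHn]].
- exists 1, 0; split.
    by split; rewrite ?monic1 ?size_poly1 ?size_poly0 ?coef0.
  by move=> L phi x a b [-> -> *]; rewrite rmorph1 rmorph0 hornerC horner0.
- exists 'X, 1; split.
    by split; rewrite ?monicX ?size_polyX ?size_poly1 ?coefX ?coef1.
  by move=> L phi x a b [_ _ -> -> *]; rewrite map_polyX rmorph1 hornerX hornerC.
have [on|en] := boolP (odd n); last first.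
  set m := n.+2./2; have nE : n.+2 = m.*2 by rewrite even_halfK //= negbK.
  have m0 : (0 < m)%N by [].
  have [|f [g [[mf sf sg cg pg] ev]]] := IHn m; first by lia.
  have mm : ((m ^ 2).-1.+1 = m ^ 2)%N by rewrite prednK // expn_gt0 m0.
  exists (f ^+ 4 + D%:P * g ^+ 4), (f ^+ 2 * g ^+ 2); split; last first.
    move=> L phi x a b mu x0; have [aE bE] := ev L phi x a b mu x0.
    rewrite nE (mult_even_a mu) (mult_even_b mu) aE bE.
    split; last by rewrite [map_poly _ (f ^+ 2 * _)]rmorphM !rmorphXn /= !hornerE.
    rewrite [map_poly phi (_ + _)]rmorphD /= [map_poly phi (D%:P * _)]rmorphM /= !rmorphXn /=.
    by rewrite map_polyC /= !hornerE.
  have sf4 : size (f ^+ 4) = (n.+2 ^ 2).+1.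
    by rewrite (size_monicX _ mf sf) nE; congr (_.+1); rewrite -!mulnn; lia.
  have sg4 : (size (D%:P * g ^+ 4)%R < size (f ^+ 4)%R)%N.
    rewrite sf4 ltnS (leq_trans (size_mulC_le _ _)) //.
    have := @size_exp_le _ g (m ^ 2).-1 4; rewrite mm => /(_ sg) /leq_trans; apply.
    by rewrite nE -!mulnn; nia.
  have [mF sF] := monic_addl (monic_exp 4 mf) sg4.
  have sG : (size (f ^+ 2 * g ^+ 2)%R <= (m ^ 2 * 2 + (m ^ 2).-1 * 2).+1)%N.
    by rewrite size_mul_le ?size_exp_le ?sf ?mm.
  have lt : ((m ^ 2 * 2 + (m ^ 2).-1 * 2).+1 <= (n.+2 ^ 2).-1)%N by rewrite nE -!mulnn; nia.
  split=> //; first by rewrite sF.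
  - by apply: leq_trans sG (leq_trans lt (leq_pred _)).
  - by rewrite nth_default ?(leq_trans sG) // nE -mul2n natrM (pcharf0 char2) mul0r.
  - rewrite nE odd_double coefM big_ord1 /=.
    have sq (q : {poly A}) : (q ^+ 2)`_0 = q`_0 ^+ 2 by rewrite -!horner_coef0 horner_exp.
    by rewrite !sq; case: ifP pg => _ ->; rewrite expr0n ?mul0r ?mulr0.
set m := n.+1./2; have nE : n.+2 = m.*2.+1 by rewrite -[n.+1]even_halfK //= on.
have m0 : (0 < m)%N by rewrite /m; case: (n) on => // -[].
have [|f [g [sp ev]]] := IHn m; first by lia.
have [|f' [g' [sp' ev']]] := IHn m.+1; first by lia.
have [mh sh] := division_odd_spec m0 sp sp'.
set h := _ + _ in mh sh.
pose F2 := (f' * f) ^+ 2 + D%:P * (g' * g) ^+ 2.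
case: sp sp' => [mf sf sg cg pg] [mf' sf' sg' cg' pg'].
have mm : ((m ^ 2).-1.+1 = m ^ 2)%N by rewrite prednK // expn_gt0 m0.
have ff0 : (f' * f)`_0 = 0 /\ (g' * g)`_0 = 0.
  rewrite !coefM !big_ord1 /=; move: pg pg' => /=.
  by case: (odd m) => /= -> ->; rewrite ?mulr0 ?mul0r.
have coef_sqr (q : {poly A}) : q`_0 = 0 -> (q ^+ 2)`_0 = 0 /\ (q ^+ 2)`_1 = 0.
  by move=> q0; rewrite expr2 !coefM big_ord1 big_ord_recl big_ord1 /= q0 !mul0r mulr0 addr0.
(* The double zero at 0 is used twice: one factor X is divided out, and the other is the condition
   at 0 for the new odd index. *)
have [F0 F1] : F2`_0 = 0 /\ F2`_1 = 0.
  have [/coef_sqr[a0 a1] /coef_sqr[b0 b1]] := ff0.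
  by rewrite !coefD !coefCM a0 a1 b0 b1 mulr0 addr0.
have mff : f' * f \is monic by rewrite monicMl.
have sff : size (f' * f) = (m.+1 ^ 2 + m ^ 2).+1 by exact: size_monic_mul.
have sff2 : size ((f' * f) ^+ 2) = (n.+2 ^ 2).+2.
  by rewrite (size_monicX _ mff sff) nE; congr (_.+1); rewrite -!mulnn; lia.
have sgg2 : (size (D%:P * (g' * g) ^+ 2)%R < size ((f' * f) ^+ 2)%R)%N.
  rewrite sff2 ltnS (leq_trans (size_mulC_le _ _)) //.
  have sgg : (size (g' * g)%R <= ((m.+1 ^ 2).-1 + (m ^ 2).-1).+1)%N.
    by rewrite size_mul_le ?mm ?prednK ?expn_gt0.
  by apply: leq_trans (size_exp_le 2 sgg) _; rewrite nE -!mulnn; nia.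
have [mF sF] := monic_addl (monic_exp 2 mff) sgg2.
have XF : F2 = drop_poly 1 F2 * 'X.
  rewrite -[LHS](poly_take_drop 1) expr1 [X in X + _](_ : _ = 0) ?add0r //.
  by apply/polyP => -[|i]; rewrite coef_take_poly coef0.
exists (drop_poly 1 F2), (h ^+ 2); split; last first.
  move=> L phi x a b mu x0; have [aE bE] := ev L phi x a b mu x0.
  have [aE' bE'] := ev' L phi x a b mu x0.
  rewrite nE (mult_odd_b mu) aE bE aE' bE'; split.
    apply: (mulfI x0); rewrite (mult_odd_a mu) aE bE aE' bE'.
    transitivity (map_poly phi F2).[x].
      rewrite [map_poly phi (_ + _)]rmorphD /= [map_poly phi (D%:P * _)]rmorphM /= !rmorphXn !rmorphM /=.
      by rewrite map_polyC /= !hornerE.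
    by rewrite {1}XF rmorphM /= map_polyX hornerMX mulrC.
  by rewrite rmorphXn rmorphD !rmorphM /= !hornerE.
have n2 : (n.+2 ^ 2 = (2 * m * m.+1 * 2).+1)%N by rewrite nE -mulnn; nia.
have sF' : size (drop_poly 1 F2) = (n.+2 ^ 2).+1 by rewrite size_drop_poly sF sff2 subn1.
have sh2 : size (h ^+ 2) = (2 * m * m.+1 * 2).+1 by exact: size_monicX.
split=> //.
- by rewrite -(monicMr _ (monicX A)) -XF.
- by rewrite sh2 n2.
- have -> : (n.+2 ^ 2).-1 = (size (h ^+ 2)).-1 by rewrite n2 sh2.
  rewrite -lead_coefE (monicP (monic_exp 2 mh)) nE -addn1 natrD -mul2n natrM.
  by rewrite (pcharf0 char2) mul0r add0r.
- by rewrite /= negbK on; rewrite coef_drop_poly.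
Qed.

(* A p-torsion point has b p = 0, so h kills the abscissas of the (p^2 - 1) / 2
   pairs of opposite p-torsion points. *)
Lemma division_poly_odd n : odd n -> exists h : {poly A},
  [/\ h \is monic, size h = (n ^ 2)./2.+1 &
    forall (L : fieldType) (phi : {rmorphism A -> L}) x a b,
      multiples (phi D) x a b -> x != 0 -> b n = (map_poly phi h).[x] ^+ 2].
Proof.
move=> on; have nE : n = (n./2).*2.+1 by rewrite -{1}(odd_double_half n) on.
have [n2|m0] := posnP n./2.
  exists 1; rewrite monic1 size_poly1 nE n2; split=> // L phi x a b mu _.
  by rewrite (mult1b mu) rmorph1 hornerC expr1n.
have [f [g [sp ev]]] := division_polys n./2.
have [f' [g' [sp' ev']]] := division_polys n./2.+1.
have [mh sh] := division_odd_spec m0 sp sp'.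
exists (f' * g + g' * f); split=> //.
  by rewrite sh; congr (_.+1); rewrite {3}nE -mulnn; nia.
move=> L phi x a b mu x0; have [aE bE] := ev L phi x a b mu x0.
have [aE' bE'] := ev' L phi x a b mu x0.
by rewrite {1}nE (mult_odd_b mu) aE bE aE' bE' rmorphD !rmorphM /= !hornerE.
Qed.

End Division.

Lemma torsion_integral (A : idomainType) (D : A) (L : fieldType) (phi : {rmorphism A -> L}) x a b n :
    2%N \in [pchar A] -> multiples (phi D) x a b -> x != 0 -> odd n -> b n = 0 ->
  integralOver phi x.
Proof.
move=> charA mu x0 on bn0; have [h [mh _ hE]] := division_poly_odd D charA on.
exists h => //; have := hE _ _ _ _ _ mu x0; rewrite bn0 => /esym/eqP.
by rewrite expf_eq0.
Qed.

(** * Rationality and integrality *)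

Lemma fracP (R : idomainType) (x : {fraction R}) :
  exists nd : R * R, nd.2 != 0 /\ x = tofrac nd.1 / tofrac nd.2.
Proof.
exists (frac (repr x)); split; first exact: denom_ratioP.
have d0 := denom_ratioP (repr x).
apply: (mulIf (_ : tofrac (frac (repr x)).2 != 0)); rewrite ?tofrac_eq0 // divfK ?tofrac_eq0 //.
rewrite -{1}[x]reprK; unlock tofrac; rewrite -[LHS]FracField.pi_mul.
apply/eqmodP; rewrite /= FracField.equivfE /FracField.mulf !numden_Ratio ?mulr1 ?oner_neq0 //.
by rewrite mulrC.
Qed.

Section FractionLift.
Variables (R : idomainType) (L : fieldType) (phi : {rmorphism R -> L}).
Hypothesis phi_inj : injective phi.

Definition frac_lift (x : {fraction R}) : L :=
  phi (projT1 (cid (fracP x))).1 / phi (projT1 (cid (fracP x))).2.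

Let phi_neq0 a : a != 0 -> phi a != 0.
Proof. by apply: contraNneq => a0; apply/eqP/phi_inj; rewrite a0 rmorph0. Qed.

Lemma frac_liftE a b : b != 0 -> frac_lift (tofrac a / tofrac b) = phi a / phi b.
Proof.
move=> b0; rewrite /frac_lift; case: cid => -[n d] /= [d0 /eqP].
rewrite eqr_div ?tofrac_eq0 // -!rmorphM /= tofrac_eq => /eqP E.
by apply/eqP; rewrite eqr_div ?phi_neq0 // -!rmorphM E.
Qed.

Lemma frac_lift_tofrac a : frac_lift (tofrac a) = phi a.
Proof. by rewrite -[tofrac a]divr1 -(rmorph1 (@tofrac R)) frac_liftE ?oner_neq0 // rmorph1 divr1. Qed.

Lemma frac_lift_zmod : zmod_morphism frac_lift.
Proof.
move=> x y; have [[a b] [/= b0 ->]] := fracP x; have [[c d] [/= d0 ->]] := fracP y.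
rewrite -mulNr addf_div ?tofrac_eq0 // -rmorphN -!rmorphM -rmorphD /= !frac_liftE ?mulf_neq0 //.
by rewrite rmorphD !rmorphM rmorphN /= -mulNr addf_div ?phi_neq0.
Qed.

Lemma frac_lift_monoid : monoid_morphism frac_lift.
Proof.
split; first by rewrite -(rmorph1 (@tofrac R)) frac_lift_tofrac rmorph1.
move=> x y; have [[a b] [/= b0 ->]] := fracP x; have [[c d] [/= d0 ->]] := fracP y.
by rewrite mulf_div -!rmorphM /= !frac_liftE ?mulf_neq0 // !rmorphM mulf_div.
Qed.

HB.instance Definition _ := GRing.isZmodMorphism.Build _ _ frac_lift frac_lift_zmod.
HB.instance Definition _ := GRing.isMonoidMorphism.Build _ _ frac_lift frac_lift_monoid.

Lemma frac_lift_ex : exists lift : {rmorphism {fraction R} -> L},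
  forall a, lift (tofrac a) = phi a.
Proof. by exists (frac_lift : {rmorphism _ -> _}); exact: frac_lift_tofrac. Qed.

End FractionLift.

(** The rational root argument: for a fraction a / b in lowest terms, clearing denominators in a
    monic equation shows that b divides a power of a, hence that b is constant. *)
Lemma poly_integrally_closed (F L : fieldType) (phi : {rmorphism {poly F} -> L})
    (lift : {rmorphism {fraction {poly F}} -> L}) (phi_inj : injective phi)
    (liftE : forall a, lift (tofrac a) = phi a) (z : {fraction {poly F}}) :
  integralOver phi (lift z) -> exists q, z = tofrac q.
Proof.
have [[a b] [/= b0 zE]] := fracP z.
have ab0 : (a != 0) || (b != 0) by rewrite b0 orbT.
have := coprimep_div_gcd ab0; have : gcdp a b != 0 by rewrite gcdp_eq0 negb_and.
have [a' aE] := dvdpP _ _ (dvdp_gcdl a b); have [b' bE] := dvdpP _ _ (dvdp_gcdr a b).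
move: (gcdp a b) aE bE => g aE bE g0; rewrite aE bE !mulpK // => co.
have b0' : b' != 0 by apply: contraNneq b0 => b'0; rewrite bE b'0 mul0r.
have {zE} zE : z = tofrac a' / tofrac b'.
  rewrite zE aE bE !rmorphM /= -mulf_div divff ?mulr1 // tofrac_eq0 //.
rewrite zE fmorph_div /= !liftE => -[P mP /rootP].
set n := size P; rewrite (@horner_coef_wide _ n) ?size_poly // => P0.
have Pn : n = n.-1.+1 by rewrite prednK // lt0n size_poly_eq0 monic_neq0.
have pb0 : phi b' != 0 by apply: contraNneq b0' => pb; apply/eqP/phi_inj; rewrite pb rmorph0.
have E : \sum_(i < n) P`_i * a' ^+ i * b' ^+ (n.-1 - i) = 0.
  apply: phi_inj; rewrite rmorph0 rmorph_sum /=.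
  transitivity (phi b' ^+ n.-1 * \sum_(i < n) (map_poly phi P)`_i * (phi a' / phi b') ^+ i);
    last by rewrite P0 mulr0.
  rewrite mulr_sumr; apply: eq_bigr => i _; rewrite coef_map /= !rmorphM !rmorphXn /=.
  have le : (i <= n.-1)%N by rewrite -ltnS -Pn.
  rewrite -{2}(subnK le) exprD expr_div_n; field.
  by rewrite expf_neq0.
have ba : b' %| a' ^+ n.-1.
  move: E; rewrite Pn big_ord_recr /= subnn expr0 mulr1.
  have -> : P`_n.-1 = 1 by rewrite -(monicP mP) lead_coefE.
  rewrite mul1r => /eqP; rewrite addrC addr_eq0 => /eqP ->; rewrite dvdpNr.
  apply: (big_ind (fun q => b' %| q)) => [|p q|i _]; [exact: dvdp0|exact: dvdp_add|].
  rewrite dvdp_mull // (_ : (n.-1 - i = (n.-1 - i).-1.+1)%N) ?exprS ?dvdp_mulr //.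
  by rewrite prednK // subn_gt0.
have cb : coprimep b' (a' ^+ n.-1) by rewrite coprimep_expr // coprimep_sym.
have := Gauss_dvdpr 1 cb; rewrite mulr1 ba dvdp1 => /esym/size_poly1P[c c0 bcE].
exists (c^-1 *: a'); rewrite bcE.
have cF0 : tofrac c%:P != 0 :> {fraction {poly F}} by rewrite tofrac_eq0 polyC_eq0.
apply: (mulIf cF0); rewrite divfK // -rmorphM /= mulrC mul_polyC scalerA divff //.
by rewrite scale1r.
Qed.

(** * Symmetric functions of the values at the roots of a separable polynomial *)

Section RationalFunctions.
Variables (K0 L : fieldType) (emb : {rmorphism K0 -> L}).
Local Notation "p ^i" := (map_poly emb p) (at level 2, format "p ^i").

Section Roots.
Variables (rho : {poly K0}) (xs : seq L).
Hypothesis xs_neq0 : (0 < size xs)%N.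
Hypothesis xs_uniq : uniq xs.
Hypothesis rhoE : rho^i = \prod_(x <- xs) ('X - x%:P).

Lemma root_rho x : root rho^i x = (x \in xs).
Proof. by rewrite rhoE root_prod_XsubC. Qed.

Lemma rho_monic : rho \is monic.
Proof. by rewrite -(map_monic emb) rhoE monic_prod_XsubC. Qed.

Lemma dvd_rho (q : {poly L}) : (rho^i %| q) = all (root q) xs.
Proof.
apply/idP/allP => [dv x xin|rt].
  by rewrite -dvdp_XsubCl; apply: dvdp_trans dv; rewrite dvdp_XsubCl root_rho.
by rewrite rhoE uniq_roots_dvdp //; [apply/allP|rewrite uniq_rootsE].
Qed.

(** As q has no root in common with rho, a Bezout relation between them, evaluated at the roots of
    rho, gives the inverse. *)
Lemma rational_inv (q : {poly K0}) : (forall x, x \in xs -> q^i.[x] != 0) ->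
  exists q' : {poly K0}, forall x, x \in xs -> q'^i.[x] = q^i.[x]^-1.
Proof.
move=> qx; have co : coprimep q rho.
  rewrite -(coprimep_map emb) rhoE big_seq.
  elim/big_ind: _ => [|u v cu cv|x xin]; first exact: coprimep1.
    by rewrite coprimepMr cu.
  by rewrite coprimep_XsubC rootE qx.
have /Bezout_eq1_coprimepP[[u v] /= E] := co.
exists u => x xin; have rx : rho^i.[x] = 0 by apply/rootP; rewrite root_rho.
have := congr1 (fun f => f^i.[x]) E; rewrite rmorphD !rmorphM rmorph1 /= !hornerE rx mulr0 addr0.
by move=> ux; apply: (mulIf (qx x xin)); rewrite mulVf ?qx.
Qed.

(** The companion matrix C of rho has the distinct eigenvalues [xs], so a polynomial q kills R(C)
    exactly when q vanishes at every R(x). The minimal polynomial of R(C) therefore has the values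
    as simple roots; its coefficients are in the base field, and it does not change under extension
    of scalars. *)
Lemma minpoly_values (R : {poly K0}) (vs : seq L) : uniq vs ->
    (forall v, (v \in vs) = (v \in [seq R^i.[x] | x <- xs])) ->
  exists Phi : {poly K0}, Phi^i = \prod_(v <- vs) ('X - v%:P).
Proof.
move=> uvs vsE; have rm := rho_monic.
have srho : size rho = (size xs).-1.+2.
  by rewrite -(size_map_poly emb) rhoE size_prod_XsubC prednK.
have [C CE] : exists C : 'M[K0]_((size xs).-1.+1), char_poly C = rho.
  by have := companionmxK rm; move: (companionmx rho); rewrite srho => C CE; exists C.
set M := horner_mx C R; exists (mxminpoly M); rewrite -mxminpoly_map.
have comp (q : {poly L}) : horner_mx (map_mx emb M) q = horner_mx (map_mx emb C) (q \Po R^i).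
  rewrite /M map_horner_mx; elim/poly_ind: q => [|q c IH]; first by rewrite comp_poly0 !rmorph0.
  rewrite comp_polyD comp_polyM comp_polyX comp_polyC !rmorphD !rmorphM /= IH horner_mx_X.
  by rewrite !horner_mx_C.
have zero_iff (q : {poly L}) : (horner_mx (map_mx emb C) q == 0) = all (root q) xs.
  rewrite -dvd_rho -CE map_char_poly; apply/idP/idP => [|/dvdpP[u ->]]; last first.
    by rewrite rmorphM /= Cayley_Hamilton mulr0.
  rewrite -dvd_mxminpoly => dv; rewrite -map_char_poly CE dvd_rho; apply/allP => x xin.
  rewrite -dvdp_XsubCl; apply: dvdp_trans dv; rewrite dvdp_XsubCl.
  by rewrite root_mxminpoly -map_char_poly CE root_rho.
apply/eqP; rewrite -eqp_monic ?mxminpoly_monic ?monic_prod_XsubC // /eqp; apply/andP; split.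
  rewrite dvd_mxminpoly comp zero_iff; apply/allP => x xin.
  by rewrite rootE horner_comp -rootE root_prod_XsubC vsE map_f.
apply: uniq_roots_dvdp; last by rewrite uniq_rootsE.
apply/allP => v; rewrite vsE => /mapP[x xin ->].
have := mx_root_minpoly (map_mx emb M); rewrite comp => /eqP; rewrite zero_iff => /allP/(_ x xin).
by rewrite !rootE horner_comp.
Qed.

End Roots.

Lemma deriv_prod_XsubC (vs : seq L) : uniq vs ->
  (\prod_(v <- vs) ('X - v%:P))^`() = \sum_(v <- vs) \prod_(u <- rem v vs) ('X - u%:P).
Proof.
elim: vs => [|a s IHs] /= => [_|/andP[aN us]]; first by rewrite !big_nil derivC.
rewrite !big_cons derivM derivXsubC mul1r IHs // eqxx; congr (_ + _).
rewrite mulr_sumr big_seq [RHS]big_seq; apply: eq_bigr => v vin.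
have av : a != v by apply: contraNneq aN => ->.
by rewrite (negPf av) big_cons.
Qed.

(** Modulo Phi, g Phi' is the sum of the g(v) times the product of the X - u, u <> v, which is monic
    of degree one less than Phi. The sum of the g(v) is thus a coefficient of a remainder, and lies
    in any field containing the coefficients of g and Phi. *)
Lemma sum_horner_roots (g : {poly L}) (vs : seq L) (Phi := \prod_(v <- vs) ('X - v%:P)) :
    uniq vs -> (0 < size vs)%N ->
  \sum_(v <- vs) g.[v] = ((g * Phi^`()) %% Phi)`_(size vs).-1.
Proof.
move=> uvs vs0; have PhiE v : v \in vs -> Phi = ('X - v%:P) * \prod_(u <- rem v vs) ('X - u%:P).
  by move=> vin; rewrite /Phi (perm_big _ (perm_to_rem vin)) big_cons.
have szr v : v \in vs -> size (\prod_(u <- rem v vs) ('X - u%:P)) = size vs.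
  by move=> vin; rewrite size_prod_XsubC size_rem // prednK.
set r := \sum_(v <- vs) g.[v] *: \prod_(u <- rem v vs) ('X - u%:P).
have szR : (size r <= size vs)%N.
  rewrite /r big_seq; apply: (big_ind (fun q : {poly L} => size q <= size vs)%N).
  - by rewrite size_poly0.
  - by move=> p q sp sq; rewrite (leq_trans (size_polyD _ _)) // geq_max sp.
  - by move=> v vin; rewrite (leq_trans (size_scale_leq _ _)) ?szr.
have [q qE] : exists q, g * Phi^`() = q * Phi + r.
  exists (\sum_(v <- vs) (g - g.[v]%:P) %/ ('X - v%:P)).
  rewrite /Phi deriv_prod_XsubC // -/Phi mulr_sumr mulr_suml /r -big_split big_seq [RHS]big_seq.
  apply: eq_bigr => v vin; rewrite /= -mul_polyC {1}(PhiE v vin) mulrA divpK ?dvdp_XsubCl.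
    by rewrite mulrBl subrK.
  by rewrite rootE !hornerE subrr.
rewrite qE modp_addl_mul_small; last by rewrite size_prod_XsubC ltnS.
rewrite coef_sum big_seq [RHS]big_seq; apply: eq_bigr => v vin.
have := monicP (monic_prod_XsubC (rem v vs) xpredT id); rewrite lead_coefE szr // => co1.
by rewrite coefZ co1 mulr1.
Qed.

End RationalFunctions.

(** * Theta values at the multiples of a point *)

Section MultiplesOfSequences.
Variables (F : fieldType) (c g : F) (S : bool -> nat -> F).
Hypothesis char2 : 2%N \in [pchar F].
Hypothesis g0 : g != 0.
Hypothesis cS : c * S true 1%N = g.
Hypothesis S00 : S false 0%N = 1.
Hypothesis S10 : S true 0%N = 0.
Hypothesis Sodd : forall n, S false n ^+ 2 * S true n ^+ 2 = g * S true n.*2.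
Hypothesis Seven : forall n, S false n.*2 = S false n ^+ 4 + S true n ^+ 4.
Hypothesis Ssucc : forall j n, S j n.*2.+1 * S j 1%N =
  S false n.+1 ^+ 2 * S j n ^+ 2 + S true n.+1 ^+ 2 * S (~~ j) n ^+ 2.

(** The weight c^(n^2) respects the theta relations, because (2 n)^2 = 4 n^2 and (2 n + 1)^2 + 1 = 2
    ((n + 1)^2 + n^2). The value of c makes the first denominator equal to 1. *)
Lemma multiples_sequences : multiples (g ^+ 4) (c * S false 1%N)
  (fun n => c ^+ (n ^ 2) * S false n) (fun n => c ^+ (n ^ 2) * S true n / g).
Proof.
have sq1 n : c ^+ (n.*2 ^ 2) = (c ^+ (n ^ 2)) ^+ 4.
  by rewrite -exprM; congr (_ ^+ _); rewrite -!mulnn; lia.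
have sq2 n : c * c ^+ (n.*2.+1 ^ 2) = (c ^+ (n.+1 ^ 2) * c ^+ (n ^ 2)) ^+ 2.
  by rewrite -exprS -exprD -exprM; congr (_ ^+ _); rewrite -!mulnn; lia.
split=> [||||n|n|n|n].
- by rewrite expr0 mul1r.
- by rewrite S10 mulr0 mul0r.
- by rewrite expr1.
- by rewrite expr1 cS divff.
- by rewrite sq1 Seven; field.
- rewrite sq1; have -> : S true n.*2 = S false n ^+ 2 * S true n ^+ 2 / g.
    by rewrite Sodd mulrC mulKf.
  by field.
- transitivity ((c * c ^+ (n.*2.+1 ^ 2)) * (S false n.*2.+1 * S false 1%N)); first by ring.
  by rewrite sq2 Ssucc; field.
- transitivity ((c * c ^+ (n.*2.+1 ^ 2)) * (S true n.*2.+1 * S true 1%N) / g ^+ 2).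
    have -> : c * c ^+ (n.*2.+1 ^ 2) * (S true n.*2.+1 * S true 1%N) =
      c ^+ (n.*2.+1 ^ 2) * S true n.*2.+1 * (c * S true 1%N) by ring.
    by rewrite cS; field.
  rewrite sq2 Ssucc sqrrD mulrn_pchar // addr0; by field.
Qed.

End MultiplesOfSequences.

Section Multiples.
Variables (k : fieldType) (p : nat).
Hypothesis char2 : 2%N \in [pchar k].
Hypothesis odd_p : odd p.
Variables (b : int) (e : k).
Hypothesis e0 : e != 0.
Local Notation thf := (thf p).
Local Notation gamf := (gamf k p).
Hypothesis s0 : thf true b e != 0.

Let c := gamf / thf true b e.
Let S j n := thf j (b * n%:Z) (e ^+ n).

Definition mult_num n := c ^+ (n ^ 2) * S false n.
Definition mult_den n := c ^+ (n ^ 2) * S true n / gamf.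

Let g0 : gamf != 0 := gamf_neq0 char2 odd_p.
Let charL := frac_pchar2 char2.

Let double n : b * n.*2%:Z = b * n%:Z * 2.
Proof. by rewrite -muln2 PoszM mulrA. Qed.

Lemma S_double_odd n : S false n ^+ 2 * S true n ^+ 2 = gamf * S true n.*2.
Proof.
rewrite /S double -muln2 exprM.
exact: (thf_double_odd char2 odd_p _ (expf_neq0 n e0)).
Qed.

Lemma S_double_even n : S false n.*2 = S false n ^+ 4 + S true n ^+ 4.
Proof.
rewrite /S double -muln2 exprM.
exact: (thf_double_even char2 odd_p).
Qed.

Lemma S_succ j n : S j n.*2.+1 * S j 1 =
  S false n.+1 ^+ 2 * S j n ^+ 2 + S true n.+1 ^+ 2 * S (~~ j) n ^+ 2.
Proof.
have := thfM char2 odd_p j (b * n.+1%:Z) (b * n%:Z) (expf_neq0 n.+1 e0) (expf_neq0 n e0).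
have -> : b * n.+1%:Z + b * n%:Z = b * n.*2.+1%:Z by rewrite -mulrDr; congr (_ * _); lia.
have -> : b * n.+1%:Z - b * n%:Z = b * 1%:Z by rewrite -mulrBr; congr (_ * _); lia.
have -> : e ^+ n.+1 * e ^+ n = e ^+ n.*2.+1 by rewrite -exprD; congr (_ ^+ _); lia.
have -> : e ^+ n.+1 / e ^+ n = e ^+ 1 by rewrite exprS mulfK ?expf_neq0 // expr1.
by [].
Qed.

Lemma multiplesP : multiples (gamf ^+ 4) (kap p b e) mult_num mult_den.
Proof.
have cS : c * S true 1 = gamf by rewrite /S mulr1 expr1; exact: divfK s0 _.
have -> : kap p b e = c * S false 1 by rewrite /S mulr1 expr1 /c /kap mulrAC.
apply: multiples_sequences => //.
- by rewrite /S mulr0 expr0 /thf theta_false_01 // rmorph1.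
- by apply/eqP; rewrite /S mulr0 expr0 thf_true_eq0 ?oner_eq0 // eqxx dvdz0.
- exact: S_double_odd.
- exact: S_double_even.
- exact: S_succ.
Qed.

Lemma mult_den_torsion n : (p%:Z %| b * n%:Z)%Z -> e ^+ n = 1 -> mult_den n = 0.
Proof.
move=> bn en; rewrite /mult_den; have -> : S true n = 0.
  by apply/eqP; rewrite /S en (thf_true_eq0 char2 odd_p _ (oner_neq0 k)) bn eqxx.
by rewrite mulr0 mul0r.
Qed.

Lemma kap_integral (A : idomainType) (D : A) (phi : {rmorphism A -> {fraction fps k}}) n :
    2%N \in [pchar A] -> phi D = gamf ^+ 4 -> odd n -> (p%:Z %| b * n%:Z)%Z -> e ^+ n = 1 ->
  integralOver phi (kap p b e).
Proof.
move=> charA phiD on bn en.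
have mu : multiples (phi D) (kap p b e) mult_num mult_den by rewrite phiD; exact: multiplesP.
exact: (torsion_integral charA mu (kap_neq0 char2 odd_p e0 s0) on (mult_den_torsion bn en)).
Qed.

End Multiples.

(** * Torsion points and Hecke operators *)

Section TorsionPoints.
Variable p : nat.
Local Notation h := (p./2).

(* The pair (b, a) stands for the p-torsion point z^a * y^b of the Tate curve,
   where x = y^p; one point is chosen in each pair of opposite points. *)
Definition pts : seq (nat * nat) :=
  [seq (0%N, a) | a <- iota 1 h] ++ [seq (b, a) | b <- iota 1 h, a <- iota 0 p].

Lemma ptsP b a : reflect ((b = 0%N /\ (0 < a <= h)%N) \/ ((0 < b <= h)%N /\ (a < p)%N)) ((b, a) \in pts).
Proof.
rewrite mem_cat; apply: (iffP orP) => -[H|H]; [left|right|left|right].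
- by case/mapP: H => a'; rewrite mem_iota => ? [-> ->]; split=> //; lia.
- by case/allpairsP: H => -[b' a'] /= [+ + [-> ->]]; rewrite !mem_iota; lia.
- by case: H => -> H; apply/mapP; exists a => //; rewrite mem_iota; lia.
- by case: H => H1 H2; apply/allpairsP; exists (b, a); split=> //=; rewrite mem_iota; lia.
Qed.

Lemma size_pts : odd p -> size pts = (p ^ 2)./2.
Proof.
move=> op; have pE : p = h.*2.+1 by rewrite -{1}(odd_double_half p) op.
rewrite size_cat size_map size_allpairs !size_iota -mulnn.
have -> : (p * p = (h + h * p).*2.+1)%N by move: pE; move: h => m; nia.
by rewrite /= uphalf_double.
Qed.

End TorsionPoints.

Section Modular.
Variables (k : fieldType) (emb : {rmorphism 'F_2 -> k}) (eta : k) (p : nat).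
Hypothesis eta_eq : eta ^+ 2 + eta + 1 = 0.
Hypothesis odd_p : odd p.

Let char2 : 2%N \in [pchar k] := F2_ext_pchar emb.
Let charL : 2%N \in [pchar {fraction fps k}] := frac_pchar2 char2.
Let p0 : (0 < p)%N := odd_gt0 odd_p.
Let eta0 : eta != 0 := eta_neq0 eta_eq.
Local Notation L := {fraction fps k}.

Definition rx : fps k := fsub emb 1 (4 * p * p) r.

(** The polynomial ring stands for Z/2[r], its variable being sent to r(x) with x = w^(4 p^2). *)
Definition phi : {poly 'F_2} -> L :=
  @tofrac (fps k) \o (horner_eval rx \o map_poly (in_alg (fps k) \o emb)).

HB.instance Definition _ := GRing.RMorphism.on phi.

Lemma phiE P : phi P = tofrac (fsub emb 1 (4 * p * p) (horner_alg r P)).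
Proof. by rewrite fsub_poly ?muln_gt0 ?p0. Qed.

Lemma phi_inj : injective phi.
Proof.
move=> P Q; rewrite !phiE => /eqP; rewrite tofrac_eq => /eqP /fsub_inj.
move=> /(_ _ (oner_neq0 k)); rewrite !muln_gt0 p0 => /(_ isT) /eqP.
rewrite -subr_eq0 -rmorphB => /eqP /r_transcendental /eqP.
by rewrite subr_eq0 => /eqP.
Qed.

Lemma thf_true_neq0 (b : int) (e : k) : e != 0 -> ~~ ((p%:Z %| b)%Z && (e == 1)) ->
  thf p true b e != 0.
Proof. by move=> e0; rewrite thf_true_eq0. Qed.

Lemma sqr_neq1 (e : k) : e != 1 -> e ^+ 2 != 1.
Proof. by move=> e1; rewrite sqrf_eq1 oppr_pchar2 // orbb. Qed.

Lemma kap_eta : kap p 0 eta = 1 + tofrac rx.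
Proof.
have e1 := eta_neq1 emb eta_eq.
rewrite kap_lambert //; last by rewrite thf_true_neq0 // negb_and e1 orbT.
  by rewrite (lambert_base emb eta_eq odd_p) rmorphD rmorph1.
by move=> n _; exact: sqr_neq1.
Qed.

Lemma quartic_relation (F : fieldType) (t g x : F) : 2%N \in [pchar F] -> t != 0 ->
  t = t ^+ 2 + g / t ^+ 2 -> t = 1 + x -> x * (x + 1) ^+ 3 = g.
Proof.
move=> charF t0 tE tx; have : (t - t ^+ 2) * t ^+ 2 = g.
  by rewrite {1}tE addrAC subrr add0r divfK // expf_neq0.
move=> <-; rewrite tx -[LHS](oppr_pchar2 charF); ring.
Qed.

(** Doubling sends the point eta to eta^2 = 1 / eta, its opposite, which has the same abscissa t. So
    t = t^2 + gam^4 / t^2 with t = 1 + r, a quartic equation for r. *)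
Lemma phi_D : phi ('X * ('X + 1) ^+ 3) = gamf k p ^+ 4.
Proof.
have e1 := eta_neq1 emb eta_eq.
have s0 : thf p true 0 eta != 0 by rewrite thf_true_neq0 // negb_and e1 orbT.
have -> : phi ('X * ('X + 1) ^+ 3) = tofrac rx * (tofrac rx + 1) ^+ 3.
  by rewrite rmorphM rmorphXn rmorphD rmorph1 /= phiE horner_algX.
apply: (quartic_relation charL (kap_neq0 char2 odd_p eta0 s0)).
  rewrite -(kap_double char2 odd_p eta0 s0) mul0r -(eta_inv eta_eq).
  by have := kapN odd_p 0 eta; rewrite oppr0.
exact: kap_eta.
Qed.

Section Points.
Variable z : k.
Hypothesis prime_p : prime p.
Hypothesis p_gt3 : (3 < p)%N.
Hypothesis pz : p.-primitive_root z.

Let z0 : z != 0.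
Proof.
apply: contra_eq_neq (prim_expr_order pz) => ->.
by rewrite expr0n gtn_eqF // eq_sym oner_eq0.
Qed.

Local Notation h := (p./2).
Local Notation pts := (pts p).

Let pE : p = h.*2.+1.
Proof. by rewrite -{1}(odd_double_half p) odd_p. Qed.

Definition kpt (j : nat) (q : nat * nat) : L := kap p (q.1 * j)%:Z (z ^+ (q.2 * j)).

Lemma pt_neq0 b a j : (b, a) \in pts -> (0 < j < p)%N ->
  thf p true (b * j)%:Z (z ^+ (a * j)) != 0.
Proof.
move=> /ptsP ba /andP[j0 jp]; apply: thf_true_neq0; first exact: expf_neq0.
have jN : ~~ (p %| j)%N by rewrite gtnNdvd.
rewrite dvdzE /= -(prim_order_dvd pz) !Euclid_dvdM // (negPf jN) !orbF.
by apply/andP => -[]; case: ba => -[b0 a0] pb pa; [move: pa|move: pb];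
  rewrite gtnNdvd //; lia.
Qed.

Lemma kpt_inj : {in pts &, injective (kpt 1)}.
Proof.
move=> [b a] [b' a'] q q'; rewrite /kpt !muln1 /= => E.
have p1 : (0 < 1 < p)%N by lia.
have := pt_neq0 q p1; have := pt_neq0 q' p1; rewrite !muln1 => s' s.
have ez a'' : z ^+ a'' != 0 by exact: expf_neq0.
have := kap_eq char2 odd_p (ez a) (ez a') s s' E.
have za (m n : nat) : (m < p)%N -> (n < p)%N -> (z ^+ m == z ^+ n) = (m == n).
  by move=> mp np; rewrite (eq_prim_root_expr pz) !modn_small.
rewrite !thf_true_eq0 ?mulf_neq0 ?invr_eq0 //.
have -> : (z ^+ a / z ^+ a' == 1) = (z ^+ a == z ^+ a').
  by rewrite -(inj_eq (mulIf (ez a'))) divfK // mul1r.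
rewrite -exprD -(prim_order_dvd pz); case/orP => /andP[].
  rewrite -PoszD dvdzE /= => pb paa.
  have b0 : (b + b' = 0)%N.
    by apply: contraTeq pb => bb; rewrite gtnNdvd //; move/ptsP: q; move/ptsP: q'; lia.
  by have := gtnNdvd (_ : 0 < a + a')%N (_ : a + a' < p)%N; rewrite paa; move/ptsP: q; move/ptsP: q'; lia.
move=> pb; have -> : b = b'.
  move: pb; rewrite dvdzE => pb; apply/eqP; apply: contraTeq pb => bb.
  by rewrite gtnNdvd //; move/ptsP: q; move/ptsP: q'; lia.
rewrite za => [/eqP -> //||]; move/ptsP: q; move/ptsP: q'; lia.
Qed.

End Points.

End Modular.

Lemma sum_fold (V : nmodType) (f : nat -> V) (n h : nat) : n = h.*2.+1 ->
  \sum_(j < n) f j = f 0%N + \sum_(1 <= j < h.+1) (f j + f (n - j)%N).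
Proof.
move=> ->; rewrite -(big_mkord xpredT) big_ltn // (big_cat_nat (n := h.+1)) //=; last by lia.
rewrite big_split /=; congr (_ + (_ + _)).
rewrite big_nat_rev /= -{1}[h.+1]add1n big_addn.
have -> : (h.*2.+1 - h = h.+1)%N by lia.
by apply: eq_big_nat => i /andP[_ ih]; congr f; lia.
Qed.

(** * Rational functions of the abscissa of a p-torsion point *)

Section TorsionValues.
Variables (k : fieldType) (emb : {rmorphism 'F_2 -> k}) (eta z : k) (p : nat).
Hypothesis eta_eq : eta ^+ 2 + eta + 1 = 0.
Hypothesis odd_p : odd p.
Hypothesis prime_p : prime p.
Hypothesis p_gt3 : (3 < p)%N.
Hypothesis pz : p.-primitive_root z.

Local Notation L := {fraction fps k}.
Local Notation A := {poly 'F_2}.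
Local Notation phi := (phi emb p).
Local Notation pts := (pts p).
Local Notation kpt := (kpt p z).
Local Notation h := (p./2).

Variable lift : {rmorphism {fraction A} -> L}.
Hypothesis liftE : forall a, lift (tofrac a) = phi a.

Let char2 : 2%N \in [pchar k] := F2_ext_pchar emb.
Let charL : 2%N \in [pchar L] := frac_pchar2 char2.
Let p0 : (0 < p)%N := odd_gt0 odd_p.
Let eta0 : eta != 0 := eta_neq0 eta_eq.
Let z0 : z != 0.
Proof.
apply: contra_eq_neq (prim_expr_order pz) => ->.
by rewrite expr0n gtn_eqF // eq_sym oner_eq0.
Qed.
Let pE : p = h.*2.+1.
Proof. by rewrite -{1}(odd_double_half p) odd_p. Qed.

Let ptN b a j : (b, a) \in pts -> (0 < j < p)%N -> thf p true (b * j)%:Z (z ^+ (a * j)) != 0.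
Proof. exact: (pt_neq0 emb eta_eq odd_p prime_p p_gt3 pz). Qed.

Definition xs := [seq kpt 1 q | q <- pts].

Lemma xs_uniq : uniq xs.
Proof.
rewrite map_inj_in_uniq; last exact: (kpt_inj emb eta_eq odd_p prime_p p_gt3 pz).
rewrite cat_uniq map_inj_uniq ?iota_uniq => [|x y [] //].
rewrite allpairs_uniq ?iota_uniq => [|//|//|[x1 x2] [y1 y2] _ _ [] -> -> //].
rewrite andbT; apply/hasPn => -[b a] /allpairsP[[b' a'] /= []].
rewrite mem_iota => b1 _ [-> _]; apply/mapP => -[a'' _ [b0]].
by move: b1; rewrite b0.
Qed.

Lemma kpt1_neq0 q : q \in pts -> kpt 1 q != 0.
Proof.
case: q => b a q; apply: (kap_neq0 char2 odd_p); first exact: expf_neq0.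
by apply: ptN => //; rewrite (ltn_trans _ p_gt3).
Qed.

(** The division polynomial is monic of degree (p^2 - 1) / 2, which is the number of pairs of
    opposite torsion points; their abscissas are distinct roots, hence all the roots. *)
Lemma torsion_poly : exists rho : {poly {fraction A}},
  map_poly lift rho = \prod_(x <- xs) ('X - x%:P).
Proof.
have charA : 2%N \in [pchar A] by rewrite (rmorph_pchar polyC) // pchar_Fp.
have [g [mg sg gE]] := division_poly_odd ('X * ('X + 1) ^+ 3) charA odd_p.
exists (map_poly (@tofrac A) g); rewrite -map_poly_comp.
rewrite (eq_map_poly (g := phi)) => [|a]; last exact: liftE.
have mG : map_poly phi g \is monic by exact: monic_map.
rewrite [LHS](@all_roots_prod_XsubC _ _ xs).
- by rewrite (monicP mG) scale1r.
- rewrite size_map size_pts // -sg size_map_poly_id0 //.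
  by rewrite (monicP mg) rmorph1 oner_eq0.
- apply/allP => x /mapP[[b a] q ->]; rewrite rootE.
  have p1 : (0 < 1 < p)%N by rewrite (ltn_trans _ p_gt3).
  have e0 : z ^+ (a * 1) != 0 by exact: expf_neq0.
  have := multiplesP char2 odd_p e0 (ptN q p1).
  rewrite -(phi_D emb eta_eq odd_p) => mu.
  have := gE _ _ _ _ _ mu (kpt1_neq0 q); rewrite (mult_den_torsion char2 odd_p).
  - by move/esym/eqP; rewrite expf_eq0.
  - by rewrite dvdz_mull.
  - by rewrite muln1 exprAC (prim_expr_order pz) expr1n.
- by rewrite uniq_rootsE xs_uniq.
Qed.

(** One polynomial must serve for all the torsion points. Polynomials are enough: by
    [rational_invr], inverses of nowhere vanishing functions are again of this kind. *)
Definition rational (f : nat * nat -> L) : Prop :=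
  exists R : {poly {fraction A}}, forall q, q \in pts -> (map_poly lift R).[kpt 1 q] = f q.

Lemma eq_rational f g : (forall q, q \in pts -> f q = g q) -> rational f -> rational g.
Proof. by move=> fg [R RE]; exists R => q q_in; rewrite RE // fg. Qed.

Lemma rational_const y : rational (fun=> lift y).
Proof. by exists y%:P => q _; rewrite map_polyC hornerC. Qed.

Lemma rational_add f g : rational f -> rational g -> rational (fun q => f q + g q).
Proof. by move=> [R RE] [S SE]; exists (R + S) => q q_in; rewrite rmorphD hornerD RE // SE. Qed.

Lemma rational_mul f g : rational f -> rational g -> rational (fun q => f q * g q).
Proof. by move=> [R RE] [S SE]; exists (R * S) => q q_in; rewrite rmorphM hornerM RE // SE. Qed.

Lemma rational_invr f : (forall q, q \in pts -> f q != 0) -> rational f ->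
  rational (fun q => (f q)^-1).
Proof.
move=> f0 [R RE]; have [rho rhoE] := torsion_poly.
have [|S SE] := @rational_inv _ _ lift rho xs rhoE R.
  by move=> _ /mapP[q q_in ->]; rewrite RE // f0.
by exists S => q q_in; rewrite SE ?RE // map_f.
Qed.

Lemma rational_kpt1 : rational (kpt 1).
Proof. by exists 'X => q _; rewrite map_polyX hornerX. Qed.

Lemma rational_sum (I : Type) (s : seq I) (f : I -> nat * nat -> L) :
  (forall i, rational (f i)) -> rational (fun q => \sum_(i <- s) f i q).
Proof.
move=> rf; elim: s => [|i s IHs].
  apply: eq_rational (rational_const 0) => q _; by rewrite big_nil rmorph0.
by apply: eq_rational (rational_add (rf i) IHs) => q _; rewrite big_cons.
Qed.

Lemma kpt_double q : q \in pts ->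
  kpt 2 q = kpt 1 q ^+ 2 + lift (tofrac ('X * ('X + 1) ^+ 3)) / kpt 1 q ^+ 2.
Proof.
case: q => b a q; have p1 : (0 < 1 < p)%N by rewrite (ltn_trans _ p_gt3).
have e0 : z ^+ (a * 1) != 0 by exact: expf_neq0.
have bE : (b * 1)%:Z * 2 = (b * 2)%:Z by rewrite muln1 PoszM.
have zE : (z ^+ (a * 1)) ^+ 2 = z ^+ (a * 2) by rewrite muln1 -exprM.
have := kap_double char2 odd_p e0 (ptN q p1).
by rewrite bE zE -(phi_D emb eta_eq odd_p) -liftE.
Qed.

Lemma kpt_sum_neq0 j q : q \in pts -> (0 < j)%N -> (j.+2 < p)%N -> kpt j.+1 q + kpt 1 q != 0.
Proof.
case: q => b a q j0 jp; have e0 n : z ^+ n != 0 by exact: expf_neq0.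
apply/eqP => /eqP; rewrite addr_eq0 (oppr_pchar2 charL) => /eqP E.
have s1 : (0 < 1 < p)%N by rewrite (ltn_trans _ p_gt3).
have sj : (0 < j.+1 < p)%N by rewrite (ltn_trans _ jp).
have := kap_eq char2 odd_p (e0 _) (e0 _) (ptN q sj) (ptN q s1) E.
have -> : (b * j.+1)%:Z + (b * 1)%:Z = (b * j.+2)%:Z by rewrite -PoszD; congr Posz; lia.
have -> : (b * j.+1)%:Z - (b * 1)%:Z = (b * j)%:Z by lia.
have -> : z ^+ (a * j.+1) * z ^+ (a * 1) = z ^+ (a * j.+2) by rewrite -exprD; congr (_ ^+ _); lia.
have -> : z ^+ (a * j.+1) / z ^+ (a * 1) = z ^+ (a * j).
  by rewrite mulnS addnC exprD muln1 mulfK.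
have sjj : (0 < j.+2 < p)%N by [].
have sj0 : (0 < j < p)%N by rewrite j0 (ltn_trans _ jp).
by rewrite (negPf (ptN q sjj)) (negPf (ptN q sj0)).
Qed.

Lemma kpt_succ j q : q \in pts -> (0 < j)%N -> (j.+2 < p)%N ->
  kpt j.+2 q = kpt j q + kpt j.+1 q * kpt 1 q / (kpt j.+1 q + kpt 1 q) ^+ 2.
Proof.
case: q => b a q j0 jp; have e0 n : z ^+ n != 0 by exact: expf_neq0.
have s1 : (0 < 1 < p)%N by rewrite (ltn_trans _ p_gt3).
have sj : (0 < j.+1 < p)%N by rewrite (ltn_trans _ jp).
have sjj : (0 < j.+2 < p)%N by [].
have sj0 : (0 < j < p)%N by rewrite j0 (ltn_trans _ jp).
have bE1 : (b * j.+1)%:Z + (b * 1)%:Z = (b * j.+2)%:Z by rewrite -PoszD; congr Posz; lia.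
have bE2 : (b * j.+1)%:Z - (b * 1)%:Z = (b * j)%:Z by lia.
have zE1 : z ^+ (a * j.+1) * z ^+ (a * 1) = z ^+ (a * j.+2) by rewrite -exprD; congr (_ ^+ _); lia.
have zE2 : z ^+ (a * j.+1) / z ^+ (a * 1) = z ^+ (a * j).
  by rewrite mulnS addnC exprD muln1 mulfK.
have := kap_addition char2 odd_p (e0 _) (e0 _) (ptN q sj) (ptN q s1).
rewrite bE1 bE2 zE1 zE2 => /(_ (ptN q sjj) (ptN q sj0)) <-.
by rewrite /kpt /= addrCA (addrr_pchar2 charL) addr0.
Qed.

Lemma rational_kpt j : (0 < j < p)%N -> rational (kpt j).
Proof.
case: j => // j /= jp; have r1 := rational_kpt1.
suff [] : rational (kpt j.+1) /\ ((j.+2 < p)%N -> rational (kpt j.+2)) by [].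
elim: j jp => [|j IHj] jp.
  split=> // _; have sq := rational_mul r1 r1.
  have nz q : q \in pts -> kpt 1 q * kpt 1 q != 0 by move=> q_in; rewrite mulf_neq0 ?kpt1_neq0.
  apply: eq_rational (rational_add sq (rational_mul (rational_const _) (rational_invr nz sq))).
  by move=> q q_in; rewrite kpt_double // expr2.
have [r1' r2'] := IHj (ltnW jp); split=> [|jp']; first exact: r2'.
have rs := rational_add (r2' jp) r1; have sq := rational_mul rs rs.
have nz q : q \in pts -> (kpt j.+2 q + kpt 1 q) * (kpt j.+2 q + kpt 1 q) != 0.
  by move=> q_in; rewrite mulf_neq0 ?kpt_sum_neq0.
apply: eq_rational (rational_add r1' (rational_mul (rational_mul (r2' jp) r1) (rational_invr nz sq))).
by move=> q q_in; rewrite (@kpt_succ j.+1) // expr2.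
Qed.

Let t : L := kap p 0 eta.

Lemma rational_t : rational (fun=> t).
Proof.
apply: eq_rational (rational_const (tofrac ('X + 1))) => q _.
by rewrite liftE /t (kap_eta emb eta_eq odd_p) rmorphD rmorph1 /= phiE // horner_algX addrC.
Qed.

Lemma eta_pow_p : eta ^+ p != 1.
Proof.
apply/eqP => ep; have := eta_neq1 emb eta_eq; apply/negP; rewrite negbK.
have p3 : coprime 3 p.
  by rewrite prime_coprime //; apply: contraTN p_gt3 => /(prime_nt_dvdP prime_p) <-.
have [u v uv _] := egcdnP p (isT : 0 < 3)%N.
rewrite (eqP p3) in uv; rewrite -[eta]expr1.
have := expr1n k u; rewrite -{1}(eta3 eta_eq) -exprM mulnC uv exprD.
by rewrite mulnC exprM ep expr1n mul1r => /eqP.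
Qed.

Lemma eta_z_neq1 m : eta * z ^+ m != 1 /\ eta / z ^+ m != 1.
Proof.
split; apply: contraNneq eta_pow_p => E; have := congr1 (fun x => x ^+ p) E.
  by rewrite expr1n exprMn exprAC (prim_expr_order pz) expr1n mulr1 => ->.
by rewrite expr1n expr_div_n exprAC (prim_expr_order pz) expr1n divr1 => ->.
Qed.

Lemma eta_z_neq0 m : eta * z ^+ m != 0 /\ eta / z ^+ m != 0.
Proof. by split; rewrite mulf_neq0 ?invr_eq0 ?expf_neq0. Qed.

Lemma thf_eta_neq0 (b : int) m :
  thf p true b (eta * z ^+ m) != 0 /\ thf p true b (eta / z ^+ m) != 0.
Proof.
have [n1 n2] := eta_z_neq1 m; have [m1 m2] := eta_z_neq0 m.
by split; rewrite (thf_true_neq0 emb) // negb_and ?n1 ?n2 orbT.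
Qed.

Lemma t_kpt_neq0 j q : q \in pts -> (0 < j < p)%N -> t + kpt j q != 0.
Proof.
case: q => b a q jp; apply/eqP => /eqP; rewrite addr_eq0 (oppr_pchar2 charL) => /eqP E.
have e0 : z ^+ (a * j) != 0 by exact: expf_neq0.
have s0 : thf p true 0 eta != 0 by have [] := thf_eta_neq0 0 0; rewrite expr0 mulr1.
have := kap_eq char2 odd_p eta0 e0 s0 (ptN q jp) E; rewrite add0r sub0r.
have [n1 _] := thf_eta_neq0 (b * j)%:Z (a * j); have [_ n2] := thf_eta_neq0 (- (b * j)%:Z) (a * j).
by rewrite (negPf n1) (negPf n2).
Qed.

Lemma kap_shiftn b n (e : k) : e != 0 -> kap p (b + n%:Z * p%:Z) e = kap p b e.
Proof.
move=> e0; elim: n => [|n IHn]; first by rewrite mul0r addr0.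
have E : b + n.+1%:Z * p%:Z = b + n%:Z * p%:Z + p%:Z.
  by rewrite -addn1 PoszD mulrDl mul1r addrA.
by rewrite E (kap_shift odd_p _ e0).
Qed.

Definition tors_sum (q : nat * nat) : L :=
  \sum_(j < p) kap p (q.1 * j)%:Z (eta * z ^+ (q.2 * j)).

(** Up to the period, (p - j) Q is - j Q. The addition law combines the abscissas of eta + j Q and
    eta - j Q into an expression in t and the abscissa of j Q. *)
Lemma tors_sumE q : q \in pts ->
  tors_sum q = t + \sum_(1 <= j < h.+1) t * kpt j q / (t + kpt j q) ^+ 2.
Proof.
case: q => b a q; rewrite /tors_sum.
rewrite (sum_fold (fun j => kap p (b * j)%:Z (eta * z ^+ (a * j))) pE) /=.
rewrite !muln0 expr0 mulr1; congr (_ + _); apply: eq_big_nat => j /andP[j0 jh].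
have jp : (0 < j < p)%N by rewrite j0 /= [X in (_ < X)%N]pE; lia.
have e0 : z ^+ (a * j) != 0 by exact: expf_neq0.
have s0 : thf p true 0 eta != 0 by have [] := thf_eta_neq0 0 0; rewrite expr0 mulr1.
have [n1 _] := thf_eta_neq0 (0 + (b * j)%:Z) (a * j).
have [_ n2] := thf_eta_neq0 (0 - (b * j)%:Z) (a * j).
rewrite -(kap_addition char2 odd_p eta0 e0 s0 (ptN q jp) n1 n2) add0r sub0r.
congr (_ + _); have [_ m2] := eta_z_neq0 (a * j).
rewrite -[RHS](kap_shiftn _ b m2).
have jp' : (j <= p)%N by have /andP[_ /ltnW] := jp.
have bE : - (b * j)%:Z + b%:Z * p%:Z = (b * (p - j))%:Z.
  by rewrite addrC -PoszM subzn ?leq_mul // mulnBr.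
have zE : z ^+ (a * (p - j)) = (z ^+ (a * j))^-1.
  apply: (mulIf e0); rewrite mulVf // -exprD -mulnDr subnK //.
  by rewrite exprM exprAC (prim_expr_order pz) expr1n.
by rewrite bE zE.
Qed.

Lemma rational_tors_sum : rational tors_sum.
Proof.
have rj j : (0 < j < p)%N -> rational (fun q => t * kpt j q / (t + kpt j q) ^+ 2).
  move=> jp; have rk := rational_kpt jp; have rs := rational_add rational_t rk.
  have sq := rational_mul rs rs.
  have nz q : q \in pts -> (t + kpt j q) * (t + kpt j q) != 0.
    by move=> q_in; rewrite mulf_neq0 ?t_kpt_neq0.
  apply: eq_rational (rational_mul (rational_mul rational_t rk) (rational_invr nz sq)).
  by move=> q _; rewrite expr2.
(* The guard on j is always true in this range; it makes every summand rational, as [rational_sum]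
   requires. *)
have : rational (fun q => \sum_(1 <= j < h.+1) if (0 < j < p)%N then t * kpt j q / (t + kpt j q) ^+ 2 else 0).
  apply: rational_sum => j; case: (boolP (0 < j < p)%N) => [/rj //|_].
  by apply: eq_rational (rational_const 0) => q _; rewrite rmorph0.
move=> /(rational_add rational_t); apply: eq_rational => q q_in.
rewrite tors_sumE //; congr (_ + _); apply: eq_big_nat => j /andP[j0 jh].
by rewrite j0 /= [X in (_ < X)%N]pE ifT //; lia.
Qed.

End TorsionValues.

Lemma sum_mulmod (V : nmodType) (f : nat -> V) (p c : nat) : coprime c p -> (0 < p)%N ->
  \sum_(j < p) f ((c * j) %% p)%N = \sum_(j < p) f j.
Proof.
move=> cp p0; pose s (j : 'I_p) := Ordinal (ltn_pmod (c * j) p0).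
have s_inj : injective s.
  move=> i j /(congr1 val) /= /eqP; wlog le_ij : i j / (i <= j)%N => [hw|].
    by case/orP: (leq_total i j) => [/hw//|/hw hji]; rewrite eq_sym => /hji.
  rewrite eq_sym eqn_mod_dvd ?leq_mul // -mulnBr Gauss_dvdr 1?coprime_sym // => dv.
  apply/val_inj/eqP; rewrite eqn_leq le_ij /= -subn_eq0; apply: contraTT dv => nz.
  by rewrite gtnNdvd ?lt0n //; move: (ltn_ord j); lia.
by rewrite [RHS](reindex_inj s_inj).
Qed.

(** * Stability of Z/2[r] under T_p *)

Section HeckeStable.
Variables (k : fieldType) (emb : {rmorphism 'F_2 -> k}) (eta z : k) (p : nat).
Hypothesis eta_eq : eta ^+ 2 + eta + 1 = 0.
Hypothesis odd_p : odd p.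
Hypothesis prime_p : prime p.
Hypothesis p_gt3 : (3 < p)%N.
Hypothesis pz : p.-primitive_root z.

Local Notation L := {fraction fps k}.
Local Notation A := {poly 'F_2}.
Local Notation phi := (phi emb p).
Local Notation pts := (pts p).
Local Notation kpt := (kpt p z).
Local Notation h := (p./2).
Local Notation tors_sum := (tors_sum eta z p).

Let char2 : 2%N \in [pchar k] := F2_ext_pchar emb.
Let charL : 2%N \in [pchar L] := frac_pchar2 char2.
Let p0 : (0 < p)%N := odd_gt0 odd_p.
Let eta0 : eta != 0 := eta_neq0 eta_eq.

Lemma kap_lambert_eta (b : int) m :
  kap p b (eta * z ^+ m) = tofrac (lambert p (4 * p) b (eta * z ^+ m)).
Proof.
have [n1 _] := eta_z_neq1 emb eta_eq prime_p p_gt3 pz m.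
have [n0 _] := eta_z_neq0 eta_eq odd_p pz m.
have [s _] := thf_eta_neq0 emb eta_eq odd_p prime_p p_gt3 pz b m.
apply: (kap_lambert char2 odd_p n0 _ s) => n _; exact: (sqr_neq1 emb n1).
Qed.

Lemma tors_sum_mu a : (0%N, a) \in pts ->
  tors_sum (0%N, a) = tofrac (1 + fsub emb 1 (4 * p * p * p) r).
Proof.
move=> /ptsP[[_ /andP[a0 ah]]|[//]].
have ap : coprime a p by rewrite coprime_sym prime_coprime // gtnNdvd //; lia.
rewrite /tors_sum /=.
rewrite (eq_bigr (fun j : 'I_p => kap p 0 (eta * z ^+ ((a * j) %% p)))) => [|j _]; last first.
  by rewrite mul0n (prim_expr_mod pz).
rewrite (sum_mulmod (fun j => kap p 0 (eta * z ^+ j)) ap p0).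
under eq_bigr => j _ do rewrite kap_lambert_eta.
rewrite -rmorph_sum /= (lambert_mu emb eta_eq odd_p pz) //.
by apply: contraTN p_gt3 => /(prime_nt_dvdP prime_p) <-.
Qed.

(** With b c = 1 modulo p, the multiple c Q generates the same subgroup and has first coordinate 1
    and root of unity z^(a c). The substitution j -> b j modulo p passes from one generator to the
    other. *)
Lemma tors_sum_cyclic b a c : coprime b p -> (b * c = 1 %[mod p])%N ->
  tors_sum (b, a) = tofrac (1 + fsub emb (z ^+ (a * c)) (4 * p) r).
Proof.
move=> bp bc; set l := z ^+ (a * c).
have lp : l ^+ p = 1 by rewrite exprAC (prim_expr_order pz) expr1n.
have lb j : l ^+ (b * j) = z ^+ (a * j).
  rewrite /l -exprM; apply/eqP; rewrite (eq_prim_root_expr pz); apply/eqP.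
  have -> : (a * c * (b * j) = a * j * (b * c))%N by ring.
  by rewrite -modnMmr bc modnMmr muln1.
rewrite /tors_sum /=.
rewrite (eq_bigr (fun j : 'I_p => kap p ((b * j) %% p)%:Z (eta * l ^+ ((b * j) %% p))))
  => [|j _]; last first.
  have [n0 _] := eta_z_neq0 eta_eq odd_p pz (a * j).
  rewrite (expr_mod _ lp) lb -[RHS](kap_shiftn odd_p _ ((b * j) %/ p) n0).
  by rewrite -PoszM -PoszD addnC -divn_eq.
rewrite (sum_mulmod (fun j => kap p j%:Z (eta * l ^+ j)) bp p0).
rewrite -(lambert_cyclic emb eta_eq odd_p lp) rmorph_sum /=.
by apply: eq_bigr => j _; rewrite /l -exprM kap_lambert_eta.
Qed.

Definition hecke_values : seq L :=
  tofrac (1 + fsub emb 1 (4 * p * p * p) r) ::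
  [seq tofrac (1 + fsub emb (z ^+ i) (4 * p) r) | i <- iota 0 p].

(** The coefficient of w^(4 p) tells the values apart: it is z^i for the one with index i, and 0 for
    the first, which is a series in w^(4 p^3). *)
Lemma hecke_values_uniq : uniq hecke_values.
Proof.
have c4 l : coefs (1 + fsub emb l (4 * p) r) (4 * p * 1) = l.
  rewrite coefsD coefs_fsub ?muln_gt0 ?p0 // coefs_r1 rmorph1 mul1r expr1 coefs1.
  by rewrite muln1 muln_eq0 (gtn_eqF p0) add0r.
rewrite /= map_inj_in_uniq ?iota_uniq ?andbT; last first.
  move=> i j; rewrite !mem_iota /= => ip jp /eqP; rewrite tofrac_eq => /eqP.
  move=> /(congr1 (fun f => coefs f (4 * p * 1))); rewrite !c4 => /eqP.
  by rewrite (eq_prim_root_expr pz) !modn_small // => /eqP.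
apply/mapP => -[i _] /eqP; rewrite tofrac_eq => /eqP.
move=> /(congr1 (fun f => coefs f (4 * p * 1))); rewrite c4 coefsD coefs1 muln1.
rewrite muln_eq0 (gtn_eqF p0) add0r /= gtnNdvd ?muln_gt0 ?p0 //; last first.
  by rewrite -mulnA ltn_Pmulr ?muln_gt0 ?p0 // (leq_trans (ltnW (ltnW p_gt3))) // leq_pmulr.
move=> /esym/eqP; rewrite expf_eq0 => /andP[_ /eqP zz].
by move: (prim_expr_order pz); rewrite zz expr0n gtn_eqF // => /eqP; rewrite eq_sym oner_eq0.
Qed.

(** The sum depends only on the subgroup generated: the (p^2 - 1) / 2 points of [pts] give just p +
    1 values, the point (0, 1) and the points (1, i) representing all the subgroups. *)
Lemma hecke_valuesE v : (v \in hecke_values) = (v \in [seq tors_sum q | q <- pts]).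
Proof.
have h1 : (0 < h)%N by rewrite half_gt0 (ltn_trans _ p_gt3).
have hp : (h < p)%N by rewrite ltn_half_double -addnn -[X in (X < _)%N]addn0 ltn_add2l.
rewrite inE; apply/orP/mapP => [[/eqP ->|/mapP[i]]|[[b a] q ->]].
- exists (0%N, 1%N); last by rewrite tors_sum_mu //; apply/ptsP; left; rewrite h1.
  by apply/ptsP; left; rewrite h1.
- rewrite mem_iota => /andP[_ ip] ->; exists (1%N, i).
    by apply/ptsP; right; rewrite h1 /= ip.
  by rewrite (@tors_sum_cyclic 1 i 1) ?coprime1n // muln1.
move/ptsP: (q) => [[b0 _]|[/andP[b0 bh] ap]].
  by left; rewrite b0 tors_sum_mu ?eqxx // -b0.
right; have bp : coprime b p by rewrite coprime_sym prime_coprime // gtnNdvd // (leq_ltn_trans bh).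
have [c _ cE] : exists2 c, True & (b * c = 1 %[mod p])%N.
  have [u u' uu _] := egcdnP p b0; exists u => //.
  by rewrite mulnC uu (eqP bp) modnMDl.
rewrite (tors_sum_cyclic _ bp cE); apply/mapP; exists ((a * c) %% p)%N.
  by rewrite mem_iota /= ltn_pmod.
by rewrite (prim_expr_mod pz).
Qed.

(** Each eta + j Q is killed by the odd integer 3 p, so its abscissa is a root of a monic division
    polynomial. *)
Lemma tors_sum_integral q : integralOver phi (tors_sum q).
Proof.
have charA : 2%N \in [pchar A] by rewrite (rmorph_pchar polyC) // pchar_Fp.
apply: big_ind => [|x y|j _]; [exact: integral0|exact: integral_add|].
have [n0 _] := eta_z_neq0 eta_eq odd_p pz (q.2 * j).
have [s _] := thf_eta_neq0 emb eta_eq odd_p prime_p p_gt3 pz (q.1 * j)%:Z (q.2 * j).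
have on : odd (3 * p) by rewrite oddM odd_p.
apply: (kap_integral char2 odd_p n0 s charA (phi_D emb eta_eq odd_p) on).
  by rewrite dvdzE abszM dvdn_mull // dvdn_mull.
move: (q.2 * j)%N => m; rewrite mulnC exprM exprMn exprAC (prim_expr_order pz) expr1n mulr1 -exprM.
by rewrite mulnC exprM (eta3 eta_eq) expr1n.
Qed.

Lemma fsub_T (f : fps 'F_2) : fsub emb 1 (4 * p * p) (T p f) =
  fsub emb 1 (4 * p * p * p) f + \sum_(i < p) fsub emb (z ^+ i) (4 * p) f.
Proof.
have d0 : (0 < 4 * p)%N by rewrite muln_gt0.
have d1 : (0 < 4 * p * p)%N by rewrite muln_gt0 d0.
by rewrite fsubD (fsub_Usub emb f d0 pz odd_p) (fsub_Vsub emb f d1 p0) addrC.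
Qed.

Lemma T_Zr f : Zr f -> Zr (T p f).
Proof.
case=> P _ <-; have [lift liftE] := frac_lift_ex (phi_inj (emb := emb) odd_p).
have [R RE] := rational_tors_sum eta_eq odd_p prime_p p_gt3 pz liftE.
have [rho rhoE] := torsion_poly eta_eq odd_p prime_p p_gt3 pz liftE.
have vsE v : (v \in hecke_values) = (v \in [seq (map_poly lift R).[x] | x <- xs z p]).
  rewrite hecke_valuesE -map_comp; congr (v \in _); apply/eq_in_map => q q_in.
  by rewrite /= RE.
have xs0 : (0 < size (xs z p))%N.
  rewrite size_map size_pts // half_gt0 -mulnn.
  by rewrite (leq_trans (ltnW (ltnW p_gt3))) // leq_pmulr.
have [Phi PhiE] := minpoly_values xs0 (xs_uniq emb eta_eq odd_p prime_p p_gt3 pz) rhoE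
  hecke_values_uniq vsE.
(* The values at hand are 1 + r_C, whence the shift by 1, which is its own inverse in characteristic
   2. *)
pose Q := P \Po ('X + 1%:P); pose inA (c : 'F_2) : {fraction A} := tofrac c%:P.
pose g := map_poly inA Q.
have gE : map_poly lift g = map_poly (@tofrac (fps k)) (map_poly (in_alg (fps k) \o emb) Q).
  rewrite -!map_poly_comp; apply: eq_map_poly => c /=.
  rewrite liftE -[LHS]/(tofrac (map_poly (in_alg (fps k) \o emb) c%:P).[rx emb p]).
  by rewrite map_polyC hornerC.
have ev l d : (0 < d)%N ->
    (map_poly lift g).[tofrac (1 + fsub emb l d r)] = tofrac (fsub emb l d (horner_alg r P)).
  move=> d0; rewrite gE horner_map fsub_poly // /Q map_comp_poly horner_comp; congr (tofrac _.[_]).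
  rewrite rmorphD /= map_polyX map_polyC /= !hornerE rmorph1 scale1r addrAC.
  by rewrite fps_addff // add0r.
(* An element of Z/2(r) by construction; its image is the sum of the P(r_C), that is, T_p of
   P(r). *)
pose y := ((g * Phi^`()) %% Phi)`_(size hecke_values).-1.
have yS : lift y = \sum_(v <- hecke_values) (map_poly lift g).[v].
  by rewrite -coef_map map_modp rmorphM /= -deriv_map PhiE -(sum_horner_roots _ hecke_values_uniq isT).
have yE : lift y = tofrac (fsub emb 1 (4 * p * p) (T p (horner_alg r P))).
  rewrite yS big_cons big_map ev ?muln_gt0 ?p0 // fsub_T rmorphD rmorph_sum /=; congr (_ + _).
  rewrite -[RHS](big_mkord xpredT (fun i => tofrac (fsub emb (z ^+ i) (4 * p) (horner_alg r P)))).
  rewrite /index_iota subn0; apply: eq_bigr => i _.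
  by rewrite ev // muln_gt0.
have : integralOver phi (lift y).
  rewrite yS big_seq; apply: big_ind => [|u v|v]; [exact: integral0|exact: integral_add|].
  rewrite hecke_valuesE => /mapP[q _ ->]; apply: integral_horner; last exact: tors_sum_integral.
  apply/integral_poly => i; rewrite coef_map /= /g coef_poly; case: ifP => _.
    by rewrite liftE; exact: integral_id.
  by rewrite rmorph0; exact: integral0.
case/(poly_integrally_closed (phi_inj (emb := emb) odd_p) liftE) => q yq.
exists q => //; apply/esym/(@fsub_inj _ emb 1 (4 * p * p)); rewrite ?muln_gt0 ?p0 ?oner_eq0 //.
by apply/eqP; rewrite -tofrac_eq -yE yq liftE -(phiE emb odd_p).
Qed.

End HeckeStable.

(** * The kernels of U_2 and of U_3 + I *)

Lemma F2_closure : exists (k : closedFieldType) (emb : {rmorphism 'F_2 -> k}) (eta : k),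
  eta ^+ 2 + eta + 1 = 0.
Proof.
have [K [emb _]] := countable_algebraic_closure 'F_2.
have /closed_rootP[x] : size ('X^2 + ('X + 1) : {poly K}) != 1%N.
  by rewrite size_polyDl size_polyXn // -[1]opprK -polyCN size_XsubC.
by rewrite rootE !hornerE => /eqP xE; exists K, emb, x; exact: xE.
Qed.

(** A root of 1 + X + ... + X^(p-1) has order dividing p, and it is not 1 because the value there is
    p, which is 1 for p odd. *)
Lemma closed_prim_root (k : closedFieldType) (emb : {rmorphism 'F_2 -> k}) (p : nat) :
  prime p -> odd p -> exists z : k, p.-primitive_root z.
Proof.
move=> prime_p op; have p1 := prime_gt1 prime_p.
have char2 := F2_ext_pchar emb.
pose P : {poly k} := \poly_(i < p) 1.
have sP : size P = p by rewrite size_poly_eq // oner_eq0.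
have /closed_rootP[z] : size P != 1%N by rewrite sP gtn_eqF.
rewrite rootE horner_poly => /eqP zP.
have zp : z ^+ p = 1.
  apply/eqP; rewrite -subr_eq0 subrX1; under eq_bigr => i _ do rewrite -[z ^+ i]mul1r.
  by rewrite zP mulr0.
have [m pm /(prime_nt_dvdP prime_p) mp] := prim_order_exists (ltnW p1) zp.
have [m1|/mp <-] := eqVneq m 1%N; last by exists z.
exfalso; have z1 : z = 1 by rewrite -[z]expr1 -m1 (prim_expr_order pm).
move: zP; rewrite z1; under eq_bigr => i _ do rewrite expr1n mulr1.
rewrite sumr_const card_ord -[p]odd_double_half op -mul2n mulrnDr mulrnA.
by rewrite (pcharf0 char2) mul0rn addr0 => /eqP; rewrite oner_eq0.
Qed.

Lemma T_Zr_prime (p : nat) f : prime p -> (3 < p)%N -> Zr f -> Zr (T p f).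
Proof.
move=> prime_p p_gt3; have [k [emb [eta eta_eq]]] := F2_closure.
have odd_p : odd p by have [p2|//] := even_prime prime_p; rewrite p2 in p_gt3.
have [z pz] := closed_prim_root emb prime_p odd_p.
exact: (T_Zr emb eta_eq odd_p prime_p p_gt3 pz).
Qed.

Lemma F2_pchar : 2%N \in [pchar 'F_2].
Proof. by rewrite pchar_Fp. Qed.

Lemma F2_sqr (a : 'F_2) : a ^+ 2 = a.
Proof. by case: a => [[|[|[]]]] // ?; apply/val_inj. Qed.

Lemma VsubE d : Vsub d = fsub (k := 'F_2) idfun 1 d.
Proof.
by apply/funext => f; apply: fpsP => n /=; case: ifP => // _; rewrite expr1n mulr1.
Qed.

Lemma Vsub2_sqr (f : fps 'F_2) : Vsub 2 f = f ^+ 2.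
Proof.
apply: fpsP => n; have [on|en] := boolP (odd n).
  by rewrite (fps_sqrr_odd F2_pchar) //= dvdn2 on.
by rewrite -(even_halfK en) -muln2 (fps_sqrr F2_pchar) F2_sqr /= dvdn_mull // mulnK.
Qed.

Lemma UsubD d : {morph Usub d : f g / f + g}.
Proof. by move=> f g; apply: fpsP. Qed.

Lemma Usub_Vsub d h f : (0 < d)%N -> Usub d (Vsub d h * f) = h * Usub d f.
Proof.
move=> d0; apply: fpsP => n; rewrite coefsM /= .
transitivity (\sum_(i < (d * n).+1 | (d %| i)%N) coefs h (i %/ d) * coefs f (d * n - i)).
  rewrite [RHS]big_mkcond /=; apply: eq_bigr => i _; case: ifP => // _; exact: mul0r.
rewrite (sum_dvdn n (fun i => coefs h (i %/ d) * coefs f (d * n - i))) //.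
by apply: eq_bigr => j _; rewrite mulKn // mulnBr.
Qed.

Lemma Vsub_horner d g P : (0 < d)%N -> Vsub d (horner_alg g P) = horner_alg (Vsub d g) P.
Proof. by move=> d0; rewrite VsubE fsub_poly. Qed.

Lemma Usub1 d : (0 < d)%N -> Usub d 1 = 1 :> fps 'F_2.
Proof. by move=> d0; apply: fpsP => n; rewrite /= muln_eq0 (gtn_eqF d0). Qed.

Lemma Usub_sqr d (f : fps 'F_2) : odd d -> Usub d (f ^+ 2) = Usub d f ^+ 2.
Proof.
move=> od; apply: fpsP => n; rewrite -[LHS]/(coefs (f ^+ 2) (d * n)).
have [on|en] := boolP (odd n).
  by rewrite !(fps_sqrr_odd F2_pchar) // oddM od.
by rewrite -(even_halfK en) -muln2 mulnA !(fps_sqrr F2_pchar).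
Qed.

Lemma Usub_sum d (I : Type) (s : seq I) (f : I -> fps 'F_2) :
  Usub d (\sum_(i <- s) f i) = \sum_(i <- s) Usub d (f i).
Proof.
elim: s => [|i s IHs]; rewrite ?big_nil ?big_cons ?UsubD ?IHs //.
Qed.

(* The reduction mod 2 of the discriminant cusp form. *)
Definition odd_squares : fps 'F_2 := Fps (fun n => (odd n && is_sq 1 n)%:R).

Lemma gam1_quartic (k : fieldType) (emb : {rmorphism 'F_2 -> k}) :
  gam k 1 ^+ 4 = fsub emb 1 4 odd_squares.
Proof.
have char2 := F2_ext_pchar emb.
pose P := [set m : int | odd `|m| /\ 0 < m].
have lfP c : (0 < c)%N -> lfin P (fun m => mono (1 : k) (`|1%:Z * m| ^ 2 * c)).
  move=> c0; apply: lfin_mono => N; have o1 : odd 1 by [].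
  apply: sub_finite_set (fin_theta o1 P 0 N) => m [Pm le]; split=> //.
  by rewrite mulr0 addr0; apply: leq_trans le; rewrite leq_pmulr.
have lf1 : lfin P (fun m => mono (1 : k) (`|1%:Z * m| ^ 2)).
  by have := lfP 1%N isT; apply: eq_lfin => m _; rewrite muln1.
have -> : gam k 1 ^+ 4 = fsum P (fun m => mono (1 : k) (`|1%:Z * m| ^ 2 * 2 * 2)).
  rewrite /gam (exprM _ 2 2) (fsum_sqr char2 lf1).
  rewrite (@eq_fsum _ _ _ _ (fun m => mono 1 (`|1%:Z * m| ^ 2 * 2))) => [|m _]; last first.
    by rewrite monoX expr1n.
  rewrite (fsum_sqr char2 (lfP 2%N isT)); apply: eq_fsum => m _.
  by rewrite monoX expr1n.
apply: fpsP => N; have [[n [on NE]]|nex] := pselect (exists n, odd n /\ N = (4 * n ^ 2)%N).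
  rewrite NE coefs_fsub // expr1n mulr1 /= oddX on /= /is_sq.
  case: asboolP => [_|nex]; last first.
    by case: nex; exists n; rewrite mul1n; split=> //; exact: odd_gt0 on.
  rewrite rmorph1 (fsum_eq_seq (X := [:: n%:Z])) //.
  - rewrite big_seq1 (_ : `|(1%:Z * n%:Z)%R|%N = n); last by lia.
    by case: eqP => [_|[]]; [rewrite mulr1n rmorph1|lia].
  - by move=> i; rewrite inE => /eqP->; split; [|have := odd_gt0 on; lia].
  - move=> i [oi i0]; case: ifP => [/eqP nE _|_]; last by rewrite eqxx.
    rewrite inE; apply/eqP; move: nE; rewrite mul1r.
    have -> : (`|i| ^ 2 * 2 * 2 = 4 * `|i| ^ 2)%N by lia.
    by move/eqP; rewrite eqn_pmul2l // eqn_exp2r // => /eqP ->; lia.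
rewrite /= fsbig1 => [|m [om m0]]; last first.
  case: eqP => // nE; case: nex; exists `|m|%N; split=> //.
  by rewrite nE mul1r; lia.
case: ifP => // /dvdnP[q qE]; rewrite qE mulnK // /is_sq.
case: asboolP => [[n [n0 nE]]|_]; last by rewrite andbF rmorph0 mul0r.
rewrite andbT; case: (boolP (odd q)) => [oq|_]; last by rewrite rmorph0 mul0r.
case: nex; exists n; split; last by rewrite qE nE mul1n mulnC.
by move: oq; rewrite nE mul1n oddX.
Qed.

(** This is [phi_D] for p = 1, where x = w^4 and gam^4 is the sum of the x^(m^2) over odd m > 0. *)
Lemma F_odd_squares : F = odd_squares.
Proof.
have [k [emb [eta eta_eq]]] := F2_closure; have o1 : odd 1 by [].
have := phi_D emb eta_eq o1; rewrite phiE // /gamf -rmorphXn (gam1_quartic emb) => /eqP.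
rewrite tofrac_eq => /eqP /fsub_inj; rewrite oner_eq0 => /(_ isT isT) <-.
by rewrite rmorphM rmorphXn rmorphD rmorph1 /= horner_algX.
Qed.

(** In even degrees r^2 and r agree, since U_2 fixes r and squaring over Z/2 doubles exponents. In
    odd degrees r^2 vanishes and r keeps the odd squares and their triples. *)
Lemma r_sqr_r : r ^+ 2 + r = odd_squares + Vsub 3 odd_squares.
Proof.
apply: fpsP => n; rewrite !coefsD; have [on|en] := boolP (odd n); last first.
  rewrite -(even_halfK en) -muln2 (fps_sqrr F2_pchar) F2_sqr.
  have -> : coefs r (n./2 * 2) = coefs r n./2 by rewrite -[in RHS]Usub2_r /= mulnC.
  rewrite F2_addrr /= oddM andbF add0r; case: ifP => // /dvdnP[q qE].
  have eq : ~~ odd q by have := congr1 odd qE; rewrite !oddM andbT andbF => <-.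
  by rewrite qE mulnK // (negPf eq).
rewrite (fps_sqrr_odd F2_pchar _ on) add0r coefs_r !big_cons big_nil /= on /=.
have -> : is_sq 2 n = false by apply/negP => /is_sq_dvdn; rewrite dvdn2 on.
have -> : is_sq 6 n = false.
  by apply/negP => /is_sq_dvdn /(dvdn_trans (isT : 2 %| 6)%N); rewrite dvdn2 on.
rewrite !addr0 add0r; congr (_ + _); case: ifP => [/dvdnP[q qE]|d3]; last first.
  have -> // : is_sq 3 n = false by apply: contraFF d3 => /is_sq_dvdn.
rewrite qE mulnK // mulnC (is_sqM 1 q (isT : 0 < 3)%N).
by have := on; rewrite qE oddM => /andP[-> _].
Qed.

Lemma G_F : G = F + (r ^+ 2 + r).
Proof.
have -> : G = F + (r ^+ 2 + r) + (- (r ^+ 3 + r ^+ 2 *+ 2 + r) *+ 2) by rewrite /G /F; ring.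
by rewrite mulr2n (fps_addff F2_pchar) addr0.
Qed.

Lemma G_Vsub : G = Vsub 3 F.
Proof.
by rewrite G_F r_sqr_r F_odd_squares addrA (fps_addff F2_pchar) add0r.
Qed.

Lemma Usub_F : Usub 3 G = F.
Proof. by rewrite G_Vsub -[Vsub 3 F]mulr1 Usub_Vsub // Usub1 // mulr1. Qed.

(** From r^3 = r^4 + G, where U_3 fixes r^4 and sends G to F, the value is r^4 + F. *)
Lemma Usub3_cube : Usub 3 (r ^+ 3) = r ^+ 3 + r ^+ 2 + r.
Proof.
have GE : G = r ^+ 2 ^+ 2 + r ^+ 3 by rewrite /G; ring.
have cubeE : r ^+ 3 = r ^+ 2 ^+ 2 + G by rewrite GE addrA (fps_addff F2_pchar) add0r.
rewrite [in LHS]cubeE UsubD Usub_F !Usub_sqr // Usub3_r /F.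
have -> : r * (r + 1) ^+ 3 = r ^+ 2 ^+ 2 + r ^+ 3 + r ^+ 2 + r + (r ^+ 3 + r ^+ 2) *+ 2 by ring.
by rewrite mulr2n (fps_addff F2_pchar) addr0 !addrA (fps_addff F2_pchar) add0r.
Qed.

Lemma U_Usub3 f : Zr f -> U f = Usub 3 f.
Proof.
case/Zr_basis => g ->; rewrite UE Usub_sum; apply: eq_bigr => i _.
rewrite (_ : horner_alg G (g i) = Vsub 3 (horner_alg F (g i))); last first.
  by rewrite Vsub_horner // -G_Vsub.
rewrite Usub_Vsub //; congr (_ * _).
case: i => [[|[|[|[|i]]]]] //= _; rewrite ?expr0 ?expr1.
- by rewrite Usub1.
- by rewrite Usub3_r.
- by rewrite Usub_sqr // Usub3_r.
- by rewrite Usub3_cube.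
Qed.

Lemma horner_alg_comp (f : fps 'F_2) (P Q : {poly 'F_2}) :
  horner_alg f (P \Po Q) = horner_alg (horner_alg f Q) P.
Proof.
elim/poly_ind: P => [|P c IHP]; first by rewrite comp_poly0 !rmorph0.
rewrite comp_polyD comp_polyM comp_polyX comp_polyC.
rewrite [LHS]rmorphD [RHS]rmorphD [X in X + _]rmorphM [X in _ = X + _]rmorphM /=.
by rewrite IHP horner_algX !horner_algC.
Qed.

Lemma horner_alg_sqr (P : {poly 'F_2}) : horner_alg (r ^+ 2) P = Vsub 2 (horner_alg r P).
Proof. by rewrite Vsub_horner // Vsub2_sqr. Qed.

(** Splitting P into its even and odd parts gives f = a(r)^2 + (r^2 + r) g(r^2). As U_2 sends both
    r^2 and r to r, it kills the second summand, and it sends the first to a(r); so U_2 f = 0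
    exactly when a = 0. *)
Lemma ModdE f : Modd f <-> Zr f /\ Usub 2 f = 0.
Proof.
split=> [[g _ <-]|[[P _ <-] UP]].
  split.
    exists (('X ^+ 2 + 'X) * (g \Po 'X^2)) => //.
    rewrite rmorphM /= horner_alg_comp (rmorphXn (horner_alg r)) rmorphD.
    by rewrite (rmorphXn (horner_alg r)) /= horner_algX.
  rewrite horner_alg_sqr mulrC Usub_Vsub // UsubD -Vsub2_sqr -[Vsub 2 r]mulr1.
  by rewrite Usub_Vsub // Usub1 // Usub2_r mulr1 (fps_addff F2_pchar) mulr0.
pose a := even_poly P + 'X * odd_poly P.
have PE : horner_alg r P = Vsub 2 (horner_alg r a) +
    (r ^+ 2 + r) * horner_alg (r ^+ 2) (odd_poly P).
  rewrite -{1}[P]poly_even_odd -horner_alg_sqr /a.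
  rewrite (rmorphD (horner_alg r)) (rmorphM (horner_alg r)) /= !horner_alg_comp.
  rewrite (rmorphXn (horner_alg r)) /= horner_algX.
  rewrite (rmorphD (horner_alg (r ^+ 2))) (rmorphM (horner_alg (r ^+ 2))) /= horner_algX.
  rewrite mulrDl -addrA; congr (_ + _).
  by rewrite addrA (fps_addff F2_pchar) add0r mulrC.
have a0 : a = 0.
  apply: r_transcendental; rewrite -UP PE UsubD -[Vsub 2 _]mulr1 Usub_Vsub // Usub1 // mulr1.
  rewrite horner_alg_sqr mulrC Usub_Vsub // UsubD -Vsub2_sqr -[Vsub 2 r]mulr1.
  by rewrite Usub_Vsub // Usub1 // Usub2_r mulr1 (fps_addff F2_pchar) mulr0 addr0.
exists (odd_poly P) => //; rewrite PE a0 rmorph0 Vsub2_sqr expr0n add0r //.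
Qed.

Lemma KE : K = [set f | Zr f /\ Usub 2 f = 0 /\ Usub 3 f = f].
Proof.
apply/seteqP; split=> f /=.
  by case=> /ModdE[Zf U2] Uf; rewrite -U_Usub3.
by case=> Zf [U2 U3]; split; [apply/ModdE|rewrite U_Usub3].
Qed.

Lemma T_Usub p q f : coprime q p -> (0 < p)%N -> T p (Usub q f) = Usub q (T p f).
Proof.
move=> qp p0; apply: fpsP => n /=; rewrite mulnCA; congr (_ + _).
rewrite Gauss_dvdr 1?coprime_sym //; case: ifP => // pn.
by rewrite muln_divA.
Qed.

Theorem theorem4p6 :
  K = [set f | Zr f /\ Usub 2 f = 0 /\ Usub 3 f = f] /\
  (forall p : nat, prime p -> (3 < p)%N -> T p @` K `<=` K).
Proof.
split=> [|p prime_p p_gt3 _ [f Kf <-]]; first exact: KE.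
move: Kf; rewrite KE => -[Zf [U2f U3f]]; split; first exact: T_Zr_prime.
have cop q : prime q -> (q <= 3)%N -> coprime q p.
  move=> prime_q q3; rewrite prime_coprime // dvdn_prime2 // ltn_eqF //.
  exact: leq_ltn_trans p_gt3.
have p0 := prime_gt0 prime_p.
rewrite -!T_Usub ?cop // U2f U3f; split=> //.
by apply: fpsP => n /=; rewrite if_same addr0.
Qed.
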